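(* For $n\in\mathbb{N}$, $n\ge 1$, let $b_n=(1-2^{-[\log_2 n]})\,e^{2\pi i n 2^{-[\log_2 n]}}$ and $\mathbf{b}=(b_n)_{n=1}^\infty$. Then there is an absolute constant $C>0$ such that for every $f\in L^2(\mathbb{T})$, $$\|T^{\mathbf{b}}f\|_{L^2(\mathbb{T})}\le C\,\|f\|_{L^2(\mathbb{T})},$$ where $T^{\mathbf{b}}$ is the maximal partial sum operator of the Malmquist-Takenaka system $(\phi_n)_{n\ge0}$ associated to $\mathbf{b}$. In particular, for every $f\in L^2(\mathbb{T})$ the Malmquist-Takenaka series with partial sums $\sum_{j=0}^n\langle f,\phi_j\rangle\phi_j(e^{ix})$ converges, as $n\to\infty$, for almost every point of $\mathbb{T}$.
   Context: $\mathbb{T}$ is the unit circle, $[x]$ is the integer part of $x$, and $\langle f,g\rangle=\frac1{2\pi}\int_{-\pi}^{\pi} f(e^{i\theta})\overline{g(e^{i\theta})}\,d\theta$ is the inner product of $L^2(\mathbb{T})$. For a sequence $\mathbf{a}=(a_n)_{n=1}^{\infty}$ of points of the open unit disk, the Blaschke products are $B_0=1$ and $$B_n(z)=\prod_{j=1}^n \frac{\overline{a_j}}{|a_j|}\,\frac{z-a_j}{1-\overline{a_j}z},$$ where the unimodular factor $\overline{a_j}/|a_j|$ is read as $1$ when $a_j=0$, and the associated Malmquist-Takenaka (MT) system is $$\phi_n(z)=B_n(z)\,\frac{\sqrt{1-|a_{n+1}|^2}}{1-\overline{a_{n+1}}z},\qquad n\ge 0 .$$ The maximal partial sum operator is $$T^{\mathbf{a}}f(x)=\sup_{n\ge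 0}\left|\sum_{j=0}^n\langle f,\phi_j\rangle\,\phi_j(e^{ix})\right| ,$$ regarded as a function on $\mathbb{T}$ via $x\mapsto e^{ix}$. *)

(* Defs.v *)
From HB Require Import structures.
From mathcomp Require Import all_boot all_order all_algebra.
From mathcomp Require Import all_classical all_reals all_analysis.
From mathcomp Require Import complex.
Set Implicit Arguments.
Unset Strict Implicit.
Unset Printing Implicit Defensive.
Import Order.TTheory GRing.Theory Num.Theory.
Import numFieldNormedType.Exports.
Local Open Scope classical_set_scope.
Local Open Scope ring_scope.
Local Open Scope complex_scope.

Section Circle.
Variable R : realType.
Implicit Types (f g : R[i] -> R[i]) (a : nat -> R[i]) (z : R[i]) (x t : R).

Definition cis t : R[i] := cos t +i* sin t.

Definition cintegral (D : set R) (h : R -> R[i]) : R[i] :=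
  (\int[lebesgue_measure]_(t in D) complex.Re (h t))
    +i* (\int[lebesgue_measure]_(t in D) complex.Im (h t)).

(* Functions on the unit circle are given on the whole plane, but are only ever
   evaluated at the points cis t. *)
Definition inner f g : R[i] :=
  ((2 * pi)^-1)%:C *
  cintegral `[- pi, pi] (fun t => f (cis t) * (g (cis t))^*).

Definition L2norm (h : R -> \bar R) : \bar R :=
  (((2 * pi)^-1)%:E *
    \int[lebesgue_measure]_(t in `[(- pi)%R, pi%R]) (`|h t| ^+ 2))%E `^ 2^-1.

Definition L2norm_circle f : \bar R := L2norm (fun t => (Normc.normc (f (cis t)))%:E).

(* Every class in L^2 of the circle has a Borel representative, and by periodicity
   measurability on R amounts to measurability on [- pi, pi]. *)
Definition L2_circle f : Prop :=
  [/\ measurable_fun setT (fun t => complex.Re (f (cis t))),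
      measurable_fun setT (fun t => complex.Im (f (cis t))) &
      (L2norm_circle f < +oo)%E].

Definition unimodular z : R[i] := if z == 0 then 1 else z^* / `|z|.

(* Sequences of points are indexed from 1; the value a 0 is never used. *)
Definition blaschke a (n : nat) z : R[i] :=
  \prod_(1 <= j < n.+1) (unimodular (a j) * ((z - a j) / (1 - (a j)^* * z))).

Definition MT a (n : nat) z : R[i] :=
  blaschke a n z *
  ((Num.sqrt (1 - Normc.normc (a n.+1) ^+ 2))%:C / (1 - (a n.+1)^* * z)).

Definition MT_partial_sum a f (n : nat) x : R[i] :=
  \sum_(0 <= j < n.+1) inner f (MT a j) * MT a j (cis x).

Definition MT_maximal a f x : \bar R :=
  ereal_sup (range (fun n : nat => (Normc.normc (MT_partial_sum a f n x))%:E)).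

(* trunc_log 2 n is the integer part of log_2 n, see floor_log2 below. *)
Definition dyadic_points (n : nat) : R[i] :=
  (1 - 2 ^- trunc_log 2 n)%:C * cis (2 * pi * n%:R * 2 ^- trunc_log 2 n).

End Circle.

Lemma floor_log2 (R : realType) (n : nat) : (0 < n)%N ->
  Num.floor (ln (n%:R : R) / ln 2) = (trunc_log 2 n)%:Z.
Proof.
move=> n0; apply/floor_def.
have l2 : 0 < ln (2 : R) by rewrite ln_gt0// ltr1n.
have /andP[lo hi] := trunc_log_bounds (isT : (1 < 2)%N) n0.
have lnX k : ln ((2 ^ k)%:R : R) = k%:R * ln 2.
  by rewrite natrX lnXn// mulr_natl.
have -> : (trunc_log 2 n)%:Z + 1 = (trunc_log 2 n).+1%:Z by rewrite intS addrC.
rewrite ler_pdivlMr// ltr_pdivrMr// -!pmulrn -!lnX.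
rewrite ler_ln ?ltr_ln ?posrE ?ltr0n ?expn_gt0// ler_nat ltr_nat.
by rewrite lo hi.
Qed.

(* Main.v *)
Require Import Defs.
From mathcomp Require Import all_boot all_order all_algebra.
From mathcomp Require Import all_classical all_reals all_analysis.
From mathcomp Require Import complex measurable_realfun ring lra zify.

(** The points come in levels: level k consists of 2^k equispaced points of modulus
    r_k = 1 - 2^-k. Inside a level and from level to level, truncating the expansion
    F = sum_j c_j phi_j is compared with Poisson averages of |F|, for different
    reasons.

    Inside a level. Take half a level, so that the points lie on a half circle, and
    a point x of the circle beyond the points kept. Put z = rho x, with 1 - rho of the
    order of the distance from x to the nearest point kept, and let B be the Blaschke
    product of the points kept. Against the Poisson kernel at z, the density
    1 - B(z) B^* annihilates the terms dropped, because they are multiples of B, and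
    it reproduces 1 - |B(z)|^2 times the truncated sum at x up to an error that is
    itself a Poisson-like sum of the |c_j| ([truncating_functional], [cotlar_core]).
    Equispacing makes 1 - |B(z)|^2 bounded below ([blaschke_small]), so that the
    truncated sum is controlled ([one_sided]). If x lies beyond the points dropped
    instead, conjugation reverses the order of the points ([psum_reverse]). What
    remains is the Poisson maximal function. On the scale of N equal arcs it is an
    operator on sequences of length N, bounded in square mean by a TT* argument: the
    composition of two Poisson kernels is dominated by their sum ([dpoisson_comp],
    [discrete_maximal]). This gives [half_level_maximal].

    From level to level. Let E_k be the sum over the levels before k. The Blaschke
    product of a whole level is a single factor in z^(2^l), so on |z| = r_k the product
    of the levels before l decays geometrically in l - k when l >= k
    ([blaschke_upper]), and the product of the levels up to l differs from a
    unimodular function by O(2^(l-k)) when l < k ([blaschke_lower]). Hence E_k differs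
    from the dilation F(r_k x) by contributions of the levels l that are geometrically
    small in |k - l| in square mean; for l < k this uses the reflection in the circle
    and the Parseval identity. The dilations are Poisson averages again, so the maximal
    function of the E_k is bounded in square mean ([lacunary_maximal]).

    A general partial sum is some E_k plus an initial part of level k. The squares of
    the maximal functions of the half levels may simply be added, since their
    coefficients are disjoint ([finite_maximal]). The Bessel inequality and monotone
    convergence extend the bound to L^2, and the bound for the tails of the expansion
    gives convergence almost everywhere. *)

Set Implicit Arguments.
Unset Strict Implicit.
Unset Printing Implicit Defensive.
Import Order.TTheory GRing.Theory Num.Theory.
Import numFieldNormedType.Exports.
Local Open Scope classical_set_scope.
Local Open Scope complex_scope.
Local Open Scope ring_scope.
Local Notation normc := Normc.normc.

(** * Complex modulus and points of the circle *)

Section ComplexNorm.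
Variable R : realType.
Implicit Types (z w : R[i]) (x t : R).

Lemma conjD z w : (z + w)^* = z^* + w^*.
Proof. exact: rmorphD. Qed.

Lemma conjB z w : (z - w)^* = z^* - w^*.
Proof. exact: rmorphB. Qed.

Lemma conjM z w : (z * w)^* = z^* * w^*.
Proof. exact: rmorphM. Qed.

Lemma conj_sum (I : Type) (r : seq I) (P : pred I) (F : I -> R[i]) :
  (\sum_(i <- r | P i) F i)^* = \sum_(i <- r | P i) (F i)^*.
Proof. exact: rmorph_sum. Qed.

Lemma conj1 : (1 : R[i])^* = 1.
Proof. exact: rmorph1. Qed.

Lemma conjV z : (z^-1)^* = (z^*)^-1.
Proof. exact: fmorphV. Qed.

Lemma conj_real x : (x%:C)^* = x%:C :> R[i].
Proof. exact: conjc_real. Qed.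

Lemma conjN z : (- z)^* = - z^*.
Proof. exact: rmorphN. Qed.

Definition conjE := (conjD, conjN, conjM, conjV, conj1, @conjCK R[i], conj_real).

Lemma complexRB x t : (x - t)%:C = x%:C - t%:C :> R[i].
Proof. exact: rmorphB. Qed.

Lemma complexRM x t : (x * t)%:C = x%:C * t%:C :> R[i].
Proof. exact: rmorphM. Qed.

Lemma normc_ge0 z : 0 <= normc z.
Proof. by case: z => a b; rewrite /= sqrtr_ge0. Qed.

Lemma normcD z w : normc (z + w) <= normc z + normc w.
Proof. exact: le_normcD. Qed.

Lemma normcN z : normc (- z) = normc z.
Proof. exact: complex.normcN. Qed.

Lemma normcM z w : normc (z * w) = normc z * normc w.
Proof. exact: Normc.normcM. Qed.

Lemma normcV z : normc z^-1 = (normc z)^-1.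
Proof. exact: Normc.normcV. Qed.

Lemma normc0 : normc (0 : R[i]) = 0.
Proof. exact: Normc.normc0. Qed.

Lemma normc1 : normc (1 : R[i]) = 1.
Proof. exact: Normc.normc1. Qed.

Lemma normc_eq0 z : (normc z == 0) = (z == 0).
Proof.
by apply/eqP/eqP => [/Normc.eq0_normc//|->]; rewrite normc0.
Qed.

Lemma normc_gt0 z : (0 < normc z) = (z != 0).
Proof. by rewrite lt_neqAle normc_ge0 eq_sym normc_eq0 andbT. Qed.

Lemma normcJ z : normc z^* = normc z.
Proof. by case: z => a b /=; rewrite sqrrN. Qed.

Lemma normcX z n : normc (z ^+ n) = normc z ^+ n.
Proof. by elim: n => [|n IH]; rewrite ?normc1// !exprS normcM IH. Qed.

Lemma normc_real x : normc x%:C = `|x|.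
Proof. by rewrite /= expr0n addr0 sqrtr_sqr. Qed.

Lemma sqr_normcE z : normc z ^+ 2 = complex.Re z ^+ 2 + complex.Im z ^+ 2.
Proof. by case: z => a b /=; rewrite sqr_sqrtr// addr_ge0// sqr_ge0. Qed.

Lemma sqr_normcC z : (normc z ^+ 2)%:C = z * z^*.
Proof.
rewrite sqr_normcE; case: z => a b /=; apply/eqP.
by rewrite eq_complex /=; apply/andP; split; apply/eqP; ring.
Qed.

Lemma mulr_normcC z : (normc z)%:C * (normc z)%:C = z * z^*.
Proof. by rewrite -sqr_normcC expr2 rmorphM. Qed.

Lemma normc_distC z w : normc (z - w) = normc (w - z).
Proof. by rewrite -normcN opprB. Qed.

Lemma normcB z w : normc (z - w) <= normc z + normc w.
Proof. by rewrite -(normcN w) normcD. Qed.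

Lemma lerB_normc z w : normc z - normc w <= normc (z - w).
Proof. by rewrite lerBlDr -{1}(subrK w z) normcD. Qed.

Lemma normc_triangle w z v : normc (z - v) <= normc (z - w) + normc (w - v).
Proof. by rewrite -[z - v](subrKA w) normcD. Qed.

Lemma Re_le_normc z : `|complex.Re z| <= normc z.
Proof.
rewrite -(ler_pXn2r (ltn0Sn 1)) ?nnegrE ?normc_ge0//.
by rewrite sqr_normcE real_normK ?num_real// lerDl sqr_ge0.
Qed.

Lemma Im_le_normc z : `|complex.Im z| <= normc z.
Proof.
rewrite -(ler_pXn2r (ltn0Sn 1)) ?nnegrE ?normc_ge0//.
by rewrite sqr_normcE real_normK ?num_real// lerDr sqr_ge0.
Qed.

Lemma normc_le_ReIm z : normc z <= `|complex.Re z| + `|complex.Im z|.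
Proof.
rewrite -(ler_pXn2r (ltn0Sn 1)) ?nnegrE ?normc_ge0 ?addr_ge0//.
rewrite sqr_normcE -[complex.Re z ^+ 2]real_normK ?num_real//.
rewrite -[complex.Im z ^+ 2]real_normK ?num_real//.
by rewrite sqrrD addrAC lerDl mulrn_wge0// mulr_ge0.
Qed.

Lemma normc_sum (I : Type) (r : seq I) (P : pred I) (F : I -> R[i]) :
  normc (\sum_(i <- r | P i) F i) <= \sum_(i <- r | P i) normc (F i).
Proof.
elim/big_rec2: _ => [|i x z _ h]; first by rewrite normc0.
by apply: (le_trans (normcD _ _)); rewrite lerD2l.
Qed.

Lemma normc_prod (I : Type) (r : seq I) (P : pred I) (F : I -> R[i]) :
  normc (\prod_(i <- r | P i) F i) = \prod_(i <- r | P i) normc (F i).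
Proof. by apply: big_morph; [exact: normcM|exact: normc1]. Qed.

Lemma ReD z w : complex.Re (z + w) = complex.Re z + complex.Re w.
Proof. by case: z; case: w. Qed.

Lemma ImD z w : complex.Im (z + w) = complex.Im z + complex.Im w.
Proof. by case: z; case: w. Qed.

Lemma ReMc z w :
  complex.Re (z * w) = complex.Re z * complex.Re w - complex.Im z * complex.Im w.
Proof. by case: z; case: w. Qed.

Lemma ImMc z w :
  complex.Im (z * w) = complex.Re z * complex.Im w + complex.Im z * complex.Re w.
Proof. by case: z; case: w. Qed.

Lemma ReJ z : complex.Re z^* = complex.Re z.
Proof. by case: z. Qed.

Lemma ImJ z : complex.Im z^* = - complex.Im z.
Proof. by case: z. Qed.

Lemma ReIm_eq z w :
  complex.Re z = complex.Re w -> complex.Im z = complex.Im w -> z = w.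
Proof. by case: z; case: w => a b c d /= -> ->. Qed.

Lemma normcD_sqr z w :
  normc (z + w) ^+ 2 = normc z ^+ 2 + normc w ^+ 2 + 2 * complex.Re (z^* * w).
Proof. by rewrite !sqr_normcE ReD ImD ReMc ReJ ImJ; ring. Qed.

Lemma conj_unit z : normc z = 1 -> z^* = z^-1.
Proof.
move=> z1; have z0 : z != 0 by rewrite -normc_gt0 z1.
by apply: (mulfI z0); rewrite -sqr_normcC z1 expr1n mulfV.
Qed.

Lemma normc_cis t : normc (cis t) = 1.
Proof. by rewrite /= cos2Dsin2 sqrtr1. Qed.

Lemma cisD x t : cis (x + t) = cis x * cis t.
Proof.
by apply: ReIm_eq; rewrite ?ReMc ?ImMc /= ?cosD ?sinD//; ring.
Qed.

Lemma cis0 : cis (0 : R) = 1.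
Proof. by rewrite /cis cos0 sin0. Qed.

Lemma cisN t : cis (- t) = (cis t)^*.
Proof. by rewrite /cis cosN sinN. Qed.

Lemma cis2pi : cis (2 * pi : R) = 1.
Proof. by rewrite mulr_natl /cis cos2pi sin2pi. Qed.

Lemma cisX t n : cis t ^+ n = cis (n%:R * t).
Proof.
by elim: n => [|n IH]; rewrite ?mul0r ?cis0// exprS IH -cisD -natr1; congr cis; ring.
Qed.

Lemma normc_unimodular z : normc (unimodular z) = 1.
Proof.
rewrite /unimodular; case: eqP => [_|/eqP z0]; first exact: normc1.
have -> : `|z| = (normc z)%:C by case: z {z0}.
by rewrite normcM normcJ normcV normc_real ger0_norm ?normc_ge0// divff// normc_eq0.
Qed.

End ComplexNorm.

(** * Blaschke factors and Szego kernels *)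

Section Blaschke.
Variable R : realType.
Implicit Types (a z w x y : R[i]).

Definition bfactor a z := unimodular a * ((z - a) / (1 - a^* * z)).

Definition szego a z : R[i] :=
  (Num.sqrt (1 - normc a ^+ 2))%:C / (1 - a^* * z).

Lemma normc_den_ge a z : 1 - normc a * normc z <= normc (1 - a^* * z).
Proof. by have := lerB_normc 1 (a^* * z); rewrite normc1 normcM normcJ. Qed.

Lemma den_neq0 a z : normc a * normc z < 1 -> 1 - a^* * z != 0.
Proof. by move=> az; rewrite -normc_gt0 (lt_le_trans _ (normc_den_ge _ _))// subr_gt0. Qed.

Lemma disc_den_neq0 a z : normc a < 1 -> normc z <= 1 -> 1 - a^* * z != 0.
Proof.
move=> a1 z1; apply: den_neq0; rewrite (le_lt_trans _ a1)//.
by rewrite ler_piMr// normc_ge0.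
Qed.

(** The pseudohyperbolic identity. *)
Lemma bfactor_sqr a z : 1 - a^* * z != 0 ->
  1 - normc (bfactor a z) ^+ 2 =
  (1 - normc a ^+ 2) * (1 - normc z ^+ 2) / normc (1 - a^* * z) ^+ 2.
Proof.
move=> d0.
rewrite /bfactor normcM normc_unimodular mul1r normcM normcV exprMn exprVn.
have n0 : normc (1 - a^* * z) ^+ 2 != 0 by rewrite expf_neq0// normc_eq0.
apply: (mulIf n0); rewrite mulrBl mul1r !divfK//.
apply: (@complexI R); rewrite !(rmorphB, rmorphM, rmorph1)/= !mulr_normcC.
by rewrite !conjE; ring.
Qed.

Lemma bfactor_circle a z : normc a < 1 -> normc z = 1 -> normc (bfactor a z) = 1.
Proof.
move=> a1 z1; have d0 : 1 - a^* * z != 0 by rewrite disc_den_neq0// z1.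
have := bfactor_sqr d0; rewrite z1 expr1n subrr mulr0 mul0r => /eqP.
rewrite subr_eq0 eq_sym -(expr1n _ 2) eqrXn2 ?normc_ge0// => /eqP ->; rewrite expr1n.
by [].
Qed.

Lemma bfactor_le1 a z : normc a < 1 -> normc z <= 1 -> normc (bfactor a z) <= 1.
Proof.
move=> a1 z1; have d0 : 1 - a^* * z != 0 by rewrite disc_den_neq0.
rewrite -(@ler_pXn2r _ 2)// ?nnegrE ?normc_ge0// expr1n -subr_ge0 bfactor_sqr//.
by rewrite divr_ge0 ?sqr_ge0// mulr_ge0// subr_ge0 expr_le1// ?normc_ge0// ltW.
Qed.

(** The numerator is a multiple of 1 - |a|^2: a Blaschke factor oscillates little
    away from its zero, which is what makes the errors in [cotlar_core] summable. *)
Lemma bfactor_diff a x z : 1 - a^* * x != 0 -> 1 - a^* * z != 0 ->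
  bfactor a x - bfactor a z =
  unimodular a * ((1 - normc a ^+ 2)%:C * (x - z) / ((1 - a^* * x) * (1 - a^* * z))).
Proof.
move=> dx dz; rewrite /bfactor complexRB sqr_normcC.
by rewrite -mulrBr; congr (_ * _); field; rewrite dx dz.
Qed.

Lemma szego_diff a x z : 1 - a^* * x != 0 -> 1 - a^* * z != 0 ->
  szego a x - szego a z =
  (Num.sqrt (1 - normc a ^+ 2))%:C * (a^* * (x - z)) /
    ((1 - a^* * x) * (1 - a^* * z)).
Proof. by move=> dx dz; rewrite /szego; field; rewrite dx dz. Qed.

Lemma normc_szego a z :
  normc (szego a z) = Num.sqrt (1 - normc a ^+ 2) / normc (1 - a^* * z).
Proof. by rewrite /szego normcM normcV normc_real ger0_norm ?sqrtr_ge0. Qed.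

(** Reflection in the circle: 1/w^* and w are mirror images, and a Blaschke
    factor takes mirror values there. *)
Lemma bfactor_reflect a w : w != 0 -> w != a -> 1 - a^* * w != 0 ->
  bfactor a (w^*)^-1 * (bfactor a w)^* = 1.
Proof.
move=> w0 wa d0.
have u1 : unimodular a * (unimodular a)^* = 1.
  by rewrite -sqr_normcC normc_unimodular expr1n.
have wJ0 : w^* != 0 by rewrite conjC_eq0.
have wJa : w^* - a^* != 0 by rewrite -conjB conjC_eq0 subr_eq0.
have dJ : 1 - a * w^* != 0.
  by rewrite -conjC_eq0 !conjE.
rewrite /bfactor !conjE.
rewrite mulrACA u1 mul1r; field.
by rewrite wJ0 dJ /= wJa.
Qed.

(** The local form of [mt_reflect]: one factor of the Blaschke product turns the
    mirror image of the Szego kernel back into the kernel itself. *)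
Lemma szego_reflect a w : w != 0 -> w != a -> 1 - a^* * w != 0 ->
  (szego a (w^*)^-1)^* * bfactor a w = w * (unimodular a * szego a w).
Proof.
move=> w0 wa d0.
have wa0 : w - a != 0 by rewrite subr_eq0.
rewrite /bfactor /szego !conjE.
field.
by rewrite d0 wa0 w0.
Qed.

End Blaschke.

(** * Continuous functions and their averages *)

Section RealContinuity.
Variable R : realType.
Implicit Types (f g : R -> R).

Lemma contD f g : continuous f -> continuous g -> continuous (fun t => f t + g t).
Proof. by move=> cf cg t; apply: cvgD; [exact: cf|exact: cg]. Qed.

Lemma contN f : continuous f -> continuous (fun t => - f t).
Proof. by move=> cf t; apply: cvgN; exact: cf. Qed.

Lemma contB f g : continuous f -> continuous g -> continuous (fun t => f t - g t).
Proof. by move=> cf cg t; apply: cvgB; [exact: cf|exact: cg]. Qed.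

Lemma contM f g : continuous f -> continuous g -> continuous (fun t => f t * g t).
Proof. by move=> cf cg t; apply: cvgM; [exact: cf|exact: cg]. Qed.

Lemma cont_cst c : continuous (fun _ : R => c : R).
Proof. by move=> t; exact: cvg_cst. Qed.

Lemma contX f n : continuous f -> continuous (fun t => f t ^+ n).
Proof.
move=> cf; elim: n => [|n IH]; first by move=> t; exact: cvg_cst.
rewrite (_ : (fun t => f t ^+ n.+1) = (fun t => f t * f t ^+ n)).
  exact: contM.
by apply/funext => t; rewrite exprS.
Qed.

Lemma cont_sqrt f : continuous f -> continuous (fun t => Num.sqrt (f t)).
Proof. by move=> cf t; apply: continuous_comp; [exact: cf|exact: sqrt_continuous]. Qed.

Lemma cont_max f g : continuous f -> continuous g ->
  continuous (fun t => Num.max (f t) (g t)).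
Proof. by move=> cf cg t; exact: (@continuous_max R R f g t (cf t) (cg t)). Qed.

Lemma cont_sum (I : Type) (r : seq I) (F : I -> R -> R) :
  (forall i, continuous (F i)) -> continuous (fun t => \sum_(i <- r) F i t).
Proof.
move=> cF; elim: r => [|i r IH].
  by rewrite (_ : (fun t => _) = fun=> 0);
    [exact: cont_cst|apply/funext => t; rewrite big_nil].
rewrite (_ : (fun t => _) = (fun t => F i t + \sum_(i <- r) F i t)).
  exact: contD.
by apply/funext => t; rewrite big_cons.
Qed.

Lemma cont_bigmax (I : Type) (r : seq I) (F : I -> R -> R) :
  (forall i, continuous (F i)) ->
  continuous (fun t => \big[Num.max/0]_(i <- r) F i t).
Proof.
move=> cF; elim: r => [|i r IH].
  by rewrite (_ : (fun t => _) = fun=> 0);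
    [exact: cont_cst|apply/funext => t; rewrite big_nil].
rewrite (_ : (fun t => _) = (fun t => Num.max (F i t) (\big[Num.max/0]_(i <- r) F i t))).
  exact: cont_max.
by apply/funext => t; rewrite big_cons.
Qed.

Lemma cont_cos k : continuous (fun t : R => cos (k * t)).
Proof.
move=> t; apply: (@continuous_comp _ _ _ (fun t : R => k * t) (@cos R)).
  exact: mulrl_continuous.
exact: continuous_cos.
Qed.

Lemma cont_sin k : continuous (fun t : R => sin (k * t)).
Proof.
move=> t; apply: (@continuous_comp _ _ _ (fun t : R => k * t) (@sin R)).
  exact: mulrl_continuous.
exact: continuous_sin.
Qed.

End RealContinuity.

Section Average.
Variable R : realType.
Local Notation mu := (@lebesgue_measure R).
Implicit Types (f g : R -> R) (a b c s : R).

Lemma cont_integrable f a b : continuous f -> mu.-integrable `[a, b] (EFin \o f).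
Proof.
move=> cf; apply: continuous_compact_integrable; first exact: segment_compact.
exact: continuous_subspaceT.
Qed.

Definition avg a b f : R := (b - a)^-1 * \int[mu]_(t in `[a, b]) f t.

Lemma eq_avg f g a b : (forall t, a <= t <= b -> f t = g t) -> avg a b f = avg a b g.
Proof.
move=> fg; congr (_ * _); apply: eq_Rintegral => t; rewrite inE/= in_itv/=.
exact: fg.
Qed.

Lemma avgD f g a b : continuous f -> continuous g ->
  avg a b (fun t => f t + g t) = avg a b f + avg a b g.
Proof. by move=> cf cg; rewrite /avg RintegralD// ?mulrDr//; exact: cont_integrable. Qed.

Lemma avgZ f a b c : continuous f -> avg a b (fun t => c * f t) = c * avg a b f.
Proof. by move=> cf; rewrite /avg RintegralZl// 1?mulrCA//; exact: cont_integrable. Qed.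

Lemma avgN f a b : continuous f -> avg a b (fun t => - f t) = - avg a b f.
Proof.
by move=> cf; rewrite -mulN1r -avgZ//; apply: eq_avg => t _; rewrite mulN1r.
Qed.

Lemma avgB f g a b : continuous f -> continuous g ->
  avg a b (fun t => f t - g t) = avg a b f - avg a b g.
Proof. by move=> cf cg; rewrite avgD ?avgN//; exact: contN. Qed.

Lemma avg_cst c a b : a < b -> avg a b (fun=> c) = c.
Proof.
move=> ab; have -> : avg a b (fun=> c) = (b - a)^-1 * (c * fine (mu `[a, b])).
  by rewrite /avg Rintegral_cst.
rewrite lebesgue_measure_itv/= lte_fin ab -EFinB/=.
by rewrite mulrCA mulVf ?mulr1// subr_eq0 gt_eqF.
Qed.

Lemma avg_le f g a b : a < b -> continuous f -> continuous g ->
  (forall t, a <= t <= b -> f t <= g t) -> avg a b f <= avg a b g.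
Proof.
move=> ab cf cg fg; rewrite ler_pM2l ?invr_gt0 ?subr_gt0//.
apply: le_Rintegral; [by []|exact: cont_integrable|exact: cont_integrable|].
by move=> t /=; rewrite in_itv/=; exact: fg.
Qed.

Lemma avg_le_cst f a b c : a < b -> continuous f ->
  (forall t, a <= t <= b -> f t <= c) -> avg a b f <= c.
Proof.
move=> ab cf fc; rewrite -[leRHS](avg_cst c ab); apply: avg_le => //.
exact: cont_cst.
Qed.

Lemma avg_ge0 f a b : a < b -> (forall t, 0 <= f t) -> 0 <= avg a b f.
Proof.
move=> ab f0; rewrite mulr_ge0 ?invr_ge0 ?subr_ge0 ?(ltW ab)//.
by apply: Rintegral_ge0 => t _.
Qed.

Lemma avg_abs f a b : a < b -> continuous f ->
  `|avg a b f| <= avg a b (fun t => `|f t|).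
Proof.
move=> ab cf; rewrite normrM ger0_norm ?invr_ge0 ?subr_ge0 ?(ltW ab)//.
rewrite ler_pM2l ?invr_gt0 ?subr_gt0//.
by apply: le_normr_Rintegral => //; exact: cont_integrable.
Qed.

Lemma avg_sum (I : Type) (r : seq I) (F : I -> R -> R) a b :
  (forall i, continuous (F i)) ->
  avg a b (fun t => \sum_(i <- r) F i t) = \sum_(i <- r) avg a b (F i).
Proof.
move=> cF; elim: r => [|i r IH].
  rewrite big_nil -[RHS](mul0r (avg a b (fun=> 0))) -avgZ; last exact: cont_cst.
  by apply: eq_avg => t _; rewrite big_nil mul0r.
rewrite big_cons -IH -avgD//; last exact: cont_sum.
by apply: eq_avg => t _; rewrite big_cons.
Qed.

Lemma avg_sqr f a b : a < b -> continuous f ->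
  avg a b f ^+ 2 <= avg a b (fun t => f t ^+ 2).
Proof.
move=> ab cf; set m := avg a b f.
have : 0 <= avg a b (fun t => (f t - m) ^+ 2) by apply: avg_ge0 => // t; exact: sqr_ge0.
rewrite (@eq_avg _ (fun t => f t ^+ 2 + ((- (2 * m)) * f t + m ^+ 2))); last first.
  by move=> t _; ring.
rewrite avgD; [|exact: contX|]; last first.
  by apply: contD; [apply: contM => //; exact: cont_cst|exact: cont_cst].
rewrite avgD; [|by apply: contM => //; exact: cont_cst|exact: cont_cst].
rewrite avgZ// avg_cst// -/m; lra.
Qed.

Lemma avg_FTC f (F : R -> R) a b : a < b -> continuous f ->
  (forall t, is_derive t (1 : R) F (f t)) -> avg a b f = (b - a)^-1 * (F b - F a).
Proof.
move=> ab cf dF; congr (_ * _); rewrite /Rintegral (@continuous_FTC2 R f F)//.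
- exact: continuous_subspaceT.
- have cF : continuous F.
    by move=> t; apply/differentiable_continuous/derivable1_diffP; apply: ex_derive.
  split => //.
  + by apply: cvg_at_right_filter; exact: cF.
  + by apply: cvg_at_left_filter; exact: cF.
- by move=> t _; rewrite derive1E derive_val.
Qed.

Lemma Rintegral_split f a b c : a <= c <= b -> continuous f ->
  \int[mu]_(t in `[a, b]) f t =
  \int[mu]_(t in `[a, c]) f t + \int[mu]_(t in `[c, b]) f t.
Proof.
move=> /andP[ac cb] cf.
have cI : mu.-integrable `]c, b] (EFin \o f).
  by apply: (integrableS _ _ _ (cont_integrable c b cf)) => //; exact: subset_itv_oc_cc.
rewrite -(Rintegral_itv_obnd_cbnd cI).
rewrite -(@Rintegral_itvB _ f (BLeft a) (BRight b) c) ?bnd_simp//.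
  by ring.
exact: cont_integrable.
Qed.

Lemma avg_split f s L N : 0 < L -> (0 < N)%N -> continuous f ->
  avg s (s + L) f = N%:R^-1 *
    \sum_(0 <= i < N) avg (s + i%:R * (L / N%:R)) (s + i.+1%:R * (L / N%:R)) f.
Proof.
move=> L0 N0 cf; have NR : 0 < (N%:R : R) by rewrite ltr0n.
have split n : \int[mu]_(t in `[s, s + n%:R * (L / N%:R)]) f t =
    \sum_(0 <= i < n) \int[mu]_(t in `[s + i%:R * (L / N%:R), s + i.+1%:R * (L / N%:R)]) f t.
  elim: n => [|n IH]; first by rewrite mul0r addr0 big_geq// set_itv1 Rintegral_set1.
  rewrite big_nat_recr//= -IH -Rintegral_split//.
  by rewrite lerDl lerD2l ler_wpM2r ?ler_nat ?mulr_ge0 ?divr_ge0 ?(ltW L0)//=.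
have -> : avg s (s + L) f = L^-1 * \int[mu]_(t in `[s, s + N%:R * (L / N%:R)]) f t.
  by rewrite /avg addrC addKr mulrCA divff ?mulr1// gt_eqF.
rewrite split !mulr_sumr; apply: eq_bigr => i _; rewrite /avg [RHS]mulrA; congr (_ * _).
have -> : s + i.+1%:R * (L / N%:R) - (s + i%:R * (L / N%:R)) = L / N%:R.
  by rewrite -natr1; ring.
by field; rewrite !gt_eqF.
Qed.

End Average.

(** * Means over a period *)

Section CircleMean.
Variable R : realType.
Implicit Types (f g : R -> R[i]) (h k : R -> R) (s t : R) (z w c : R[i]).

(** The starting point s of the period is kept: arcs are cut from s when cis s = 1,
    while the scalar product of the circle starts at - pi. *)
Definition mean s h : R := avg s (s + 2 * pi) h.

Definition ccont f := continuous (fun t => complex.Re (f t)) /\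
  continuous (fun t => complex.Im (f t)).

Definition cmean s f : R[i] :=
  Complex (mean s (fun t => complex.Re (f t))) (mean s (fun t => complex.Im (f t))).

Lemma twopi_gt0 : 0 < 2 * pi :> R.
Proof. by rewrite mulr_gt0 ?pi_gt0. Qed.

Lemma mean_lt s : s < s + 2 * pi.
Proof. by rewrite ltrDl twopi_gt0. Qed.
#[local] Hint Resolve mean_lt : core.

Lemma eq_mean s h k : h =1 k -> mean s h = mean s k.
Proof. by move=> hk; apply: eq_avg => t _; exact: hk. Qed.

Lemma eq_cmean s f g : f =1 g -> cmean s f = cmean s g.
Proof. by move=> fg; congr Complex; apply: eq_mean => t; rewrite fg. Qed.

Lemma ccont_cst c : ccont (fun=> c).
Proof. by split; exact: cont_cst. Qed.

Lemma ccontD f g : ccont f -> ccont g -> ccont (fun t => f t + g t).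
Proof.
move=> [f1 f2] [g1 g2]; split.
  rewrite (_ : (fun t => _) = (fun t => complex.Re (f t) + complex.Re (g t))).
    exact: contD.
  by apply/funext => t; rewrite ReD.
rewrite (_ : (fun t => _) = (fun t => complex.Im (f t) + complex.Im (g t))).
  exact: contD.
by apply/funext => t; rewrite ImD.
Qed.

Lemma ccontM f g : ccont f -> ccont g -> ccont (fun t => f t * g t).
Proof.
move=> [f1 f2] [g1 g2]; split.
  rewrite (_ : (fun t => _) = (fun t =>
    complex.Re (f t) * complex.Re (g t) - complex.Im (f t) * complex.Im (g t))).
    by apply: contB; apply: contM.
  by apply/funext => t; rewrite ReMc.
rewrite (_ : (fun t => _) = (fun t =>
    complex.Re (f t) * complex.Im (g t) + complex.Im (f t) * complex.Re (g t))).
  by apply: contD; apply: contM.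
by apply/funext => t; rewrite ImMc.
Qed.

Lemma ccontN f : ccont f -> ccont (fun t => - f t).
Proof.
move=> cf; rewrite (_ : (fun t => _) = (fun t => -1 * f t)).
  by apply: ccontM => //; exact: ccont_cst.
by apply/funext => t; rewrite mulN1r.
Qed.

Lemma ccontB f g : ccont f -> ccont g -> ccont (fun t => f t - g t).
Proof. by move=> cf cg; apply: ccontD => //; exact: ccontN. Qed.

Lemma ccontJ f : ccont f -> ccont (fun t => (f t)^*).
Proof.
move=> [f1 f2]; split.
  rewrite (_ : (fun t => _) = (fun t => complex.Re (f t)))//.
  by apply/funext => t; rewrite ReJ.
rewrite (_ : (fun t => _) = (fun t => - complex.Im (f t))).
  exact: contN.
by apply/funext => t; rewrite ImJ.
Qed.

Lemma ccont_sum (I : Type) (r : seq I) (F : I -> R -> R[i]) :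
  (forall i, ccont (F i)) -> ccont (fun t => \sum_(i <- r) F i t).
Proof.
move=> cF; elim: r => [|i r IH].
  by rewrite (_ : (fun t => _) = fun=> 0);
    [exact: ccont_cst|apply/funext => t; rewrite big_nil].
rewrite (_ : (fun t => _) = (fun t => F i t + \sum_(i <- r) F i t)).
  exact: ccontD.
by apply/funext => t; rewrite big_cons.
Qed.

Lemma ccont_cis : ccont (@cis R).
Proof.
split => /=.
  by have := @cont_cos R 1; under eq_fun do rewrite mul1r.
by have := @cont_sin R 1; under eq_fun do rewrite mul1r.
Qed.

Lemma ccont_horner (p : {poly R[i]}) f : ccont f -> ccont (fun t => p.[f t]).
Proof.
move=> cf; elim/poly_ind: p => [|p c IH].
  by under eq_fun do rewrite horner0; exact: ccont_cst.
under eq_fun do rewrite !hornerE; apply: ccontD; last exact: ccont_cst.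
exact: ccontM.
Qed.

Lemma cont_normc2 f : ccont f -> continuous (fun t => normc (f t) ^+ 2).
Proof.
move=> [f1 f2]; rewrite (_ : (fun t => _) =
    (fun t => complex.Re (f t) ^+ 2 + complex.Im (f t) ^+ 2)).
  by apply: contD; apply: contX.
by apply/funext => t; rewrite sqr_normcE.
Qed.

Lemma cont_normc f : ccont f -> continuous (fun t => normc (f t)).
Proof.
move=> cf; rewrite (_ : (fun t => _) = (fun t => Num.sqrt (normc (f t) ^+ 2))).
  by apply: cont_sqrt; exact: cont_normc2.
by apply/funext => t; rewrite sqrtr_sqr ger0_norm// normc_ge0.
Qed.

Lemma cmeanD s f g : ccont f -> ccont g ->
  cmean s (fun t => f t + g t) = cmean s f + cmean s g.
Proof.
move=> [f1 f2] [g1 g2]; apply: ReIm_eq; rewrite ?ReD ?ImD /= /mean -avgD//.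
  by apply: eq_avg => t _; rewrite ReD.
by apply: eq_avg => t _; rewrite ImD.
Qed.

Lemma cmeanZ s c f : ccont f -> cmean s (fun t => c * f t) = c * cmean s f.
Proof.
move=> [f1 f2]; have cR r h : continuous h -> continuous (fun t => r * h t).
  by move=> ch; apply: contM => //; exact: cont_cst.
apply: ReIm_eq; rewrite ?ReMc ?ImMc /= /mean -!avgZ// -?avgD -?avgB//; try exact: cR.
  by apply: eq_avg => t _; rewrite ReMc.
by apply: eq_avg => t _; rewrite ImMc.
Qed.

Lemma cmeanB s f g : ccont f -> ccont g ->
  cmean s (fun t => f t - g t) = cmean s f - cmean s g.
Proof.
move=> cf cg; rewrite cmeanD//; last exact: ccontN.
congr (_ + _); rewrite -mulN1r -cmeanZ//.
by apply: eq_cmean => t; rewrite mulN1r.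
Qed.

Lemma cmeanJ s f : ccont f -> cmean s (fun t => (f t)^*) = (cmean s f)^*.
Proof.
move=> [f1 f2]; apply: ReIm_eq; rewrite ?ReJ ?ImJ /= /mean -?avgN//.
  by apply: eq_avg => t _; rewrite ReJ.
by apply: eq_avg => t _; rewrite ImJ.
Qed.

Lemma cmean_cst s c : cmean s (fun=> c) = c.
Proof. by apply: ReIm_eq; rewrite /= /mean avg_cst. Qed.

Lemma cmean_sum s (I : Type) (r : seq I) (F : I -> R -> R[i]) :
  (forall i, ccont (F i)) ->
  cmean s (fun t => \sum_(i <- r) F i t) = \sum_(i <- r) cmean s (F i).
Proof.
move=> cF; elim: r => [|i r IH].
  by rewrite big_nil -[RHS](cmean_cst s); apply: eq_cmean => t; rewrite big_nil.
rewrite big_cons -IH -cmeanD//; last exact: ccont_sum.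
by apply: eq_cmean => t; rewrite big_cons.
Qed.

Lemma cmean_real s h : cmean s (fun t => (h t)%:C) = (mean s h)%:C.
Proof.
by apply: ReIm_eq => //=; rewrite /mean avg_cst.
Qed.

(** The factor 2 spares the rotation that makes the integral real: real and
    imaginary parts are estimated separately. *)
Lemma normc_cmean s f : ccont f -> normc (cmean s f) <= 2 * mean s (fun t => normc (f t)).
Proof.
move=> cf; have [f1 f2] := cf; apply: (le_trans (normc_le_ReIm _)) => /=.
rewrite mulr_natl mulr2n; apply: lerD; apply: (le_trans (avg_abs _ _)) => //;
  apply: avg_le => //; try exact: cont_normc.
- by move=> t; apply: cvg_norm; exact: f1.
- by move=> t _; exact: Re_le_normc.
- by move=> t; apply: cvg_norm; exact: f2.
- by move=> t _; exact: Im_le_normc.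
Qed.

Lemma cmean_cis s n : (0 < n)%N -> cmean s (fun t => cis t ^+ n) = 0.
Proof.
move=> n0; have nR : (n%:R : R) != 0 by rewrite pnatr_eq0 -lt0n.
have D t : is_derive t (1 : R) (fun t => n%:R * t : R) n%:R.
  have := @is_deriveZ R R R id n%:R t 1 1 (is_derive_id _ _).
  by rewrite /GRing.scale/= mulr1.
have cper h : (forall t, h (t + pi *+ 2) = h t) ->
    forall t (k : nat), h (t + k%:R * (2 * pi)) = h t :> R.
  move=> hp t k; elim: k t => [|k IH] t; first by rewrite mul0r addr0.
  by rewrite -natr1 mulrDl mul1r addrA (mulr_natl pi 2) hp -(mulr_natl pi 2) IH.
have dS t : is_derive t (1 : R) (fun t => n%:R^-1 * sin (n%:R * t)) (cos (n%:R * t)).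
  have := @is_deriveZ R R R _ n%:R^-1 t 1 _
    (is_derive1_comp (is_derive_sin (n%:R * t)) (D t)).
  by rewrite /GRing.scale/= mulrCA mulVf// mulr1.
have dC t : is_derive t (1 : R) (fun t => - n%:R^-1 * cos (n%:R * t)) (sin (n%:R * t)).
  have := @is_deriveZ R R R _ (- n%:R^-1) t 1 _
    (is_derive1_comp (is_derive_cos (n%:R * t)) (D t)).
  by rewrite /GRing.scale/= mulNr mulNr mulrN opprK mulrCA mulVf// mulr1.
apply: ReIm_eq; rewrite /= /mean.
- rewrite (@eq_avg R _ (fun t => cos (n%:R * t))); last by move=> t _; rewrite cisX.
  have -> := avg_FTC (mean_lt s) (@cont_cos R n%:R) dS.
  by rewrite [n%:R * (s + _)]mulrDr (cper (@sin R)) ?subrr ?mulr0//; exact: sinD2pi.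
- rewrite (@eq_avg R _ (fun t => sin (n%:R * t))); last by move=> t _; rewrite cisX.
  have -> := avg_FTC (mean_lt s) (@cont_sin R n%:R) dC.
  by rewrite [n%:R * (s + _)]mulrDr (cper (@cos R)) ?subrr ?mulr0//; exact: cosD2pi.
Qed.

End CircleMean.

(** * Uniform limits of polynomials on a disc *)

Section DiscAlgebra.
Variable R : realType.
Implicit Types (f g : R[i] -> R[i]) (r e rho M : R) (z w a c : R[i]) (p q : {poly R[i]}).

(** For rho = 1 this is the disc algebra. Defined as a closure of polynomials it
    reduces every formula below to polynomials, without contour integrals. *)
Definition discalg rho f := forall e, 0 < e ->
  exists p, forall z, normc z <= rho -> normc (f z - p.[z]) <= e.

Lemma le0_eps (x M : R) : 0 <= M -> (forall e, 0 < e -> e <= 1 -> x <= e * M) -> x <= 0.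
Proof.
move=> M0 h; rewrite leNgt; apply/negP => x0.
have M1 : 0 < M + 1 by rewrite ltr_wpDl.
pose e := Num.min 1 (x / (2 * (M + 1))).
have e0 : 0 < e by rewrite lt_min ltr01 divr_gt0// mulr_gt0.
have e1 : e <= 1 by rewrite ge_min lexx.
have e2 : e * (2 * (M + 1)) <= x by rewrite -ler_pdivlMr ?mulr_gt0// ge_min lexx orbT.
have := h e e0 e1; nra.
Qed.

Lemma le_eps (x y M : R) : 0 <= M ->
  (forall e, 0 < e -> e <= 1 -> x <= y + e * M) -> x <= y.
Proof.
move=> M0 h; rewrite -subr_le0; apply: (le0_eps M0) => e e0 e1.
by rewrite lerBlDl h.
Qed.

Lemma discalg_cst rho c : discalg rho (fun=> c).
Proof. by move=> e e0; exists c%:P => z _; rewrite hornerC subrr normc0 ltW. Qed.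

Lemma discalg_id rho : discalg rho id.
Proof. by move=> e e0; exists 'X => z _; rewrite hornerX subrr normc0 ltW. Qed.

Lemma eq_discalg rho f g : (forall z, normc z <= rho -> f z = g z) ->
  discalg rho f -> discalg rho g.
Proof. by move=> fg df e /df[p hp]; exists p => z zr; rewrite -fg// hp. Qed.

Lemma poly_bounded rho p : exists2 M, 0 <= M &
  forall z, normc z <= rho -> normc p.[z] <= M.
Proof.
elim/poly_ind: p => [|p c [M M0 IH]].
  by exists 0 => // z _; rewrite horner0 normc0.
exists (M * `|rho| + normc c); first by rewrite addr_ge0 ?normc_ge0// mulr_ge0.
move=> z zr; rewrite hornerMXaddC (le_trans (normcD _ _))// lerD2r normcM.
by rewrite ler_pM ?normc_ge0 ?IH// (le_trans zr)// ler_norm.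
Qed.

Lemma discalg_bounded rho f : discalg rho f -> exists2 M, 0 <= M &
  forall z, normc z <= rho -> normc (f z) <= M.
Proof.
move=> /(_ 1 ltr01)[p hp]; have [M M0 Mp] := poly_bounded rho p.
exists (1 + M) => [|z zr]; first by rewrite addr_ge0.
by rewrite -(subrK p.[z] (f z)) (le_trans (normcD _ _))// lerD// ?hp ?Mp.
Qed.

Lemma discalgD rho f g : discalg rho f -> discalg rho g ->
  discalg rho (fun z => f z + g z).
Proof.
move=> df dg e e0; have e2 : 0 < e / 2 by rewrite divr_gt0.
have [p hp] := df _ e2; have [q hq] := dg _ e2; exists (p + q) => z zr.
rewrite hornerD opprD addrACA (le_trans (normcD _ _))//.
by rewrite [leRHS](splitr e) lerD ?hp ?hq.
Qed.

(** Approximations of the factors multiply because both functions are bounded. *)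
Lemma discalgM rho f g : discalg rho f -> discalg rho g ->
  discalg rho (fun z => f z * g z).
Proof.
move=> df dg e e0.
have [M M0 Mf] := discalg_bounded df; have [L L0 Lg] := discalg_bounded dg.
have D0 : 0 < M + L + 1 by rewrite ltr_wpDl// addr_ge0.
pose d := Num.min 1 (e / (M + L + 1)).
have d0 : 0 < d by rewrite lt_min ltr01 divr_gt0.
have d1 : d <= 1 by rewrite ge_min lexx.
have de : d * (M + L + 1) <= e by rewrite -ler_pdivlMr// ge_min lexx orbT.
have [p hp] := df _ d0; have [q hq] := dg _ d0; exists (p * q) => z zr.
have -> : f z * g z - (p * q).[z] =
    f z * (g z - q.[z]) + (f z - p.[z]) * g z - (f z - p.[z]) * (g z - q.[z]).
  by rewrite hornerM; ring.
have := normcB (f z * (g z - q.[z]) + (f z - p.[z]) * g z) ((f z - p.[z]) * (g z - q.[z])).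
have := normcD (f z * (g z - q.[z])) ((f z - p.[z]) * g z).
rewrite !normcM; have := Mf z zr; have := Lg z zr; have := hp z zr; have := hq z zr.
have := normc_ge0 (f z); have := normc_ge0 (g z).
have := normc_ge0 (f z - p.[z]); have := normc_ge0 (g z - q.[z]).
move: (normc (f z)) (normc (g z)) (normc (f z - p.[z])) (normc (g z - q.[z])).
move=> A B C D ? ? ? ? ? ? ? ? h1 h2; apply: (le_trans h2).
apply: (@le_trans _ _ (A * D + C * B + C * D)); first by rewrite lerD2r.
apply: (le_trans _ de).
have : A * D <= M * d by apply: ler_pM.
have : C * B <= d * L by apply: ler_pM.
have : C * D <= d * 1 by apply: ler_pM => //; apply: le_trans d1.
lra.
Qed.

Lemma discalgB rho f g : discalg rho f -> discalg rho g ->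
  discalg rho (fun z => f z - g z).
Proof.
move=> df dg; apply: (@eq_discalg _ (fun z => f z + (-1) * g z)).
  by move=> z _; rewrite mulN1r.
by apply: discalgD => //; apply: discalgM => //; exact: discalg_cst.
Qed.

Lemma discalg_sum rho (I : Type) (s : seq I) (P : pred I) (F : I -> R[i] -> R[i]) :
  (forall i, P i -> discalg rho (F i)) ->
  discalg rho (fun z => \sum_(i <- s | P i) F i z).
Proof.
move=> dF; elim: s => [|i s IH].
  by apply: (eq_discalg _ (discalg_cst rho 0)) => z _; rewrite big_nil.
case Pi : (P i); last by apply: (eq_discalg _ IH) => z _; rewrite big_cons Pi.
apply: (eq_discalg _ (discalgD (dF i Pi) IH)) => z _.
by rewrite big_cons Pi.
Qed.

Lemma discalg_prod rho (I : Type) (s : seq I) (P : pred I) (F : I -> R[i] -> R[i]) :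
  (forall i, P i -> discalg rho (F i)) ->
  discalg rho (fun z => \prod_(i <- s | P i) F i z).
Proof.
move=> dF; elim: s => [|i s IH].
  by apply: (eq_discalg _ (discalg_cst rho 1)) => z _; rewrite big_nil.
case Pi : (P i); last by apply: (eq_discalg _ IH) => z _; rewrite big_cons Pi.
apply: (eq_discalg _ (discalgM (dF i Pi) IH)) => z _.
by rewrite big_cons Pi.
Qed.

Lemma exp_small (x e : R) : 0 <= x -> x < 1 -> 0 < e -> exists n, x ^+ n <= e.
Proof.
move=> x0 x1 e0; have /cvgrPdist_le/(_ e e0) : (x ^+ n @[n --> \oo] --> (0 : R)).
  by apply: cvg_expr; rewrite ger0_norm.
case=> n _ /(_ n (leqnn n))/=; rewrite sub0r normrN => h; exists n.
by rewrite (le_trans (ler_norm _)).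
Qed.

(** Partial sums of the geometric series. *)
Lemma discalg_inv rho a : 0 <= rho -> normc a * rho < 1 ->
  discalg rho (fun z => (1 - a^* * z)^-1).
Proof.
move=> rho0 ar e e0; set x := normc a * rho.
have x0 : 0 <= x by rewrite mulr_ge0 ?normc_ge0.
have x1 : 0 < 1 - x by rewrite subr_gt0.
have [n xn] := exp_small x0 ar (mulr_gt0 e0 x1).
exists (\sum_(i < n) (a^* *: 'X) ^+ i) => z zr.
have az : normc (a^* * z) <= x by rewrite normcM normcJ ler_wpM2l// normc_ge0.
have D0 : 1 - a^* * z != 0.
  by apply: den_neq0; apply: le_lt_trans ar; rewrite ler_wpM2l ?normc_ge0.
have -> : (\sum_(i < n) (a^* *: 'X) ^+ i).[z] = \sum_(i < n) (a^* * z) ^+ i.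
  by rewrite horner_sum; apply: eq_bigr => i _; rewrite horner_exp hornerZ hornerX.
have -> : (1 - a^* * z)^-1 - \sum_(i < n) (a^* * z) ^+ i =
    (a^* * z) ^+ n / (1 - a^* * z).
  apply: (mulIf D0); rewrite mulrBl mulVf// divfK//.
  by rewrite [_ * (1 - _)]mulrC -[1 - a^* * z]opprB mulNr -subrX1 opprB subKr.
rewrite normcM normcV normcX ler_pdivrMr ?normc_gt0//.
apply: (@le_trans _ _ (x ^+ n)).
  by rewrite lerXn2r ?nnegrE ?normc_ge0.
apply: (le_trans xn); rewrite ler_pM2l//.
have := lerB_normc 1 (a^* * z); rewrite normc1; lra.
Qed.

Lemma uniform_approx_continuous (h : R -> R) :
  (forall e, 0 < e -> exists2 k : R -> R, continuous k & forall t, `|h t - k t| <= e) ->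
  continuous h.
Proof.
move=> H t; apply/cvgrPdist_le => e e0.
have e3 : 0 < e / 3 by rewrite divr_gt0.
have [k ck hk] := H _ e3.
have /cvgrPdist_le/(_ _ e3) := ck t.
apply: filterS => u hu.
have -> : h t - h u = (h t - k t) + (k t - k u) - (h u - k u) by ring.
rewrite (le_trans (ler_normB _ _))// (_ : e = e / 3 + e / 3 + e / 3); last by field.
by rewrite lerD// (le_trans (ler_normD _ _))// lerD.
Qed.

Lemma ccont_discalg rho f (g : R -> R[i]) : discalg rho f -> ccont g ->
  (forall t, normc (g t) <= rho) -> ccont (fun t => f (g t)).
Proof.
move=> df cg gr; split; apply: uniform_approx_continuous => e e0;
    have [p hp] := df _ e0; have [p1 p2] := ccont_horner p cg.
  exists (fun t => complex.Re p.[g t]) => // t.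
  have := Re_le_normc (f (g t) - p.[g t]).
  by rewrite ReD; case: p.[g t] (hp _ (gr t)) => u v /= h1 h2; apply: (le_trans h2).
exists (fun t => complex.Im p.[g t]) => // t.
have := Im_le_normc (f (g t) - p.[g t]).
by rewrite ImD; case: p.[g t] (hp _ (gr t)) => u v /= h1 h2; apply: (le_trans h2).
Qed.

Lemma ccont_circle rho f : 1 <= rho -> discalg rho f -> ccont (fun t => f (cis t)).
Proof.
by move=> r1 df; apply: (ccont_discalg df (ccont_cis R)) => t; rewrite normc_cis.
Qed.

Lemma cmean_poly s p : cmean s (fun t => p.[cis t]) = p.[0].
Proof.
rewrite (@eq_cmean _ _ _ (fun t => \sum_(i < size p) p`_i * cis t ^+ i)); last first.
  by move=> t; rewrite horner_coef.
have cX i : ccont (fun t : R => cis t ^+ i).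
  by have := ccont_horner 'X^i (ccont_cis R); under eq_fun do rewrite hornerXn.
rewrite cmean_sum => [|i]; last by apply: ccontM => //; exact: ccont_cst.
rewrite horner_coef; apply: eq_bigr => i _; rewrite cmeanZ//; congr (_ * _).
case: (val i) => [|n]; last by rewrite cmean_cis// expr0n.
by rewrite -[RHS](cmean_cst s); apply: eq_cmean.
Qed.

Lemma normc_eps z w M : 0 <= M -> (forall e, 0 < e -> normc (z - w) <= e * M) -> z = w.
Proof.
move=> M0 h; apply/eqP; rewrite -subr_eq0 -normc_eq0 eq_le normc_ge0 andbT.
by apply: (le0_eps M0) => e e0 _; exact: h.
Qed.

(** The Cauchy formula at an interior point z, for the class of uniform limits
    of polynomials: a polynomial is p(z) plus a multiple of y - z, and
    (y - z) / (1 - z y^* ) = y on the circle. *)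
Lemma cauchy_formula s f z : discalg 1 f -> normc z < 1 ->
  cmean s (fun t => f (cis t) * ((1 - z^* * cis t)^-1)^*) = f z.
Proof.
move=> df z1.
have dk : discalg 1 (fun w => (1 - z^* * w)^-1) by apply: discalg_inv => //; rewrite mulr1.
have ck : ccont (fun t => ((1 - z^* * cis t)^-1)^*).
  by apply: ccontJ; exact: (ccont_circle (lexx 1) dk).
have poly0 p : p.[0] = 0 -> cmean s (fun t => p.[cis t]) = 0 by rewrite cmean_poly.
have kint : cmean s (fun t => (1 - z^* * cis t)^-1) = 1.
  apply: (@normc_eps _ _ 3) => // e e0; have [p hp] := dk _ e0.
  have cp := ccont_horner p (ccont_cis R).
  rewrite -(subrK (cmean s (fun t => p.[cis t])) (cmean _ _)) -cmeanB//; last first.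
    exact: (ccont_circle (lexx 1) dk).
  rewrite cmean_poly -addrA (le_trans (normcD _ _))//.
  rewrite (_ : e * 3 = e * 2 + e); last ring.
  apply: lerD.
    apply: (le_trans (normc_cmean _ (ccontB (ccont_circle (lexx 1) dk) cp))).
    rewrite mulrC ler_wpM2r//; apply: avg_le_cst; first exact: mean_lt.
      by apply: cont_normc; apply: ccontB => //; exact: (ccont_circle (lexx 1) dk).
    by move=> t _; apply: hp; rewrite normc_cis.
  by rewrite normc_distC; have := hp 0; rewrite mulr0 subr0 invr1 normc0; apply.
have K0 : 0 < 1 - normc z by rewrite subr_gt0.
have kb t : normc ((1 - z^* * cis t)^-1)^* <= (1 - normc z)^-1.
  rewrite normcJ normcV lef_pV2 ?posrE//; last first.
    by rewrite normc_gt0 disc_den_neq0// normc_cis.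
  by have := normc_den_ge z (cis t); rewrite normc_cis mulr1.
have pcauchy p : cmean s (fun t => p.[cis t] * ((1 - z^* * cis t)^-1)^*) = p.[z].
  have /factor_theorem[q hq] : root (p - p.[z]%:P) z.
    by rewrite rootE !hornerE subrr.
  rewrite (@eq_cmean _ _ _ (fun t => p.[z] * ((1 - z^* * cis t)^-1)^* + ('X * q).[cis t])).
    rewrite cmeanD ?cmeanZ ?cmeanJ ?kint ?conj1 ?mulr1//.
    - by rewrite poly0 ?addr0// hornerM hornerX mul0r.
    - exact: (ccont_circle (lexx 1) dk).
    - by apply: ccontM => //; exact: ccont_cst.
    - exact: ccont_horner (ccont_cis R).
  move=> t; have y1 := normc_cis t; set y := cis t in y1 *.
  have D0 : 1 - z^* * y != 0 by rewrite disc_den_neq0// y1.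
  have DJ : 1 - z * y^* != 0 by rewrite -conjC_eq0 !conjE.
  rewrite !conjE hornerM hornerX.
  have -> : p.[y] = p.[z] + q.[y] * (y - z).
    have := congr1 (fun u => u.[y]) hq; rewrite /= !hornerE => h.
    by rewrite -h addrC subrK.
  have yy : y * y^* = 1 by rewrite -sqr_normcC y1 expr1n.
  have -> : y - z = y * (1 - z * y^*) by rewrite mulrBr mulr1 mulrCA yy mulr1.
  by rewrite mulrDl; congr (_ + _); field.
have M0 : 0 <= 2 * (1 - normc z)^-1 + 1 by rewrite addr_ge0// mulr_ge0// invr_ge0 ltW.
apply: (normc_eps M0) => e e0; have [p hp] := df _ e0.
have cp := ccont_horner p (ccont_cis R); have cf := ccont_circle (lexx 1) df.
rewrite -(subrK (cmean s (fun t => p.[cis t] * ((1 - z^* * cis t)^-1)^*)) (cmean _ _)).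
rewrite -cmeanB; try exact: ccontM.
rewrite pcauchy -addrA (le_trans (normcD _ _))// mulrDr mulr1.
apply: lerD; last by rewrite normc_distC hp// ltW.
rewrite (@eq_cmean _ _ _ (fun t => (f (cis t) - p.[cis t]) * ((1 - z^* * cis t)^-1)^*)); last first.
  by move=> t; rewrite mulrBl.
have cfp : ccont (fun t => (f (cis t) - p.[cis t]) * ((1 - z^* * cis t)^-1)^*).
  by apply: ccontM => //; exact: ccontB.
apply: (le_trans (normc_cmean _ cfp)).
rewrite [leRHS]mulrCA ler_wpM2l//; apply: avg_le_cst; first exact: mean_lt.
  exact: cont_normc.
move=> t _; rewrite normcM ler_pM ?normc_ge0//.
by apply: hp; rewrite normc_cis.
Qed.

(** The Cauchy formula at the origin. *)
Lemma mean_value s f : discalg 1 f -> cmean s (fun t => f (cis t)) = f 0.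
Proof.
move=> df; rewrite -(@cauchy_formula s f 0)// ?normc0//.
by apply: eq_cmean => t; rewrite conjC0 mul0r subr0 invr1 conj1 mulr1.
Qed.

Definition poisson z w : R := (1 - normc z ^+ 2) / normc (1 - z^* * w) ^+ 2.

Lemma poisson_ge0 z w : normc z <= 1 -> 0 <= poisson z w.
Proof. by move=> z1; rewrite divr_ge0 ?sqr_ge0// subr_ge0 expr_le1 ?normc_ge0. Qed.

(** The conjugate Cauchy kernel plus an analytic function of w that vanishes at 0;
    only the first part contributes to [poisson_formula]. *)
Lemma poissonE z w : normc z < 1 -> normc w = 1 ->
  (poisson z w)%:C = ((1 - z^* * w)^-1)^* + w * (z^* / (1 - z^* * w)).
Proof.
move=> z1 w1; have D0 : 1 - z^* * w != 0 by rewrite disc_den_neq0// w1.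
have DJ : 1 - z * w^* != 0 by rewrite -conjC_eq0 !conjE.
have ww : w * w^* = 1 by rewrite -sqr_normcC w1 expr1n.
rewrite /poisson complexRM fmorphV/= complexRB !sqr_normcC !conjE rmorph1.
apply: (mulIf (mulf_neq0 D0 DJ)); rewrite divfK ?mulf_neq0//.
transitivity (1 - z^* * w + w * z^* * (1 - z * w^*)); last by field; rewrite D0.
have -> : w * z^* * (1 - z * w^*) = w * z^* - z * z^* * (w * w^*) by ring.
by rewrite ww; ring.
Qed.

Lemma ccont_poisson z : normc z < 1 -> ccont (fun t => (poisson z (cis t))%:C).
Proof.
move=> z1; rewrite (_ : (fun t => _) = (fun t => ((1 - z^* * cis t)^-1)^* +
    cis t * (z^* / (1 - z^* * cis t)))); last first.
  by apply/funext => t; rewrite poissonE// normc_cis.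
have dk : discalg 1 (fun w => (1 - z^* * w)^-1) by apply: discalg_inv => //; rewrite mulr1.
have ck := ccont_circle (lexx 1) dk.
apply: ccontD; first exact: ccontJ.
by apply: ccontM; [exact: ccont_cis|apply: ccontM => //; exact: ccont_cst].
Qed.

Lemma cont_poisson z : normc z < 1 -> continuous (fun t => poisson z (cis t)).
Proof. by move=> /ccont_poisson[]. Qed.

Lemma poisson_formula s f z : discalg 1 f -> normc z < 1 ->
  cmean s (fun t => f (cis t) * (poisson z (cis t))%:C) = f z.
Proof.
move=> df z1.
have dk : discalg 1 (fun w => (1 - z^* * w)^-1) by apply: discalg_inv => //; rewrite mulr1.
have ck := ccont_circle (lexx 1) dk; have cf := ccont_circle (lexx 1) df.
pose g w := f w * (w * (z^* / (1 - z^* * w))).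
have dg : discalg 1 g.
  apply: discalgM => //; apply: discalgM; first exact: discalg_id.
  by apply: discalgM => //; exact: discalg_cst.
rewrite (@eq_cmean _ _ _ (fun t =>
    f (cis t) * ((1 - z^* * cis t)^-1)^* + g (cis t))); last first.
  by move=> t; rewrite poissonE ?normc_cis// mulrDr.
rewrite cmeanD; first by rewrite cauchy_formula// mean_value// /g mul0r mulr0 addr0.
  by apply: ccontM => //; exact: ccontJ.
exact: (ccont_circle (lexx 1) dg).
Qed.

Lemma poisson_formulaJ s f z : discalg 1 f -> normc z < 1 ->
  cmean s (fun t => (f (cis t))^* * (poisson z (cis t))%:C) = (f z)^*.
Proof.
move=> df z1; rewrite -(poisson_formula s df z1) -cmeanJ.
  by apply: eq_cmean => t; rewrite !conjE.
by apply: ccontM; [exact: (ccont_circle (lexx 1) df)|exact: ccont_poisson].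
Qed.


Lemma cont_mean_le s (h k : R -> R) : continuous h -> continuous k ->
  (forall t, h t <= k t) -> mean s h <= mean s k.
Proof. by move=> ch ck hk; apply: avg_le => //; exact: mean_lt. Qed.

Lemma poly_parseval s p n : (size p <= n)%N ->
  mean s (fun t => normc p.[cis t] ^+ 2) = \sum_(i < n) normc p`_i ^+ 2.
Proof.
elim/poly_ind: p n => [|p c IH] n sp.
  rewrite /mean (@eq_avg _ _ (fun=> 0)); last by move=> t _; rewrite horner0 normc0 expr0n.
  by rewrite avg_cst ?mean_lt// big1// => i _; rewrite coef0 normc0 expr0n.
case: n sp => [|n] sp.
  move: sp; rewrite leqn0 size_poly_eq0 => /eqP->; rewrite big_ord0.
  rewrite /mean (@eq_avg _ _ (fun=> 0)) ?avg_cst ?mean_lt//.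
  by move=> t _; rewrite horner0 normc0 expr0n.
have spn : (size p <= n)%N.
  have [->|p0] := eqVneq p 0; first by rewrite size_poly0.
  by move: sp; rewrite size_MXaddC (negPf p0).
rewrite big_ord_recl coefD coefMX coefC/= add0r.
under eq_bigr do rewrite coefD coefMX coefC/= addr0.
rewrite -(IH n spn); set q := 'X * p.
have cp := ccont_horner p (ccont_cis R).
have cq := ccont_horner ((c^*)%:P * q) (ccont_cis R).
rewrite (@eq_mean _ s _ (fun t => normc c ^+ 2 +
  (normc p.[cis t] ^+ 2 + 2 * complex.Re ((c^*)%:P * q).[cis t]))); last first.
  move=> t; rewrite hornerMXaddC addrC normcD_sqr hornerM hornerC hornerM hornerX.
  by rewrite normcM normc_cis mulr1 [cis t * _]mulrC addrA.
rewrite /mean avgD; [|exact: cont_cst|]; last first.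
  apply: contD; first exact: cont_normc2.
  by apply: contM; [exact: cont_cst|case: cq].
rewrite avg_cst ?mean_lt// avgD; [|exact: cont_normc2|]; last first.
  by apply: contM; [exact: cont_cst|case: cq].
congr (_ + _); rewrite avgZ; last by case: cq.
have := congr1 (@complex.Re R) (cmean_poly s ((c^*)%:P * q)).
by rewrite /= /mean => ->; rewrite !hornerM hornerX mul0r mulr0 mulr0 addr0.
Qed.

Definition dil_poly r p : {poly R[i]} := \poly_(i < size p) (p`_i * r%:C ^+ i).

Lemma horner_dil r p z : (dil_poly r p).[z] = p.[r%:C * z].
Proof.
rewrite horner_poly horner_coef; apply: eq_bigr => i _.
by rewrite exprMn mulrA.
Qed.

Lemma coef_dil r p i : (dil_poly r p)`_i = p`_i * r%:C ^+ i.
Proof.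
by rewrite coef_poly; case: ltnP => // h; rewrite nth_default ?mul0r.
Qed.

Lemma size_dil r p : (size (dil_poly r p) <= size p)%N.
Proof. exact: size_poly. Qed.

Lemma poly_contraction s r p : 0 <= r <= 1 ->
  mean s (fun t => normc p.[r%:C * cis t] ^+ 2) <= mean s (fun t => normc p.[cis t] ^+ 2).
Proof.
move=> /andP[r0 r1]; rewrite (poly_parseval _ (leqnn (size p))).
rewrite (@eq_mean _ _ _ (fun t => normc (dil_poly r p).[cis t] ^+ 2)); last first.
  by move=> t; rewrite horner_dil.
rewrite (poly_parseval _ (size_dil r p)); apply: ler_sum => i _.
rewrite coef_dil normcM normcX normc_real ger0_norm//.
by rewrite ler_sqr ?nnegrE ?mulr_ge0 ?normc_ge0 ?exprn_ge0// ler_piMr ?normc_ge0// exprn_ile1.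
Qed.

(** On Fourier coefficients this is (1 - r^n)^2 + 1 <= r^(-2n). *)
Lemma poly_dilation_diff s r p : 0 < r <= 1 ->
  mean s (fun t => normc (p.[cis t] - p.[r%:C * cis t]) ^+ 2) +
    mean s (fun t => normc p.[cis t] ^+ 2) <=
  mean s (fun t => normc p.[(r^-1)%:C * cis t] ^+ 2).
Proof.
move=> /andP[r0 r1].
rewrite (@eq_mean _ _ _ (fun t => normc (p - dil_poly r p).[cis t] ^+ 2)); last first.
  by move=> t; rewrite hornerD hornerN horner_dil.
rewrite [leRHS](@eq_mean _ _ _ (fun t => normc (dil_poly r^-1 p).[cis t] ^+ 2)); last first.
  by move=> t; rewrite horner_dil.
rewrite (poly_parseval _ (leqnn (size p))) (poly_parseval _ (size_dil r^-1 p)).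
rewrite (@poly_parseval _ _ (size p)); last first.
  by rewrite (leq_trans (size_polyD _ _))// geq_max leqnn size_polyN size_dil.
rewrite -big_split; apply: ler_sum => i _ /=.
rewrite coefD coefN !coef_dil -{1}(mulr1 p`_i) -mulrBr !normcM !normcX !normc_real.
rewrite (_ : 1 - r%:C ^+ i = (1 - r ^+ i)%:C); last first.
  by rewrite complexRB rmorph1 rmorphXn.
rewrite normc_real !ger0_norm ?invr_ge0 ?(ltW r0)//; last first.
  by rewrite subr_ge0 exprn_ile1// ltW.
rewrite exprVn; have : 0 < r ^+ i by exact: exprn_gt0.
have : r ^+ i <= 1 by rewrite exprn_ile1// ltW.
move: (r ^+ i) (normc p`_i) (normc_ge0 p`_i) => x c c0 x1 x0.
rewrite !exprMn -{2}(mulr1 (c ^+ 2)) -mulrDr ler_wpM2l ?sqr_ge0//.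
rewrite exprVn -div1r ler_pdivlMr ?exprn_gt0//; nra.
Qed.

Lemma mean_sqr_approx s (f g : R -> R[i]) M e : ccont f -> ccont g ->
  0 <= M -> 0 < e -> e <= 1 -> (forall t, normc (f t) <= M) ->
  (forall t, normc (f t - g t) <= e) ->
  mean s (fun t => normc (g t) ^+ 2) <= mean s (fun t => normc (f t) ^+ 2) + e * (2 * M + 1)
  /\ mean s (fun t => normc (f t) ^+ 2) <= mean s (fun t => normc (g t) ^+ 2) + e * (2 * M + 1).
Proof.
move=> cf cg M0 e0 e1 fM fg; set E := e * (2 * M + 1).
have H t : normc (g t) ^+ 2 <= normc (f t) ^+ 2 + E /\
    normc (f t) ^+ 2 <= normc (g t) ^+ 2 + E.
  have := lerB_normc (f t) (g t); have := lerB_normc (g t) (f t).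
  rewrite (normc_distC (g t)); have := fM t; have := fg t.
  have := normc_ge0 (f t); have := normc_ge0 (g t); rewrite /E.
  move: (normc (f t)) (normc (g t)) (normc (f t - g t)) => a b d b0 a0 d1 a1 h1 h2.
  have h3 : b <= a + e by lra.
  have h4 : a <= b + e by lra.
  by split; nra.
have cE : continuous (fun _ : R => E) by exact: cont_cst.
have mE : mean s (fun=> E) = E by rewrite /mean avg_cst ?mean_lt.
split; rewrite -mE /mean -avgD//; try exact: cont_normc2;
  apply: cont_mean_le; try (by apply: contD => //; exact: cont_normc2);
  try exact: cont_normc2; by move=> t; case: (H t).
Qed.

Lemma discalg_circle_approx rho r f e p : discalg rho f -> 0 <= r <= rho ->
  (forall z, normc z <= rho -> normc (f z - p.[z]) <= e) ->
  [/\ ccont (fun t => f (r%:C * cis t)), ccont (fun t => p.[r%:C * cis t])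
    & forall t, normc (f (r%:C * cis t) - p.[r%:C * cis t]) <= e].
Proof.
move=> df /andP[r0 rr] hp.
have cr : ccont (fun t => r%:C * cis t).
  by apply: ccontM; [exact: ccont_cst|exact: ccont_cis].
have nr t : normc (r%:C * cis t) <= rho.
  by rewrite normcM normc_real normc_cis mulr1 ger0_norm.
split; [exact: ccont_discalg df cr nr|exact: ccont_horner|].
by move=> t; exact: hp.
Qed.

Lemma discalg_contraction s r f : 0 <= r <= 1 -> discalg 1 f ->
  mean s (fun t => normc (f (r%:C * cis t)) ^+ 2) <=
  mean s (fun t => normc (f (cis t)) ^+ 2).
Proof.
move=> r01 df; have [M M0 fM] := discalg_bounded df.
have one : 0 <= (1 : R) <= 1 by rewrite ler01 lexx.
have idE t : cis t = (1%:C : R[i]) * cis t by rewrite mul1r.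
have nr t r' : 0 <= r' <= 1 -> normc (r'%:C * cis t) <= 1.
  by move=> /andP[? ?]; rewrite normcM normc_real normc_cis mulr1 ger0_norm.
apply: (@le_eps _ _ (2 * (2 * M + 1))); first by rewrite mulr_ge0// addr_ge0// mulr_ge0.
move=> e e0 e1; have [p hp] := df _ e0.
have [c1 c2 c3] := discalg_circle_approx df r01 hp.
have [d1 d2 d3] := discalg_circle_approx df one hp.
have [_ h1] := @mean_sqr_approx s _ _ M e c1 c2 M0 e0 e1 (fun t => fM _ (nr t r r01)) c3.
have [h2 _] := @mean_sqr_approx s _ _ M e d1 d2 M0 e0 e1 (fun t => fM _ (nr t 1 one)) d3.
have := poly_contraction s p r01.
rewrite (eq_mean s (fun t => congr1 (fun z => normc p.[z] ^+ 2) (idE t))).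
rewrite (eq_mean s (fun t => congr1 (fun z => normc (f z) ^+ 2) (idE t))).
by move: h1 h2; lra.
Qed.

(** This measures the change of f under dilation by r through the growth of f under
    the inverse dilation, which reflection in the circle makes accessible. *)
Lemma discalg_dilation_diff s r f : 0 < r <= 1 -> discalg r^-1 f ->
  mean s (fun t => normc (f (cis t) - f (r%:C * cis t)) ^+ 2) +
    mean s (fun t => normc (f (cis t)) ^+ 2) <=
  mean s (fun t => normc (f ((r^-1)%:C * cis t)) ^+ 2).
Proof.
move=> r01 df; have [M M0 fM] := discalg_bounded df.
have /andP[r0 r1] := r01.
have rV1 : 1 <= r^-1 by rewrite invf_ge1.
have one : 0 <= (1 : R) <= r^-1 by rewrite ler01 rV1.
have rr : 0 <= r <= r^-1 by rewrite (ltW r0) (le_trans r1).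
have rV : 0 <= r^-1 <= r^-1 by rewrite lexx invr_ge0 ltW.
have idE t : cis t = (1%:C : R[i]) * cis t by rewrite mul1r.
have nr t r' : 0 <= r' <= r^-1 -> normc (r'%:C * cis t) <= r^-1.
  by move=> /andP[? ?]; rewrite normcM normc_real normc_cis mulr1 ger0_norm.
apply: (@le_eps _ _ (16 * (2 * (2 * M) + 1))).
  by rewrite mulr_ge0// addr_ge0// !mulr_ge0.
move=> e e0 e1; have e2 : 0 < e / 2 by rewrite divr_gt0.
have e21 : e / 2 <= 1 by lra.
have [p hp] := df _ e2.
have [c1 c2 c3] := discalg_circle_approx df rr hp.
have [d1 d2 d3] := discalg_circle_approx df one hp.
have [g1 g2 g3] := discalg_circle_approx df rV hp.
have [_ h1] := @mean_sqr_approx s _ _ M _ d1 d2 M0 e2 e21 (fun t => fM _ (nr t 1 one)) d3.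
have [h2 _] := @mean_sqr_approx s _ _ M _ g1 g2 M0 e2 e21 (fun t => fM _ (nr t _ rV)) g3.
have M2 : 0 <= 2 * M by rewrite mulr_ge0.
have bD t : normc (f (1%:C * cis t) - f (r%:C * cis t)) <= 2 * M.
  by rewrite (le_trans (normcB _ _))// mulr_natl mulr2n lerD// fM// nr.
have aD t : normc (f (1%:C * cis t) - f (r%:C * cis t) -
    (p.[1%:C * cis t] - p.[r%:C * cis t])) <= e.
  have -> : f (1%:C * cis t) - f (r%:C * cis t) - (p.[1%:C * cis t] - p.[r%:C * cis t]) =
    (f (1%:C * cis t) - p.[1%:C * cis t]) - (f (r%:C * cis t) - p.[r%:C * cis t]) by ring.
  by rewrite (le_trans (normcB _ _))// [leRHS]splitr lerD.
have [_ h3] := @mean_sqr_approx s _ _ (2 * M) e (ccontB d1 c1) (ccontB d2 c2) M2 e0 e1 bD aD.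
have := poly_dilation_diff s p r01.
rewrite (eq_mean s (fun t => congr1 (fun z => normc p.[z] ^+ 2) (idE t))).
rewrite (eq_mean s (fun t => congr1 (fun z => normc (f z) ^+ 2) (idE t))).
rewrite (eq_mean s (fun t => congr1 (fun z => normc (f z - f (r%:C * cis t)) ^+ 2) (idE t))).
rewrite (eq_mean s (fun t => congr1 (fun z => normc (p.[z] - p.[r%:C * cis t]) ^+ 2) (idE t))).
by move: h1 h2 h3; nra.
Qed.

End DiscAlgebra.

(** * The Malmquist-Takenaka system of a sequence in the disc *)

Section System.
Variable R : realType.
Implicit Types (al : nat -> R[i]) (c : nat -> R[i]) (z w x : R[i]) (rho s : R)
  (m n k : nat).

(** Points are indexed from 0 here, so that [mt al n] involves the zeros [al 0],
    ..., [al n.-1] and the kernel of [al n]. *)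
Definition bprod al m n z := \prod_(m <= j < n) bfactor (al j) z.

Definition mt al n z := bprod al 0 n z * szego (al n) z.

(** On the circle this is the product of the conjugate of [mt al m] and the
    Blaschke product of [al 0], ..., [al n.-1], for m < n. *)
Definition mt_dual al m n z :=
  z * (bprod al m.+1 n z * (unimodular (al m) * szego (al m) z)).

Definition psum al c m n z := \sum_(m <= j < n) c j * mt al j z.

Definition indisc al := forall j, normc (al j) < 1.

Lemma bprod_cat al m k n z : (m <= k <= n)%N ->
  bprod al m n z = bprod al m k z * bprod al k n z.
Proof. by move=> /andP[mk kn]; rewrite /bprod (big_cat_nat mk kn). Qed.

Lemma bprod_recl al m n z : (m < n)%N ->
  bprod al m n z = bfactor (al m) z * bprod al m.+1 n z.
Proof. by move=> mn; rewrite /bprod big_ltn. Qed.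

Lemma bprod_recr al m n z : (m <= n)%N ->
  bprod al m n.+1 z = bprod al m n z * bfactor (al n) z.
Proof. by move=> mn; rewrite /bprod big_nat_recr. Qed.

Lemma bprod_shift al m n z :
  bprod (fun j => al (m + j)%N) 0 n z = bprod al m (m + n) z.
Proof.
rewrite /bprod -{2}[m]add0n big_addn addKn.
by apply: eq_bigr => j _; rewrite addnC.
Qed.

Lemma mt_shift al m n z :
  mt al (m + n) z = bprod al 0 m z * mt (fun j => al (m + j)%N) n z.
Proof.
rewrite /mt bprod_shift mulrA -bprod_cat// leq_addr.
by [].
Qed.

Lemma bprod_circle al m n x : indisc al -> normc x = 1 -> normc (bprod al m n x) = 1.
Proof.
move=> ia x1; rewrite normc_prod big1// => j _.
exact: bfactor_circle.
Qed.

Lemma bprod_le1 al m n z : indisc al -> normc z <= 1 -> normc (bprod al m n z) <= 1.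
Proof.
move=> ia z1; rewrite /bprod; elim: (index_iota m n) => [|j l IH].
  by rewrite big_nil normc1.
by rewrite big_cons normcM mulr_ile1 ?normc_ge0 ?bfactor_le1.
Qed.

Lemma discalg_szego rho a : 0 <= rho -> normc a * rho < 1 -> discalg rho (szego a).
Proof.
move=> r0 ar; apply: discalgM; first exact: discalg_cst.
exact: discalg_inv.
Qed.

Lemma discalg_bfactor rho a : 0 <= rho -> normc a * rho < 1 -> discalg rho (bfactor a).
Proof.
move=> r0 ar; apply: discalgM; first exact: discalg_cst.
apply: discalgM; last exact: discalg_inv.
by apply: discalgB; [exact: discalg_id|exact: discalg_cst].
Qed.

Lemma discalg_bprod rho al m n : 0 <= rho ->
  (forall j, (m <= j < n)%N -> normc (al j) * rho < 1) -> discalg rho (bprod al m n).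
Proof.
move=> r0 ar; rewrite (_ : bprod al m n = fun z =>
    \prod_(j <- index_iota m n | (m <= j < n)%N) bfactor (al j) z); last first.
  apply/funext => z; rewrite /bprod big_seq_cond; apply: eq_bigl => j.
  by rewrite mem_index_iota andbT.
by apply: discalg_prod => j jmn; apply: discalg_bfactor => //; exact: ar.
Qed.

Lemma discalg_mt rho al n : 0 <= rho ->
  (forall j, (j <= n)%N -> normc (al j) * rho < 1) -> discalg rho (mt al n).
Proof.
move=> r0 ar; apply: discalgM; last by apply: discalg_szego => //; exact: ar.
by apply: discalg_bprod => // j /andP[_ jn]; apply: ar; exact: ltnW.
Qed.

Lemma discalg_dual rho al m n : 0 <= rho -> (m < n)%N ->
  (forall j, (j < n)%N -> normc (al j) * rho < 1) -> discalg rho (mt_dual al m n).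
Proof.
move=> r0 mn ar; apply: discalgM; first exact: discalg_id.
apply: discalgM; first by apply: discalg_bprod => // j /andP[_ jn]; exact: ar.
by apply: discalgM; [exact: discalg_cst|apply: discalg_szego => //; exact: ar].
Qed.

Lemma discalg_psum rho al c m n : 0 <= rho ->
  (forall j, (j < n)%N -> normc (al j) * rho < 1) -> discalg rho (psum al c m n).
Proof.
move=> r0 ar; rewrite (_ : psum al c m n = fun z =>
    \sum_(j <- index_iota m n | (m <= j < n)%N) c j * mt al j z); last first.
  apply/funext => z; rewrite /psum big_seq_cond; apply: eq_bigl => j.
  by rewrite mem_index_iota andbT.
apply: discalg_sum => j /andP[_ jn]; apply: discalgM; first exact: discalg_cst.
by apply: discalg_mt => // k kj; apply: ar; exact: leq_ltn_trans jn.
Qed.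

Lemma indisc1 al : indisc al -> forall j, normc (al j) * 1 < 1.
Proof. by move=> ia j; rewrite mulr1. Qed.

Lemma bprod_reflect al m n w : w != 0 ->
  (forall j, (m <= j < n)%N -> w != al j /\ 1 - (al j)^* * w != 0) ->
  (bprod al m n (w^*)^-1)^* * bprod al m n w = 1.
Proof.
move=> w0 h; rewrite /bprod rmorph_prod -big_split/= big_nat big1// => j jmn.
have [wa d0] := h j jmn.
by rewrite -[bfactor (al j) w]conjCK -conjM bfactor_reflect// conj1.
Qed.

(** This continues the identity [mt_dual_circle] off the circle. *)
Lemma mt_reflect al m n w : (m < n)%N -> w != 0 ->
  (forall j, (j < n)%N -> w != al j /\ 1 - (al j)^* * w != 0) ->
  (mt al m (w^*)^-1)^* * bprod al 0 n w = mt_dual al m n w.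
Proof.
move=> mn w0 h; rewrite (@bprod_cat al 0 m) ?(ltnW mn)// (bprod_recl _ _ mn).
have [wa d0] := h m mn.
rewrite /mt /mt_dual conjM.
have e1 := @bprod_reflect al 0 m w w0 (fun j jm => h j (ltn_trans (proj2 (andP jm)) mn)).
have e2 := szego_reflect w0 wa d0.
set A := (bprod al 0 m _)^* in e1 *; set B := bprod al 0 m w in e1 *.
set S := (szego _ _)^* in e2 *; set T := bfactor _ _ in e2 *.
transitivity ((A * B) * (S * T) * bprod al m.+1 n w); first by ring.
by rewrite e1 e2; ring.
Qed.

Lemma mt_dual_circle al m n x : indisc al -> (m < n)%N -> normc x = 1 ->
  (mt al m x)^* * bprod al 0 n x = mt_dual al m n x.
Proof.
move=> ia mn x1; have x0 : x != 0 by rewrite -normc_gt0 x1.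
rewrite -mt_reflect//; first by rewrite (conj_unit x1) invrK.
move=> j jn; split; last by rewrite disc_den_neq0// x1.
by apply: contraTneq (ia j) => <-; rewrite x1 ltxx.
Qed.

Lemma ccont_mt al n : indisc al -> ccont (fun t => mt al n (cis t)).
Proof.
move=> ia; apply: (@ccont_circle _ 1) => //.
by apply: discalg_mt => // j _; exact: indisc1.
Qed.

Lemma ccont_psum al c m n : indisc al -> ccont (fun t => psum al c m n (cis t)).
Proof.
move=> ia; apply: (@ccont_circle _ 1) => //.
by apply: discalg_psum => // j _; exact: indisc1.
Qed.

(** On the circle the product is the boundary value of a function of the disc
    algebra that vanishes at the origin. *)
Lemma mt_orthogonal s al m n : indisc al -> (m < n)%N ->
  cmean s (fun t => mt al n (cis t) * (mt al m (cis t))^*) = 0.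
Proof.
move=> ia mn; pose g z := mt_dual al m n z * szego (al n) z.
rewrite (@eq_cmean _ _ _ (fun t => g (cis t))); last first.
  by move=> t; rewrite /g -mt_dual_circle ?normc_cis// /mt; ring.
rewrite mean_value; first by rewrite /g /mt_dual !mul0r.
apply: discalgM; first by apply: discalg_dual => // j _; exact: indisc1.
by apply: discalg_szego => //; exact: indisc1.
Qed.

(** The squared modulus of [mt al n] on the circle is the Poisson kernel at
    [al n]. *)
Lemma mt_normalized s al n : indisc al ->
  cmean s (fun t => mt al n (cis t) * (mt al n (cis t))^*) = 1.
Proof.
move=> ia; rewrite -(poisson_formula s (discalg_cst 1 1) (ia n)).
apply: eq_cmean => t; rewrite mul1r -sqr_normcC /mt normcM bprod_circle ?normc_cis//.
rewrite mul1r normc_szego exprMn exprVn sqr_sqrtr//.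
by rewrite subr_ge0 expr_le1 ?normc_ge0// ltW.
Qed.

Lemma mt_orthonormal s al m n : indisc al ->
  cmean s (fun t => mt al n (cis t) * (mt al m (cis t))^*) = (m == n)%:R.
Proof.
move=> ia; case: (ltngtP m n) => [mn|nm|->]; last exact: mt_normalized.
- exact: mt_orthogonal.
- rewrite -[RHS]conjC0 -(mt_orthogonal s ia nm) -cmeanJ.
    by apply: eq_cmean => t; rewrite conjM conjCK mulrC.
  by apply: ccontM; [exact: ccont_mt|apply: ccontJ; exact: ccont_mt].
Qed.

Lemma mean_sqr_psum s al c m n : indisc al ->
  mean s (fun t => normc (psum al c m n (cis t)) ^+ 2) =
  \sum_(m <= j < n) normc (c j) ^+ 2.
Proof.
move=> ia; apply: (@complexI R); rewrite -cmean_real.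
rewrite (@eq_cmean _ _ _ (fun t => \sum_(m <= j < n) \sum_(m <= k < n)
    (c j * (c k)^*) * (mt al j (cis t) * (mt al k (cis t))^*))); last first.
  move=> t; rewrite sqr_normcC /psum conj_sum mulr_suml; apply: eq_bigr => j _.
  by rewrite mulr_sumr; apply: eq_bigr => k _; rewrite conjM; ring.
have cM j k : ccont (fun t => mt al j (cis t) * (mt al k (cis t))^*).
  by apply: ccontM; [exact: ccont_mt|apply: ccontJ; exact: ccont_mt].
rewrite cmean_sum => [|j]; last first.
  by apply: ccont_sum => k; apply: ccontM; [exact: ccont_cst|].
rewrite rmorph_sum; apply: eq_big_nat => j jmn.
rewrite cmean_sum => [|k]; last by apply: ccontM; [exact: ccont_cst|].
rewrite (@eq_bigr _ _ _ _ _ _ _ (fun k => if k == j then c j * (c k)^* else 0)); last first.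
  move=> k _; rewrite cmeanZ// mt_orthonormal//.
  by case: eqP => _; rewrite ?mulr1 ?mulr0.
rewrite -big_mkcond big_nat1_eq jmn -sqr_normcC.
by [].
Qed.

Lemma normc_poisson_le s f z : discalg 1 f -> normc z < 1 ->
  normc (f z) <= 2 * mean s (fun t => normc (f (cis t)) * poisson z (cis t)).
Proof.
move=> df z1; rewrite -(poisson_formula s df z1).
have cf : ccont (fun t => f (cis t) * (poisson z (cis t))%:C).
  by apply: ccontM; [exact: ccont_circle df|exact: ccont_poisson].
apply: (le_trans (normc_cmean s cf)); rewrite ler_wpM2l// le_eqVlt.
apply/orP; left; apply/eqP/eq_mean => t.
by rewrite normcM normc_real ger0_norm// poisson_ge0// ltW.
Qed.

Lemma psum_cat al c m k n z : (m <= k <= n)%N ->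
  psum al c m n z = psum al c m k z + psum al c k n z.
Proof. by move=> /andP[mk kn]; rewrite /psum (big_cat_nat mk kn). Qed.

(** On the circle the first factor is unimodular, so that blocks may be studied as
    sums for the shifted sequences. *)
Lemma psum_shift al c m n z :
  psum al c m (m + n) z =
  bprod al 0 m z * psum (fun j => al (m + j)%N) (fun j => c (m + j)%N) 0 n z.
Proof.
rewrite /psum -{1}[m]add0n big_addn addKn mulr_sumr.
by apply: eq_bigr => j _; rewrite addnC mt_shift; ring.
Qed.

End System.

(** * The discrete Poisson maximal function *)

Section DiscreteMaximal.
Variable R : realType.
Implicit Types (x y z w : R[i]) (r rho sigma t u : R).

Lemma cis_neq1 u : 0 < u < 2 * pi -> cis u != 1 :> R[i].
Proof.
move=> /andP[u0 u1]; apply/eqP => /(congr1 (@complex.Re R))/= cu.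
have : 0 < sin (u / 2) by apply: sin_gt0_pi; rewrite divr_gt0//= ltr_pdivrMr// mulrC.
suff -> : sin (u / 2) = 0 by rewrite ltxx.
apply/eqP; rewrite -sqrf_eq0 sin2cos2; apply/eqP.
have e : (u / 2) *+ 2 = u by rewrite -mulr_natr divfK.
have := cos_mulr2n (u / 2); rewrite e cu; lra.
Qed.

Definition unit_root (N : nat) : R[i] := cis (2 * pi / N%:R).

Lemma unit_rootX N j : unit_root N ^+ j = cis (2 * pi * j%:R / N%:R).
Proof. by rewrite /unit_root cisX; congr cis; ring. Qed.

Lemma unit_root_exp N : (0 < N)%N -> unit_root N ^+ N = 1.
Proof. by move=> N0; rewrite unit_rootX mulfK ?cis2pi// pnatr_eq0 -lt0n. Qed.

Lemma unit_root_prim N n : (0 < n < N)%N -> unit_root N ^+ n != 1.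
Proof.
move=> /andP[n0 nN]; have N0 : (0 < N)%N by exact: leq_ltn_trans nN.
rewrite unit_rootX cis_neq1// divr_gt0 ?mulr_gt0 ?ltr0n ?pi_gt0//=.
by rewrite ltr_pdivrMr ?ltr0n// ltr_pM2l ?ltr_nat// mulr_gt0// pi_gt0.
Qed.

Lemma normc_unit_rootX N j : normc (unit_root N ^+ j) = 1.
Proof. by rewrite unit_rootX normc_cis. Qed.

Lemma unit_root_sum N n : (n < N)%N ->
  \sum_(j < N) (unit_root N ^+ j) ^+ n = (N * (n == 0))%:R :> R[i].
Proof.
move=> nN; case: n nN => [|n] nN.
  by under eq_bigr do rewrite expr0; rewrite sumr_const card_ord muln1.
have N0 : (0 < N)%N by exact: leq_ltn_trans nN.
have w1 : unit_root N ^+ n.+1 - 1 != 0 by rewrite subr_eq0 unit_root_prim.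
apply: (mulfI w1); rewrite muln0 mulr0.
under eq_bigr do rewrite -exprM mulnC exprM.
by rewrite -subrX1 -exprM mulnC exprM unit_root_exp// expr1n subrr.
Qed.

Lemma bernoulli_inv (x : R) n : 0 <= x <= 1 -> (1 - x) ^+ n * (1 + n%:R * x) <= 1.
Proof.
move=> /andP[x0 x1]; elim: n => [|n IH]; first by rewrite expr0 mul0r addr0 mulr1.
apply: le_trans IH; rewrite exprS.
have -> : (1 - x) * (1 - x) ^+ n * (1 + n.+1%:R * x) =
  (1 - x) ^+ n * ((1 - x) * (1 + n.+1%:R * x)) by ring.
rewrite ler_wpM2l ?exprn_ge0 ?subr_ge0// -natr1; have := ler0n R n; nra.
Qed.

(** Only the powers of the kernel's expansion that are multiples of N survive the
    sum over the N-th roots of unity, which is N (1 + rho^N) / (1 - rho^N). *)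
Lemma poisson_row_sum N rho i : (0 < N)%N -> 0 <= rho <= 1 - (2 * N%:R)^-1 ->
  \sum_(j < N) poisson (rho%:C * unit_root N ^+ i) (unit_root N ^+ j) <= 5 * N%:R.
Proof.
move=> N0 /andP[r0 r1]; set z := rho%:C * _; have NR : 0 < N%:R :> R by rewrite ltr0n.
have e0 : 0 < (2 * N%:R)^-1 :> R by rewrite invr_gt0 mulr_gt0.
have e1 : (2 * N%:R)^-1 <= 1 :> R.
  have : 1 <= N%:R :> R by rewrite ler1n.
  by rewrite invf_le1 ?mulr_gt0//; lra.
have rlt1 : rho < 1 by lra.
have nz : normc z = rho by rewrite normcM normc_unit_rootX mulr1 normc_real ger0_norm.
have z1 : normc z < 1 by rewrite nz.
have rN : rho ^+ N <= 2 / 3.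
  apply: (@le_trans _ _ ((1 - (2 * N%:R)^-1) ^+ N)).
    by rewrite lerXn2r// nnegrE subr_ge0.
  have e01 : 0 <= (2 * N%:R : R)^-1 <= 1 by rewrite (ltW e0) e1.
  have := bernoulli_inv N e01.
  have -> : N%:R * (2 * N%:R)^-1 = 1 / 2 :> R by field; rewrite gt_eqF.
  lra.
have rN0 : 0 <= rho ^+ N by exact: exprn_ge0.
have D0 (w : R[i]) : normc w = 1 -> 1 - z^* * w != 0.
  by move=> w1; rewrite disc_den_neq0// w1.
have zN : z^* ^+ N = (rho ^+ N)%:C.
  rewrite -rmorphXn /z exprMn -exprM mulnC exprM unit_root_exp// expr1n mulr1.
  by rewrite rmorphXn/= conj_real rmorphXn.
have sumA : \sum_(j < N) (1 - z^* * unit_root N ^+ j)^-1 = (N%:R / (1 - rho ^+ N))%:C.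
  have q0 : 1 - (rho ^+ N)%:C != 0 :> R[i].
    by rewrite -(rmorph1 (real_complex R)) -complexRB fmorph_eq0 subr_eq0 gt_eqF//; lra.
  rewrite complexRM fmorphV/= complexRB rmorph1; apply: (mulIf q0); rewrite divfK//.
  rewrite mulr_suml.
  rewrite (eq_bigr (fun j : 'I_N => \sum_(n < N) z^* ^+ n * (unit_root N ^+ j) ^+ n)); last first.
    move=> j _; have d0 := D0 _ (normc_unit_rootX N j).
    apply: (mulfI d0); rewrite mulVKf//.
    have -> : 1 - (rho ^+ N)%:C = 1 - (z^* * unit_root N ^+ j) ^+ N.
      by rewrite exprMn zN -exprM mulnC exprM unit_root_exp// expr1n mulr1.
    rewrite -[LHS]opprB subrX1 -mulNr opprB; congr (_ * _).
    by apply: eq_bigr => n _; rewrite exprMn.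
  rewrite exchange_big/=.
  rewrite (eq_bigr (fun n : 'I_N => if n == 0 :> nat then N%:R else 0)); last first.
    move=> n _; rewrite -mulr_sumr unit_root_sum//; case: eqP => [->|_].
      by rewrite expr0 mul1r muln1.
    by rewrite muln0 mulr0.
  rewrite -big_mkcond (big_pred1 (Ordinal N0)); last first.
    by move=> n; apply/eqP/eqP => [h|->//]; exact/val_inj.
  by rewrite rmorph_nat.
apply: (@le_trans _ _ (2 * (N%:R / (1 - rho ^+ N)) - N%:R)); last first.
  have : N%:R / (1 - rho ^+ N) <= 3 * N%:R.
    rewrite ler_pdivrMr; last lra.
    by nra.
  lra.
rewrite le_eqVlt; apply/orP; left; apply/eqP/(@complexI R).
rewrite rmorph_sum complexRB complexRM/= -sumA !rmorph_nat.
have sumJ : \sum_(j < N) ((1 - z^* * unit_root N ^+ j)^-1)^* =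
    \sum_(j < N) (1 - z^* * unit_root N ^+ j)^-1.
  by rewrite -conj_sum sumA conj_real.
transitivity (\sum_(j < N) (((1 - z^* * unit_root N ^+ j)^-1)^* +
    ((1 - z^* * unit_root N ^+ j)^-1 - 1))).
  apply: eq_bigr => j _; rewrite poissonE ?normc_unit_rootX//; congr (_ + _).
  by field; exact: D0 (normc_unit_rootX N j).
rewrite big_split/= sumJ sumrB sumr_const card_ord; ring.
Qed.

(** Moving a point of the closed disc radially to the circle at most doubles its
    distance to a point of the circle. *)
Lemma dist_le_den r x y : 0 <= r <= 1 -> normc x = 1 -> normc y = 1 ->
  normc (x - y) <= 2 * normc (1 - (r%:C * y)^* * x).
Proof.
move=> /andP[r0 r1] x1 y1.
have h1 : 1 - r <= normc (1 - (r%:C * y)^* * x).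
  apply: le_trans (normc_den_ge _ _).
  by rewrite normcM y1 x1 normc_real ger0_norm// !mulr1.
have -> : normc (x - y) = normc (1 - y^* * x).
  rewrite -[normc (x - y)]mul1r -{1}y1 -normcJ -normcM mulrBr normc_distC.
  by rewrite [y^* * y]mulrC -sqr_normcC y1 expr1n.
have := normcD (1 - (r%:C * y)^* * x) (((r - 1)%:C * y^*) * x).
rewrite [normc (_ * x)]normcM normcM normcJ x1 y1 !mulr1 normc_real.
rewrite distrC ger0_norm ?subr_ge0//.
have -> : 1 - (r%:C * y)^* * x + (r - 1)%:C * y^* * x = 1 - y^* * x.
  by rewrite conjM conj_real complexRB rmorph1; ring.
lra.
Qed.

Lemma den_quasi_triangle r sigma x y w : 0 <= r <= 1 -> 0 <= sigma <= 1 ->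
  normc x = 1 -> normc y = 1 -> normc w = 1 ->
  normc (1 - (r%:C * x)^* * y) <=
    normc (1 - (r%:C * x)^* * w) + 2 * normc (1 - (sigma%:C * y)^* * w).
Proof.
move=> /andP[r0 r1] s01 x1 y1 w1.
have := dist_le_den s01 w1 y1; have := normcD (1 - (r%:C * x)^* * w) ((r%:C * x)^* * (w - y)).
have -> : 1 - (r%:C * x)^* * w + (r%:C * x)^* * (w - y) = 1 - (r%:C * x)^* * y by ring.
rewrite [normc (_ * (w - y))]normcM normcJ [normc (r%:C * x)]normcM x1 mulr1 normc_real.
rewrite ger0_norm//.
have := normc_ge0 (w - y); nra.
Qed.

Section Kernel.
Variable N : nat.
Hypothesis N0 : (0 < N)%N.
Local Notation y j := (unit_root N ^+ j).

(** The Poisson kernel sampled at the N-th roots of unity, normalised to act as an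
    averaging operator on functions on these roots. *)
Definition dpoisson rho (i j : nat) : R := poisson (rho%:C * y i) (y j) / N%:R.

(** Closer to the circle than half of the mesh 1 / N the row sums would not be
    bounded. *)
Definition dradius (rho : R) : bool := 0 <= rho <= 1 - (2 * N%:R)^-1.

Lemma dradius01 rho : dradius rho -> 0 <= rho /\ rho < 1.
Proof.
move=> /andP[r0 r1]; split => //; apply: (le_lt_trans r1).
by rewrite ltrBlDr ltrDl invr_gt0 mulr_gt0 ?ltr0n.
Qed.

Lemma dpoissonE rho i j : 0 <= rho ->
  dpoisson rho i j = (1 - rho ^+ 2) / normc (1 - (rho%:C * y i)^* * y j) ^+ 2 / N%:R.
Proof.
move=> r0; rewrite /dpoisson /poisson normcM normc_unit_rootX mulr1 normc_real.
by rewrite ger0_norm.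
Qed.

Lemma dpoisson_ge0 rho i j : dradius rho -> 0 <= dpoisson rho i j.
Proof.
move=> /dradius01[r0 r1]; rewrite divr_ge0// poisson_ge0//.
by rewrite normcM normc_unit_rootX mulr1 normc_real ger0_norm// ltW.
Qed.

Lemma dpoissonC rho i j : 0 <= rho -> dpoisson rho i j = dpoisson rho j i.
Proof.
move=> r0; rewrite !dpoissonE//; congr (_ / _ ^+ 2 / _).
rewrite -normcJ; congr normc.
by rewrite !conjE; ring.
Qed.

Lemma dpoisson_sum rho i : dradius rho -> \sum_(j < N) dpoisson rho i j <= 5.
Proof.
move=> dr; rewrite -mulr_suml ler_pdivrMr ?ltr0n//.
exact: poisson_row_sum.
Qed.

(** Multiplied by the three denominators this is the quasi-triangle inequality:
    of the distances from j to i and to i', at least one is comparable with the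
    distance from i to i'. *)
Lemma dpoisson_mul rho sigma i i' j : dradius rho -> dradius sigma -> rho <= sigma ->
  dpoisson rho i j * dpoisson sigma i' j <=
  dpoisson rho i i' * (2 * dpoisson sigma i' j + 8 * dpoisson rho i j).
Proof.
move=> dr ds rs; have [r0 r1] := dradius01 dr; have [s0 s1] := dradius01 ds.
rewrite !dpoissonE//.
set A := normc (1 - (rho%:C * y i)^* * y j); set B := normc (1 - (sigma%:C * y i')^* * y j).
set D := normc (1 - (rho%:C * y i)^* * y i').
have nr (x : R) : 0 <= x -> x < 1 -> forall i j : nat, 0 < normc (1 - (x%:C * y i)^* * y j).
  move=> x0 x1 k l; rewrite normc_gt0 disc_den_neq0 ?normc_unit_rootX//.
  by rewrite normcM normc_unit_rootX mulr1 normc_real ger0_norm.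
have A0 : 0 < A by exact: nr.
have B0 : 0 < B by exact: nr.
have D0 : 0 < D by exact: nr.
have DAB : D <= A + 2 * B.
  by apply: den_quasi_triangle; rewrite ?normc_unit_rootX ?r0 ?s0 ?ltW.
have D2 : D ^+ 2 <= 2 * A ^+ 2 + 8 * B ^+ 2.
  have : D ^+ 2 <= (A + 2 * B) ^+ 2.
    by rewrite ler_sqr ?nnegrE ?addr_ge0 ?mulr_ge0// ltW.
  by have := sqr_ge0 (A - 2 * B); lra.
have NR : 0 < N%:R :> R by rewrite ltr0n.
set p := 1 - rho ^+ 2; set q := 1 - sigma ^+ 2.
have q0 : 0 <= q by rewrite /q; nra.
have qp : q <= p by rewrite /q /p; nra.
have p0 : 0 <= p by exact: le_trans qp.
have -> : p / A ^+ 2 / N%:R * (q / B ^+ 2 / N%:R) =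
    (p * q * D ^+ 2) / (A ^+ 2 * B ^+ 2 * D ^+ 2 * N%:R ^+ 2).
  by field; rewrite !gt_eqF.
have -> : p / D ^+ 2 / N%:R * (2 * (q / B ^+ 2 / N%:R) + 8 * (p / A ^+ 2 / N%:R)) =
    (p * (2 * q * A ^+ 2 + 8 * p * B ^+ 2)) / (A ^+ 2 * B ^+ 2 * D ^+ 2 * N%:R ^+ 2).
  by field; rewrite !gt_eqF.
rewrite ler_wpM2r ?invr_ge0 ?mulr_ge0 ?(ltW A0) ?(ltW B0) ?(ltW D0) ?ler0n//.
rewrite -[p * q * _]mulrA ler_wpM2l//.
have : q * D ^+ 2 <= q * (2 * A ^+ 2 + 8 * B ^+ 2) by rewrite ler_wpM2l.
have : q * B ^+ 2 <= p * B ^+ 2 by rewrite ler_wpM2r ?sqr_ge0.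
lra.
Qed.

Lemma dpoisson_comp rho sigma i i' : dradius rho -> dradius sigma ->
  \sum_(j < N) dpoisson rho i j * dpoisson sigma i' j <=
  50 * (dpoisson rho i i' + dpoisson sigma i i').
Proof.
wlog rs : rho sigma i i' / rho <= sigma => [H|] dr ds.
  have [rs|/ltW rs] := leP rho sigma; first exact: H.
  rewrite addrC (dpoissonC i) ?(dradius01 ds).1// (dpoissonC i) ?(dradius01 dr).1//.
  by under eq_bigr do rewrite mulrC; exact: H.
apply: (@le_trans _ _ (50 * dpoisson rho i i')); last first.
  by rewrite ler_pM2l// lerDl dpoisson_ge0.
apply: (@le_trans _ _ (\sum_(j < N) dpoisson rho i i' *
    (2 * dpoisson sigma i' j + 8 * dpoisson rho i j))).
  by apply: ler_sum => j _; exact: dpoisson_mul.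
rewrite -mulr_sumr mulrC ler_wpM2r ?dpoisson_ge0// big_split/= -!mulr_sumr.
have := dpoisson_sum i dr; have := dpoisson_sum i' ds; lra.
Qed.

(** The maximal theorem in linearized form, the radius being an arbitrary function
    of the position. It is the TT* argument: the composition of two kernels is
    dominated by their sum, so the square of the adjoint is controlled by the
    adjoint. *)
Lemma discrete_maximal (rho : 'I_N -> R) (g : 'I_N -> R) :
  (forall i, dradius (rho i)) -> (forall i, 0 <= g i) ->
  \sum_(i < N) (\sum_(j < N) dpoisson (rho i) i j * g j) ^+ 2 <=
  10 ^+ 4 * \sum_(j < N) g j ^+ 2.
Proof.
(* [u] is the linearized operator T applied to [g], and [v] is T* applied to [u]. *)
move=> dr g0; pose u i := \sum_(j < N) dpoisson (rho i) i j * g j.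
pose v j := \sum_(i < N) dpoisson (rho i) i j * u i.
have u0 i : 0 <= u i by apply: sumr_ge0 => j _; rewrite mulr_ge0 ?dpoisson_ge0.
set S := \sum_(i < N) u i ^+ 2; set V := \sum_(j < N) v j ^+ 2.
set G := \sum_(j < N) g j ^+ 2.
have ES : S = \sum_(j < N) g j * v j.
  under [RHS]eq_bigr do rewrite mulr_sumr.
  rewrite exchange_big; apply: eq_bigr => i _.
  rewrite expr2 {1}/u mulr_suml; apply: eq_bigr => j _; ring.
have EV : V <= 100 * \sum_(j < N) u j * v j.
  have -> : V = \sum_(i < N) \sum_(i' < N) (u i * u i') *
      \sum_(j < N) dpoisson (rho i) i j * dpoisson (rho i') i' j.
    rewrite /V; under eq_bigr do rewrite expr2 {1}/v mulr_suml.
    rewrite exchange_big; apply: eq_bigr => i _.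
    under eq_bigr do rewrite /v mulr_sumr.
    rewrite exchange_big; apply: eq_bigr => i' _.
    by rewrite mulr_sumr; apply: eq_bigr => j _; ring.
  apply: (@le_trans _ _ (\sum_(i < N) \sum_(i' < N) (u i * u i') *
      (50 * (dpoisson (rho i) i i' + dpoisson (rho i') i i')))).
    apply: ler_sum => i _; apply: ler_sum => i' _.
    by rewrite ler_wpM2l ?mulr_ge0// dpoisson_comp.
  have E1 : \sum_(j < N) u j * v j =
      \sum_(i < N) \sum_(i' < N) u i * u i' * dpoisson (rho i) i i'.
    under eq_bigr do rewrite /v mulr_sumr.
    rewrite exchange_big; apply: eq_bigr => i _; apply: eq_bigr => i' _; ring.
  have E2 : \sum_(j < N) u j * v j =
      \sum_(i < N) \sum_(i' < N) u i * u i' * dpoisson (rho i') i i'.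
    rewrite E1 exchange_big; apply: eq_bigr => i _; apply: eq_bigr => i' _.
    by rewrite (dpoissonC i')  ?(dradius01 (dr i')).1//; ring.
  have -> : 100 * \sum_(j < N) u j * v j =
      50 * \sum_(j < N) u j * v j + 50 * \sum_(j < N) u j * v j by ring.
  rewrite {1}E1 E2 !mulr_sumr -big_split/=; apply: ler_sum => i _.
  rewrite !mulr_sumr -big_split/=; apply: ler_sum => i' _.
  by rewrite le_eqVlt; apply/orP; left; apply/eqP; ring.
(* The bound V <= 100 <u, v> gives |v| <= 100 |u|, and S = <g, v> concludes; both
   steps are Young inequalities. *)
have V1 : V <= 10 ^+ 4 * S.
  have : 100 * \sum_(j < N) u j * v j <= 2^-1 * V + 5000 * S.
    rewrite /V /S !mulr_sumr -big_split/=; apply: ler_sum => j _.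
    have := sqr_ge0 (v j - 100 * u j); lra.
  lra.
have S1 : S <= 5000 * G + (20000)^-1 * V.
  rewrite ES /G /V !mulr_sumr -big_split/=; apply: ler_sum => j _.
  have := sqr_ge0 (v j - 10000 * g j); lra.
lra.
Qed.

(** The radius may be chosen separately at each position, which turns a pointwise
    supremum over radii into one linear operator. *)
Lemma discrete_maximal_pointwise (Z g : nat -> R) :
  (forall i, (i < N)%N -> 0 <= Z i) -> (forall i, 0 <= g i) ->
  (forall i, (i < N)%N -> exists2 rho, dradius rho &
     Z i <= \sum_(j < N) dpoisson rho i j * g j) ->
  \sum_(i < N) Z i ^+ 2 <= 10 ^+ 4 * \sum_(j < N) g j ^+ 2.
Proof.
move=> Z0 g0 H.
have H' (i : 'I_N) : exists rho, dradius rho /\ Z i <= \sum_(j < N) dpoisson rho i j * g j.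
  by have [rho h1 h2] := H i (ltn_ord i); exists rho.
have [rho hr] := choice H'.
apply: le_trans (@discrete_maximal rho (fun j => g j) (fun i => (hr i).1) (fun j => g0 j)).
apply: ler_sum => i _; rewrite ler_sqr ?nnegrE ?Z0//; first exact: (hr i).2.
exact: le_trans (Z0 _ _) (hr i).2.
Qed.

End Kernel.

End DiscreteMaximal.

(** * Truncated sums and Poisson averages *)

Section Cotlar.
Variable R : realType.
Implicit Types (al c : nat -> R[i]) (a x z : R[i]) (rho s L : R) (i j m n : nat).

Lemma normc_sub_radial x rho : normc x = 1 -> 0 <= rho <= 1 ->
  normc (x - rho%:C * x) = 1 - rho.
Proof.
move=> x1 /andP[r0 r1]; rewrite -{1}[x]mul1r -mulrBl normcM x1 mulr1.
by rewrite -(rmorph1 (real_complex R)) -complexRB normc_real ger0_norm// subr_ge0.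
Qed.

(** Radial comparison: |1 - a^* x| is at most |1 - a^* rho x| plus 1 - rho, and
    1 - rho is itself at most |1 - a^* rho x|. *)
Lemma den_half a x rho : normc a < 1 -> normc x = 1 -> 0 <= rho <= 1 ->
  normc (1 - a^* * x) <= 2 * normc (1 - a^* * (rho%:C * x)).
Proof.
move=> a1 x1 r01; have /andP[r0 r1] := r01.
have h1 : 1 - rho <= normc (1 - a^* * (rho%:C * x)).
  apply: le_trans (normc_den_ge _ _).
  rewrite normcM x1 mulr1 normc_real ger0_norm// lerD2l lerN2.
  by rewrite ler_piMl// ltW.
have := normcB (1 - a^* * (rho%:C * x)) (a^* * (x - rho%:C * x)).
have -> : 1 - a^* * (rho%:C * x) - a^* * (x - rho%:C * x) = 1 - a^* * x by ring.
rewrite [normc (a^* * (x - _))]normcM normcJ (normc_sub_radial x1 r01).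
have := normc_ge0 a; nra.
Qed.

Lemma den_le_add a x rho : normc a < 1 -> normc x = 1 -> 0 <= rho <= 1 ->
  normc (1 - a^* * (rho%:C * x)) <= normc (1 - a^* * x) + (1 - rho).
Proof.
move=> a1 x1 r01; have /andP[r0 r1] := r01.
have := normcD (1 - a^* * x) (a^* * (x - rho%:C * x)).
have -> : 1 - a^* * x + a^* * (x - rho%:C * x) = 1 - a^* * (rho%:C * x) by ring.
rewrite [normc (a^* * (x - _))]normcM normcJ (normc_sub_radial x1 r01).
have := normc_ge0 a; nra.
Qed.

Section Radial.
Variables (x : R[i]) (rho : R).
Hypotheses (x1 : normc x = 1) (r01 : 0 <= rho <= 1).
Local Notation z := (rho%:C * x).
Local Notation d a := (normc (1 - a^* * x)).

Let nz1 : normc z <= 1.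
Proof.
by case/andP: r01 => r0 r1; rewrite normcM x1 mulr1 normc_real ger0_norm.
Qed.

Let d_gt0 a : normc a < 1 -> 0 < d a.
Proof. by move=> a1; rewrite normc_gt0 disc_den_neq0// x1. Qed.

Let two_den a (k : R) : normc a < 1 -> 0 <= k ->
  k * (1 - rho) / (d a * normc (1 - a^* * z)) <= 2 * k * (1 - rho) / d a ^+ 2.
Proof.
move=> a1 k0; have d0 := d_gt0 a1; have h := den_half a1 x1 r01.
have dz0 : 0 < normc (1 - a^* * z) by rewrite normc_gt0 disc_den_neq0.
have -> : 2 * k * (1 - rho) / d a ^+ 2 = k * (1 - rho) * (2 / d a ^+ 2) by ring.
have /andP[_ r1] := r01.
rewrite ler_wpM2l ?mulr_ge0 ?subr_ge0// ler_pdivlMr ?exprn_gt0//.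
rewrite mulrC ler_pdivrMr ?mulr_gt0// expr2 mulrCA [leRHS]mulrC.
by rewrite ler_pM2r.
Qed.

Lemma bfactor_osc a : normc a < 1 ->
  normc (bfactor a x - bfactor a z) <= 2 * (1 - normc a ^+ 2) * (1 - rho) / d a ^+ 2.
Proof.
move=> a1; have a2 : 0 <= 1 - normc a ^+ 2 by rewrite subr_ge0 expr_le1 ?normc_ge0 ?ltW.
rewrite bfactor_diff ?disc_den_neq0 ?x1//.
rewrite normcM normc_unimodular mul1r normcM normcV [normc (_ * (x - z))]normcM.
rewrite [normc ((1 - a^* * x) * _)]normcM (normc_sub_radial x1 r01) normc_real ger0_norm//.
exact: two_den.
Qed.

Lemma szego_osc a : normc a < 1 ->
  normc (szego a x - szego a z) <=
  2 * Num.sqrt (1 - normc a ^+ 2) * (1 - rho) / d a ^+ 2.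
Proof.
move=> a1; rewrite szego_diff ?disc_den_neq0 ?x1//.
apply: le_trans (two_den a1 (sqrtr_ge0 _)).
rewrite normcM normcV [normc ((1 - a^* * x) * _)]normcM.
rewrite ler_wpM2r ?invr_ge0 ?mulr_ge0 ?normc_ge0//.
rewrite [normc (_%:C * _)]normcM normc_real ger0_norm ?sqrtr_ge0//.
rewrite ler_wpM2l ?sqrtr_ge0// normcM normcJ (normc_sub_radial x1 r01).
by rewrite ler_piMl ?(ltW a1) ?subr_ge0//; case/andP: r01.
Qed.

Lemma id_szego_osc a : normc a < 1 ->
  normc (z * szego a z - x * szego a x) <=
  2 * Num.sqrt (1 - normc a ^+ 2) * (1 - rho) / d a ^+ 2.
Proof.
move=> a1; have x1' : normc x <= 1 by rewrite x1.
have dx := disc_den_neq0 a1 x1'.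
have dz := disc_den_neq0 a1 nz1.
have -> : z * szego a z - x * szego a x = (Num.sqrt (1 - normc a ^+ 2))%:C * (z - x) /
    ((1 - a^* * x) * (1 - a^* * z)).
  by rewrite /szego; field; rewrite dx dz.
apply: le_trans (two_den a1 (sqrtr_ge0 _)).
rewrite normcM normcV [normc ((1 - a^* * x) * _)]normcM [normc (_%:C * _)]normcM.
by rewrite normc_real ger0_norm ?sqrtr_ge0// normc_distC (normc_sub_radial x1 r01).
Qed.

Variable al : nat -> R[i].
Hypothesis ia : indisc al.

Lemma bprod_osc n : normc (bprod al 0 n x - bprod al 0 n z) <=
  2 * (1 - rho) * \sum_(0 <= i < n) (1 - normc (al i) ^+ 2) / d (al i) ^+ 2.
Proof.
elim: n => [|n IH]; first by rewrite /bprod !big_geq// subrr normc0 mulr0.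
rewrite !(bprod_recr _ _ (leq0n n)) big_nat_recr//= mulrDr.
have -> : bprod al 0 n x * bfactor (al n) x - bprod al 0 n z * bfactor (al n) z =
  (bprod al 0 n x - bprod al 0 n z) * bfactor (al n) x +
  bprod al 0 n z * (bfactor (al n) x - bfactor (al n) z) by ring.
apply: (le_trans (normcD _ _)); apply: lerD.
  by rewrite normcM (bfactor_circle (ia n) x1) mulr1.
have := bfactor_osc (ia n); rewrite normcM => h.
apply: (@le_trans _ _ (normc (bfactor (al n) x - bfactor (al n) z))).
  by rewrite ler_piMl ?normc_ge0// bprod_le1.
by apply: (le_trans h); rewrite le_eqVlt; apply/orP; left; apply/eqP; ring.
Qed.

Variables (m : nat) (L : R).
Hypothesis HL : forall j, (j < m)%N ->
  \sum_(0 <= i < j.+1) (1 - normc (al i) ^+ 2) / d (al i) ^+ 2 <= L / d (al j).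

Let sz j := Num.sqrt (1 - normc (al j) ^+ 2).

Let mt_le j : normc (mt al j x) <= sz j / d (al j).
Proof. by rewrite /mt normcM bprod_circle// mul1r normc_szego. Qed.

Let bosc j : (j < m)%N ->
  normc (bprod al 0 j.+1 x - bprod al 0 j.+1 z) <= 2 * (1 - rho) * (L / d (al j)).
Proof.
move=> jm; apply: (le_trans (bprod_osc _)); rewrite ler_wpM2l ?HL//.
by rewrite mulr_ge0// subr_ge0; case/andP: r01.
Qed.

Let bosc' j : (j < m)%N ->
  normc (bprod al 0 j x - bprod al 0 j z) <= 2 * (1 - rho) * (L / d (al j)).
Proof.
move=> jm; apply: (le_trans (bprod_osc _)); rewrite ler_wpM2l//.
  by rewrite mulr_ge0// subr_ge0; case/andP: r01.
apply: le_trans (HL jm); rewrite big_nat_recr//= lerDl divr_ge0 ?sqr_ge0//.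
by rewrite subr_ge0 expr_le1 ?normc_ge0 ?ltW.
Qed.

(** The hypothesis [HL] bounds the variation of the Blaschke product over the
    segment from x to z by (1 - rho) / d (al j), the size of the relative variation
    of the Szego kernel of [al j]; so the product varies no faster than the kernel. *)
Lemma mt_osc j : (j < m)%N ->
  normc (mt al j z - mt al j x) <= 2 * (L + 1) * (sz j * (1 - rho) / d (al j) ^+ 2).
Proof.
move=> jm; rewrite normc_distC /mt.
have -> : bprod al 0 j x * szego (al j) x - bprod al 0 j z * szego (al j) z =
  (bprod al 0 j x - bprod al 0 j z) * szego (al j) x +
  bprod al 0 j z * (szego (al j) x - szego (al j) z) by ring.
have d0 := d_gt0 (ia j).
have -> : 2 * (L + 1) * (sz j * (1 - rho) / d (al j) ^+ 2) =
  2 * (1 - rho) * (L / d (al j)) * (sz j / d (al j)) +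
  2 * sz j * (1 - rho) / d (al j) ^+ 2 by field; rewrite gt_eqF.
apply: (le_trans (normcD _ _)); apply: lerD; rewrite normcM.
  by rewrite ler_pM ?normc_ge0 ?bosc'// normc_szego.
apply: le_trans (szego_osc (ia j)).
by rewrite ler_piMl ?normc_ge0// bprod_le1.
Qed.

(** For z = x the difference vanishes by [mt_dual_circle]; the factors of the dual
    function beyond j are at most 1 in modulus and drop out of the estimate. *)
Lemma dual_osc j : (j < m)%N ->
  normc ((mt_dual al j m z)^* - (bprod al 0 m z)^* * mt al j x) <=
  2 * (L + 1) * (sz j * (1 - rho) / d (al j) ^+ 2).
Proof.
move=> jm; have d0 := d_gt0 (ia j).
have E : mt al j x * (bprod al 0 j.+1 x)^* = (x * (unimodular (al j) * szego (al j) x))^*.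
  have := mt_dual_circle ia (ltnSn j) x1; have bp : bprod al j.+1 j.+1 x = 1 by rewrite /bprod big_geq.
  rewrite /mt_dual bp mul1r.
  by move=> <-; rewrite conjM conjCK.
have -> : (mt_dual al j m z)^* - (bprod al 0 m z)^* * mt al j x =
  (bprod al j.+1 m z)^* * ((unimodular (al j) * (z * szego (al j) z - x * szego (al j) x))^*
    + (bprod al 0 j.+1 x - bprod al 0 j.+1 z)^* * mt al j x).
  rewrite (@bprod_cat _ al 0 j.+1 m)//.
  rewrite mulrBr conjB [(unimodular _ * (x * _))^*](_ : _ =
    mt al j x * (bprod al 0 j.+1 x)^*); last by rewrite E; congr (_^*); ring.
  by rewrite /mt_dual !conjE; ring.
rewrite normcM normcJ.
have -> : 2 * (L + 1) * (sz j * (1 - rho) / d (al j) ^+ 2) =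
  2 * sz j * (1 - rho) / d (al j) ^+ 2 +
  2 * (1 - rho) * (L / d (al j)) * (sz j / d (al j)) by field; rewrite gt_eqF.
apply: (@le_trans _ _ (normc ((unimodular (al j) * (z * szego (al j) z - x * szego (al j) x))^*
    + (bprod al 0 j.+1 x - bprod al 0 j.+1 z)^* * mt al j x))).
  by rewrite ler_piMl ?normc_ge0// bprod_le1.
apply: (le_trans (normcD _ _)); apply: lerD.
  rewrite normcJ normcM normc_unimodular mul1r; exact: id_szego_osc.
by rewrite normcM normcJ ler_pM ?normc_ge0 ?bosc ?mt_le.
Qed.

(** The functional with density 1 - B(z) B(y)^* against the Poisson kernel at z,
    where B is the Blaschke product of the first m points, annihilates every later
    function of the system, since those are multiples of B. *)
Lemma truncating_functional s c n : normc z < 1 -> (m <= n)%N ->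
  cmean s (fun t => psum al c 0 n (cis t) *
    (1 - bprod al 0 m z * (bprod al 0 m (cis t))^*) * (poisson z (cis t))%:C) =
  \sum_(0 <= j < m) c j * (mt al j z - bprod al 0 m z * (mt_dual al j m z)^*).
Proof.
move=> z1 mn.
set F := psum al c 0 n; set B := bprod al 0 m.
pose G := psum (fun j => al (m + j)%N) (fun j => c (m + j)%N) 0 (n - m).
pose W w := \sum_(0 <= j < m) (c j)^* * mt_dual al j m w.
have ia' : indisc (fun j => al (m + j)%N) by move=> j; exact: ia.
have dF : discalg 1 F by apply: discalg_psum => // j _; exact: indisc1.
have dG : discalg 1 G by apply: discalg_psum => // j _; exact: indisc1.
have dW : discalg 1 W.
  rewrite (_ : W = fun w => \sum_(j <- index_iota 0 m | (0 <= j < m)%N)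
      (c j)^* * mt_dual al j m w); last first.
    apply/funext => w; rewrite /W big_seq_cond; apply: eq_bigl => j.
    by rewrite mem_index_iota andbT.
  apply: discalg_sum => j /andP[_ jm]; apply: discalgM; first exact: discalg_cst.
  by apply: discalg_dual => // k _; exact: indisc1.
have splitF w : F w = psum al c 0 m w + B w * G w.
  by rewrite /F (@psum_cat _ al c 0 m n)//=; congr (_ + _); rewrite /G -psum_shift subnKC.
have circ t : F (cis t) * (B (cis t))^* = (W (cis t))^* + G (cis t).
  have B1 : B (cis t) * (B (cis t))^* = 1.
    by rewrite -sqr_normcC bprod_circle ?normc_cis// expr1n.
  rewrite splitF mulrDl mulrAC B1 mul1r; congr (_ + _).
  rewrite /psum /W conj_sum mulr_suml; apply: eq_big_nat => j /andP[_ jm].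
  by rewrite -(mt_dual_circle ia jm (normc_cis t)) !conjE; rewrite mulrA.
rewrite (@eq_cmean _ _ _ (fun t => F (cis t) * (poisson z (cis t))%:C -
    B z * ((W (cis t))^* * (poisson z (cis t))%:C + G (cis t) * (poisson z (cis t))%:C))); last first.
  move=> t; rewrite -mulrDl -circ; ring.
have cP := ccont_poisson z1.
have cF := ccont_circle (lexx 1) dF; have cG := ccont_circle (lexx 1) dG.
have cW := ccontJ (ccont_circle (lexx 1) dW).
have cWP : ccont (fun t => (W (cis t))^* * (poisson z (cis t))%:C +
    G (cis t) * (poisson z (cis t))%:C).
  by apply: ccontD; exact: ccontM.
rewrite cmeanB; [|exact: ccontM|by apply: ccontM => //; exact: ccont_cst].
rewrite cmeanZ// cmeanD; [|exact: ccontM|exact: ccontM].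
rewrite !poisson_formula// poisson_formulaJ// splitF.
have -> : psum al c 0 m z + B z * G z - B z * ((W z)^* + G z) =
  psum al c 0 m z - B z * (W z)^* by ring.
rewrite /psum /W conj_sum mulr_sumr -sumrB; apply: eq_bigr => j _.
by rewrite conjM conjCK; ring.
Qed.

(** A Cotlar inequality. Replacing z by x in the terms of [truncating_functional]
    produces the factor 1 - |B(z)|^2 and the errors of [mt_osc] and [dual_osc]. *)
Lemma cotlar_core s c n : normc z < 1 -> (m <= n)%N ->
  (1 - normc (bprod al 0 m z) ^+ 2) * normc (psum al c 0 m x) <=
  4 * mean s (fun t => normc (psum al c 0 n (cis t)) * poisson z (cis t)) +
  4 * (L + 1) * \sum_(0 <= j < m) normc (c j) * (sz j * (1 - rho) / d (al j) ^+ 2).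
Proof.
move=> z1 mn; set B := bprod al 0 m z; set Lam := \sum_(0 <= j < m) _.
have B1 : normc B <= 1 by exact: bprod_le1.
have B2 : 0 <= 1 - normc B ^+ 2 by rewrite subr_ge0 expr_le1 ?normc_ge0.
pose T := \sum_(0 <= j < m) c j * (mt al j z - B * (mt_dual al j m z)^*).
have cF : ccont (fun t => psum al c 0 n (cis t)) by exact: ccont_psum.
have cB : ccont (fun t => bprod al 0 m (cis t)).
  apply: (@ccont_circle _ 1) => //; apply: discalg_bprod => // j _; exact: indisc1.
have cE : ccont (fun t => psum al c 0 n (cis t) *
    (1 - B * (bprod al 0 m (cis t))^*) * (poisson z (cis t))%:C).
  apply: ccontM; last exact: ccont_poisson.
  apply: ccontM => //; apply: ccontB; first exact: ccont_cst.
  by apply: ccontM; [exact: ccont_cst|exact: ccontJ].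
have nT : normc T <= 4 * mean s (fun t => normc (psum al c 0 n (cis t)) * poisson z (cis t)).
  rewrite /T -(truncating_functional s c z1 mn) (le_trans (normc_cmean s cE))//.
  have -> : (4 : R) = 2 * 2 by ring.
  rewrite -[2 * 2 * _]mulrA ler_wpM2l// /mean -avgZ; last first.
    by apply: contM; [exact: cont_normc|exact: cont_poisson].
  apply: cont_mean_le; first exact: cont_normc.
    apply: contM; first exact: cont_cst.
    by apply: contM; [exact: cont_normc|exact: cont_poisson].
  move=> t; rewrite !normcM normc_real ger0_norm ?poisson_ge0//.
  rewrite [2 * (_ * _)]mulrA ler_wpM2r ?poisson_ge0// [leRHS]mulrC ler_wpM2l ?normc_ge0//.
  rewrite (le_trans (normcB _ _))// normc1 normcM normcJ bprod_circle ?normc_cis//.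
  by rewrite mulr1; lra.
have -> : (1 - normc B ^+ 2) * normc (psum al c 0 m x) =
    normc (\sum_(0 <= j < m) c j * ((1 - normc B ^+ 2)%:C * mt al j x)).
  rewrite -[X in X * _]ger0_norm// -normc_real -normcM /psum mulr_sumr.
  by congr normc; apply: eq_bigr => j _; ring.
have -> : \sum_(0 <= j < m) c j * ((1 - normc B ^+ 2)%:C * mt al j x) =
  T - \sum_(0 <= j < m) c j * ((mt al j z - mt al j x) -
        B * ((mt_dual al j m z)^* - B^* * mt al j x)).
  rewrite /T -sumrB; apply: eq_bigr => j _.
  by rewrite complexRB rmorph1 sqr_normcC; ring.
apply: (le_trans (normcB _ _)); apply: lerD => //.
apply: (le_trans (normc_sum _ _ _)); rewrite mulr_sumr.
rewrite big_nat [leRHS]big_nat; apply: ler_sum => j /andP[_ jm].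
rewrite normcM [leRHS]mulrCA ler_wpM2l ?normc_ge0//.
have h1 := mt_osc jm; have h2 := dual_osc jm.
apply: (le_trans (normcB _ _)); rewrite normcM.
have h3 : normc B * normc ((mt_dual al j m z)^* - B^* * mt al j x) <=
    normc ((mt_dual al j m z)^* - B^* * mt al j x).
  by rewrite ler_piMl ?normc_ge0.
move: h1 h2 h3; rewrite -/B; lra.
Qed.

Lemma prod_le_inv_sum (I : Type) (r : seq I) (t : I -> R) :
  (forall k, 0 <= t k <= 1) ->
  0 <= \prod_(k <- r) (1 - t k) /\
  \prod_(k <- r) (1 - t k) * (1 + \sum_(k <- r) t k) <= 1.
Proof.
move=> t01; elim: r => [|k r [IH0 IH]].
  by rewrite !big_nil mul1r addr0 lexx; split.
rewrite !big_cons; have /andP[t0 t1] := t01 k; split.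
  by rewrite mulr_ge0// subr_ge0.
have S0 : 0 <= \sum_(k <- r) t k by apply: sumr_ge0 => k' _; case/andP: (t01 k').
move: IH IH0 S0; set P := \prod_(k <- r) _; set S := \sum_(k <- r) _ => IH IH0 S0.
apply: le_trans IH; rewrite [(1 - t k) * P]mulrC -mulrA ler_wpM2l//; nra.
Qed.

(** Each factor loses 1 - |b(z)|^2 of its squared modulus, and the losses add up to
    at least kappa / (1 + K)^2, since going from x to z multiplies the distances to
    the points by at most 1 + K. *)
Lemma blaschke_small K kappa : 0 <= K -> 0 <= kappa ->
  (forall i, (i < m)%N -> 1 - rho <= K * d (al i)) ->
  kappa <= \sum_(0 <= i < m) (1 - normc (al i) ^+ 2) * (1 - rho) / d (al i) ^+ 2 ->
  kappa / (kappa + (1 + K) ^+ 2) <= 1 - normc (bprod al 0 m z) ^+ 2.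
Proof.
move=> K0 k0 hK hk; have /andP[r0 r1] := r01.
pose t i := 1 - normc (bfactor (al i) z) ^+ 2.
have t01 i : 0 <= t i <= 1.
  rewrite /t subr_ge0 expr_le1 ?normc_ge0//= bfactor_le1//=.
  by rewrite lerBlDr lerDl sqr_ge0.
have [P0 P1] := prod_le_inv_sum (index_iota 0 m) t01.
have PE : \prod_(i <- index_iota 0 m) (1 - t i) = normc (bprod al 0 m z) ^+ 2.
  rewrite /bprod normc_prod -prodrXl; apply: eq_bigr => i _.
  by rewrite /t opprB addrCA subrr addr0.
have K2 : 0 < (1 + K) ^+ 2 by rewrite exprn_gt0// ltr_pwDl.
have S1 : kappa / (1 + K) ^+ 2 <= \sum_(0 <= i < m) t i.
  rewrite ler_pdivrMr//; apply: (le_trans hk); rewrite mulr_suml.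
  rewrite big_nat [leRHS]big_nat; apply: ler_sum => i /andP[_ im].
  have dz := disc_den_neq0 (ia i) nz1; have d0 := d_gt0 (ia i).
  rewrite /t bfactor_sqr//.
  have a2 : 0 <= 1 - normc (al i) ^+ 2 by rewrite subr_ge0 expr_le1 ?normc_ge0 ?ltW.
  rewrite -mulrA -[leRHS]mulrA -[leRHS]mulrA ler_wpM2l//.
  have nzr : normc z = rho by rewrite normcM x1 mulr1 normc_real ger0_norm.
  rewrite nzr.
  have dz0 : 0 < normc (1 - (al i)^* * z) by rewrite normc_gt0.
  have hz : normc (1 - (al i)^* * z) <= (1 + K) * d (al i).
    apply: (le_trans (den_le_add (ia i) x1 r01)); have := hK i im; lra.
  have hz2 : normc (1 - (al i)^* * z) ^+ 2 <= (1 + K) ^+ 2 * d (al i) ^+ 2.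
    by rewrite -exprMn ler_sqr ?nnegrE ?normc_ge0 ?mulr_ge0 ?addr_ge0 ?normc_ge0.
  rewrite ler_pdivrMr ?exprn_gt0//.
  have -> : (1 - rho ^+ 2) * (normc (1 - (al i)^* * z) ^- 2 * (1 + K) ^+ 2) * d (al i) ^+ 2 =
    (1 - rho ^+ 2) * ((1 + K) ^+ 2 * d (al i) ^+ 2) / normc (1 - (al i)^* * z) ^+ 2.
    by ring.
  rewrite ler_pdivlMr ?exprn_gt0// ler_pM ?subr_ge0 ?sqr_ge0//.
  nra.
move: P0 P1; rewrite PE; set Q := normc _ ^+ 2; set S := \sum_(0 <= i < m) t i in S1 *.
move=> Q0 QS; move: S1; rewrite ler_pdivrMr// => S1.
have S0 : 0 <= S by apply: sumr_ge0 => k _; case/andP: (t01 k).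
rewrite ler_pdivrMr; last by rewrite ltr_wpDl.
nra.
Qed.

End Radial.
End Cotlar.

(** * Chords and arcs *)

Section Trigonometry.
Variable R : realType.
Implicit Types (u v w : R).

Let sin_mvt w : 0 < w -> exists2 k, k \in `]0, w[ & sin w = cos k * w :> R.
Proof.
move=> w0; have [k kw] := @MVT R (@sin R) (@cos R) 0 w w0
  (fun x _ => is_derive_sin x) (continuous_subspaceT (@continuous_sin R)).
by rewrite sin0 !subr0 => ->; exists k.
Qed.

Lemma sin_le w : 0 <= w -> sin w <= w :> R.
Proof.
rewrite le_eqVlt => /orP[/eqP<-|w0]; first by rewrite sin0.
by have [k _ ->] := sin_mvt w0; rewrite ler_piMl ?cos_le1// ltW.
Qed.

Lemma sin_ge_cos w : 0 <= w <= pi -> w * cos w <= sin w :> R.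
Proof.
move=> /andP[]; rewrite le_eqVlt => /orP[/eqP<-|w0 wpi]; first by rewrite sin0 mul0r.
have [k /[!in_itv]/= /andP[k0 kw] ->] := sin_mvt w0.
rewrite mulrC ler_pM2r// ltW// ltr_cos ?in_itv/= ?(ltW k0) ?(ltW w0)//.
by rewrite (le_trans (ltW kw)).
Qed.

(** The numerical constant is cos(3 pi / 8) ^ 2 > 1 / 8. *)
Lemma sin_linear_lower v : 0 <= v <= 3 * pi / 4 -> v / 8 <= sin v :> R.
Proof.
move=> /andP[v0 v1]; have p0 := @pi_gt0 R.
have s4 : sin (pi / 4) <= 3 / 4 :> R.
  have : sin (pi / 4) ^+ 2 = 1 / 2 :> R.
    have := cos_mulr2n (pi / 4 : R); rewrite (_ : (pi / 4) *+ 2 = pi / 2 :> R).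
      by rewrite cos_pihalf sin2cos2; lra.
    by rewrite -mulr_natr; field.
  by move=> h; nra.
have cv : - (3 / 4) <= cos v.
  apply: (@le_trans _ _ (cos (3 * pi / 4))).
    have -> : 3 * pi / 4 = pi / 4 + pi / 2 :> R by field.
    by rewrite cosDpihalf lerN2.
  rewrite leNgt; apply/negP; rewrite ltr_cos ?in_itv/= ?v0; first by lra.
    by apply/andP; split; lra.
  by lra.
have e : (v / 2) *+ 2 = v by rewrite -mulr_natr divfK.
have c2 : 1 / 8 <= cos (v / 2) ^+ 2 by have := cos_mulr2n (v / 2); rewrite e; lra.
have sE : sin v = 2 * (cos (v / 2) * sin (v / 2)).
  by have := sin_mulr2n (v / 2); rewrite e -mulr_natr mulrC.
have c0 : 0 <= cos (v / 2).
  by apply: cos_ge0_pihalf; apply/andP; split; lra.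
have sc : v / 2 * cos (v / 2) <= sin (v / 2) by apply: sin_ge_cos; lra.
by rewrite sE; nra.
Qed.

Lemma normc_1_cis u : normc (1 - cis u : R[i]) = 2 * `|sin (u / 2)|.
Proof.
apply/eqP; rewrite -(@eqrXn2 _ 2)// ?normc_ge0 ?mulr_ge0//; apply/eqP.
rewrite sqr_normcE ReD ImD /= exprMn real_normK ?num_real//.
have e : (u / 2) *+ 2 = u by rewrite -mulr_natr divfK.
have := cos_mulr2n (u / 2); have := cos2Dsin2 (u / 2); have := cos2Dsin2 u; rewrite e.
by move: (cos u) (sin u) (cos (u / 2)) (sin (u / 2)) => a b c d; nra.
Qed.

Lemma normc_1_cis_le u : normc (1 - cis u : R[i]) <= `|u|.
Proof.
rewrite normc_1_cis; have [u0|/ltW u0] := leP 0 u.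
  have := @sin_le (u / 2) (divr_ge0 u0 (ler0n _ _)).
  have := @sin_le (- (u / 2)); rewrite sinN oppr_ge0.
  have [s0|s0] := leP 0 (sin (u / 2)); first by rewrite !ger0_norm//; lra.
  move=> _ _; rewrite ltr0_norm// ger0_norm//.
  have [u1|u1] := leP u (2 * pi); last first.
    by have := sin_geN1 (u / 2); have := @pi_ge2 R; lra.
  have : 0 <= sin (u / 2) by apply: sin_ge0_pi; rewrite divr_ge0//= ler_pdivrMr// mulrC.
  by lra.
rewrite (ler0_norm u0) -normrN -sinN.
have w0 : 0 <= - (u / 2) by rewrite oppr_ge0 pmulr_lle0.
have := sin_le w0; have [s0|s0] := leP 0 (sin (- (u / 2))).
  by rewrite ger0_norm//; lra.
move=> _; rewrite ltr0_norm//.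
have [u1|u1] := leP (- u) (2 * pi); last first.
  by have := sin_geN1 (- (u / 2)); have := @pi_ge2 R; lra.
have : 0 <= sin (- (u / 2)) by apply: sin_ge0_pi; rewrite w0/=; lra.
by lra.
Qed.

Lemma normc_1_cis_ge u : `|u| <= 3 * pi / 2 -> `|u| / 8 <= normc (1 - cis u : R[i]).
Proof.
rewrite normc_1_cis => hu.
have -> : `|sin (u / 2)| = `|sin (`|u| / 2)|.
  have [u0|u0] := leP 0 u; first by rewrite (ger0_norm u0).
  by rewrite (ltr0_norm u0) mulNr sinN normrN.
have : `|u| / 2 / 8 <= sin (`|u| / 2).
  by apply: sin_linear_lower; rewrite divr_ge0//=; lra.
by move/le_trans => /(_ _ (ler_norm _)); lra.
Qed.

Lemma pi_le4 : pi <= 4 :> R.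
Proof. by have := pihalf_lt2 R; lra. Qed.

End Trigonometry.

(** * Truncation at a point beyond the points kept *)

Section OneSided.
Variable R : realType.
Implicit Types (al c : nat -> R[i]) (x : R[i]) (p s : R) (m n h N : nat).

(** Telescoping, since 2 / (u + 1) + 1 / u^2 <= 2 / u for u >= 1. *)
Lemma sum_inv_sqr (E : R) j : 1 <= E - j%:R ->
  \sum_(0 <= i < j.+1) (E - i%:R) ^- 2 <= 2 / (E - j%:R).
Proof.
elim: j => [|j IH] Ej.
  rewrite big_nat1 subr0 in Ej *; rewrite -div1r ler_pdivrMr ?exprn_gt0 ?(lt_le_trans ltr01)//.
  by rewrite expr2 mulrA divfK ?gt_eqF ?(lt_le_trans ltr01)//; lra.
rewrite big_nat_recr//=; move: Ej; rewrite -natr1.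
have -> : E - (j%:R + 1) = E - j%:R - 1 by ring.
move=> Ej; have h : 1 <= E - j%:R by lra.
apply: (le_trans (lerD (IH h) (lexx _))).
move: Ej {IH h}; set u := E - j%:R - 1 => u1.
have -> : E - j%:R = u + 1 by rewrite /u; ring.
have u0 : 0 < u by lra.
have -> : 2 / (u + 1) + u ^- 2 = (2 * u ^+ 2 + u + 1) / (u ^+ 2 * (u + 1)).
  by field; rewrite !gt_eqF//; lra.
have -> : 2 / u = (2 * u * (u + 1)) / (u ^+ 2 * (u + 1)).
  by field; rewrite !gt_eqF//; lra.
by rewrite ler_wpM2r ?invr_ge0 ?mulr_ge0 ?sqr_ge0//; nra.
Qed.

(** The factor 4 (800 + 1) is that of [cotlar_core] for L = 800; the factor before it
    bounds the inverse of 1 - |B(z)|^2. *)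
Definition cotlar_const : R := 14 * (2 * 32 ^+ 2) * (4 * (800 + 1)).

Let cotlar_arith (kV Q X A S : R) : 1 <= kV ->
  kV^-1 / (kV^-1 + (1 + 5 / 2) ^+ 2) <= Q -> Q * X <= 4 * A + 4 * (800 + 1) * S ->
  0 <= X -> 0 <= A -> 0 <= S -> X <= 14 * kV * (4 * (800 + 1)) * (A + S).
Proof.
move=> kV1 hQ core X0 A0 S0; have kV0 : 0 < kV by lra.
have k0 : 0 < kV^-1 by rewrite invr_gt0.
have k1 : kV^-1 <= 1 by rewrite invf_le1.
move: hQ; rewrite ler_pdivrMr; last by rewrite addr_gt0// exprn_gt0//; lra.
move=> hQ; have Q0 : 0 <= Q by nra.
have hQ' : kV^-1 <= 14 * Q by nra.
have kX : kV^-1 * X <= 14 * (4 * (800 + 1)) * (A + S) by nra.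
have -> : X = kV * (kV^-1 * X) by rewrite mulVKf ?gt_eqF.
have -> : 14 * kV * (4 * (800 + 1)) * (A + S) = kV * (14 * (4 * (800 + 1)) * (A + S)) by ring.
by rewrite ler_pM2l.
Qed.

Lemma cotlar_const_ge : 64 <= cotlar_const.
Proof. by rewrite /cotlar_const; lra. Qed.

(** A truncation from the left, at a point x lying to the right of all the points
    kept. The scale h / N is comparable with the distance from x to the nearest of
    them. *)
Lemma one_sided al c x p s rho m n h N : rho = 1 - h%:R / (2 * N%:R) -> indisc al -> normc x = 1 ->
  (0 < N)%N -> (0 < m <= n)%N -> (0 < h <= 2 * N)%N ->
  h%:R <= p - m%:R + 2 <= 3 * h%:R -> m%:R < p + 1 ->
  (forall j, (j < m)%N -> N%:R^-1 <= 1 - normc (al j) ^+ 2 <= 2 / N%:R) ->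
  (forall j, (j < m)%N -> (p - j%:R + 1) / 5 <=
     N%:R * normc (1 - (al j)^* * x) <= 8 * (p - j%:R + 1)) ->
  normc (psum al c 0 m x) <= cotlar_const *
    (mean s (fun t => normc (psum al c 0 n (cis t)) * poisson (rho%:C * x) (cis t)) +
     \sum_(0 <= j < m) normc (c j) * (Num.sqrt (1 - normc (al j) ^+ 2) * (1 - rho) /
        normc (1 - (al j)^* * x) ^+ 2)).
Proof.
move=> rhoE ia x1 N0 /andP[m0 mn] /andP[h0 hN] /andP[hp1 hp2] mp ha hd.
pose d j := normc (1 - (al j)^* * x).
have NR : 0 < N%:R :> R by rewrite ltr0n.
have hR : 1 <= h%:R :> R by rewrite ler1n.
have tau : 1 - rho = h%:R / (2 * N%:R) by rewrite rhoE; ring.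
have tau0 : 0 < 1 - rho by rewrite tau divr_gt0 ?mulr_gt0//; lra.
have r01 : 0 <= rho <= 1.
  apply/andP; split; last by lra.
  by rewrite rhoE subr_ge0 ler_pdivrMr ?mulr_gt0// mul1r -natrM ler_nat.
have z1 : normc (rho%:C * x) < 1.
  by rewrite normcM x1 mulr1 normc_real ger0_norm; lra.
have d0 j : 0 < d j by rewrite normc_gt0 disc_den_neq0// x1.
have jm1 j : (j < m)%N -> j%:R + 1 <= m%:R :> R by move=> jm; rewrite natr1 ler_nat.
have L1 j : (j < m)%N ->
    \sum_(0 <= i < j.+1) (1 - normc (al i) ^+ 2) / d i ^+ 2 <= 800 / d j.
  move=> jm; have jm' := jm1 j jm.
  apply: (@le_trans _ _ (\sum_(0 <= i < j.+1) 50 * N%:R * (p + 1 - i%:R) ^- 2)).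
    rewrite big_nat [leRHS]big_nat; apply: ler_sum => i /andP[_ ij].
    have im : (i < m)%N by exact: leq_trans jm.
    have im' := jm1 i im.
    have /andP[a1 a2] := ha i im; have /andP[b1 b2] := hd i im; rewrite -/(d i) in b1 b2.
    have e0 : 0 < p + 1 - i%:R by lra.
    rewrite ler_pdivrMr ?exprn_gt0//; apply: (le_trans a2).
    rewrite ler_pdivrMr//.
    have -> : 50 * N%:R * (p + 1 - i%:R) ^- 2 * d i ^+ 2 * N%:R =
      50 * (N%:R * d i) ^+ 2 / (p + 1 - i%:R) ^+ 2 by field; rewrite gt_eqF.
    rewrite ler_pdivlMr ?exprn_gt0//; nra.
  rewrite -mulr_sumr.
  have /andP[b1 b2] := hd j jm; rewrite -/(d j) in b1 b2.
  have ej : 1 <= p + 1 - j%:R by lra.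
  apply: (@le_trans _ _ (50 * N%:R * (2 / (p + 1 - j%:R)))).
    by rewrite ler_wpM2l ?mulr_ge0 ?(ltW NR)// sum_inv_sqr.
  rewrite ler_pdivlMr//.
  have -> : 50 * N%:R * (2 / (p + 1 - j%:R)) * d j = 100 * (N%:R * d j) / (p + 1 - j%:R).
    by field; rewrite gt_eqF//; lra.
  by rewrite ler_pdivrMr; lra.
have core := @cotlar_core R x rho x1 r01 al ia m 800 L1 s c n z1 mn.
set A := mean s _ in core *; set S := \sum_(0 <= j < m) _ in core *.
have A0 : 0 <= A.
  apply: avg_ge0; first exact: mean_lt.
  by move=> t; rewrite mulr_ge0 ?normc_ge0// poisson_ge0// ltW.
have s0 j : 0 <= Num.sqrt (1 - normc (al j) ^+ 2) by exact: sqrtr_ge0.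
have S0 : 0 <= S.
  apply: sumr_ge0 => j _; rewrite mulr_ge0 ?normc_ge0// divr_ge0 ?sqr_ge0//.
  by rewrite mulr_ge0// ltW.
(* Fewer than h points are kept: all are within O(h / N) of x, so each term is
   already bounded by its error term. *)
have [hm|mh] := leqP h m; last first.
  apply: (@le_trans _ _ (64 * S)); last first.
    have := cotlar_const_ge; move: cotlar_const => C hC; nra.
  rewrite /psum (le_trans (normc_sum _ _ _))// /S mulr_sumr.
  rewrite big_nat [leRHS]big_nat; apply: ler_sum => j /andP[_ jm].
  rewrite normcM mulrCA ler_wpM2l ?normc_ge0// /mt normcM bprod_circle// mul1r.
  have /andP[b1 b2] := hd j jm; rewrite normc_szego -/(d j) in b1 b2 *.
  have dle : d j <= 64 * (1 - rho).
    have mh' : m%:R + 1 <= h%:R :> R by rewrite natr1 ler_nat.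
    rewrite -(ler_pM2l NR) tau.
    have -> : N%:R * (64 * (h%:R / (2 * N%:R))) = 32 * h%:R :> R by field; rewrite gt_eqF.
    have := ler0n R j; lra.
  have -> : 64 * (Num.sqrt (1 - normc (al j) ^+ 2) * (1 - rho) / d j ^+ 2) =
    Num.sqrt (1 - normc (al j) ^+ 2) / d j * ((64 * (1 - rho)) / d j).
    by field; rewrite gt_eqF.
  by rewrite ler_peMr ?divr_ge0 ?(ltW (d0 j))// ler_pdivlMr// mul1r.
have K52 : 0 <= 5 / 2 :> R by lra.
have [kV kVE kV1] : exists2 kV : R, kV = 2 * 32 ^+ 2 & 1 <= kV.
  by exists (2 * 32 ^+ 2) => //; lra.
have kV0 : 0 < kV by exact: lt_le_trans kV1.
have kap0 : 0 <= kV^-1 by rewrite invr_ge0 ltW.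
have hK i : (i < m)%N -> 1 - rho <= 5 / 2 * d i.
  move=> im; have im' := jm1 i im.
  have /andP[b1 b2] := hd i im; rewrite -/(d i) in b1 b2.
  rewrite -(ler_pM2l NR) tau.
  have -> : N%:R * (h%:R / (2 * N%:R)) = h%:R / 2 :> R by field; rewrite gt_eqF.
  lra.
(* The h points nearest to x are enough for a definite loss of modulus. *)
have hk : kV^-1 <= \sum_(0 <= i < m) (1 - normc (al i) ^+ 2) * (1 - rho) / d i ^+ 2.
  have -> : kV^-1 = \sum_(m - h <= i < m) (kV * h%:R)^-1 :> R.
    rewrite sumr_const_nat subKn// -mulr_natr; field; rewrite !gt_eqF//; lra.
  rewrite (@big_cat_nat _ _ _ (m - h) 0 m) ?leq_subr//=.
  rewrite -[leLHS]add0r; apply: lerD.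
    apply: sumr_ge0 => i _; rewrite divr_ge0 ?sqr_ge0// mulr_ge0 ?(ltW tau0)//.
    by rewrite subr_ge0 expr_le1 ?normc_ge0 ?ltW.
  rewrite big_nat [leRHS]big_nat; apply: ler_sum => i /andP[mhi im].
  have /andP[a1 a2] := ha i im; have /andP[b1 b2] := hd i im; rewrite -/(d i) in b1 b2.
  have mi : m%:R <= i%:R + h%:R :> R by rewrite -natrD ler_nat addnC -leq_subLR.
  have im' := jm1 i im.
  have dh : N%:R * d i <= 32 * h%:R by lra.
  rewrite ler_pdivlMr ?exprn_gt0//.
  apply: (@le_trans _ _ (N%:R^-1 * (1 - rho))); last by rewrite ler_wpM2r ?(ltW tau0).
  rewrite tau.
  have -> : N%:R^-1 * (h%:R / (2 * N%:R)) = h%:R / 2 / N%:R ^+ 2 :> R by field; rewrite gt_eqF.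
  rewrite ler_pdivlMr ?exprn_gt0// mulrC.
  have -> : N%:R ^+ 2 * ((kV * h%:R)^-1 * d i ^+ 2) = (N%:R * d i) ^+ 2 / (kV * h%:R).
    by field; rewrite !gt_eqF//; lra.
  have kh : 0 < kV * h%:R by rewrite mulr_gt0//; lra.
  rewrite ler_pdivrMr// kVE.
  have -> : h%:R / 2 * (2 * 32 ^+ 2 * h%:R) = (32 * h%:R) ^+ 2 :> R by field.
  by rewrite ler_sqr ?nnegrE ?mulr_ge0 ?(ltW (d0 i)) ?(ltW NR)//; lra.
have := blaschke_small x1 r01 ia K52 kap0 hK hk.
set Q := 1 - normc _ ^+ 2 in core *; move=> hQ.
rewrite /cotlar_const -kVE.
exact: cotlar_arith kV1 hQ core (normc_ge0 _) A0 S0.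
Qed.

End OneSided.

(** * Equal arcs and the Poisson kernel *)

Section Arcs.
Variable R : realType.
Implicit Types (x y : R[i]) (s t u v rho : R) (N i j l : nat).

Definition arc_end s N i : R := s + i%:R * (2 * pi / N%:R).

Lemma arc_end_lt s N i : (0 < N)%N -> arc_end s N i < arc_end s N i.+1.
Proof.
move=> N0; rewrite /arc_end ltrD2l ltr_pM2r ?ltr_nat//.
by rewrite divr_gt0 ?twopi_gt0// ltr0n.
Qed.

Lemma mean_arcs s N (h : R -> R) : (0 < N)%N -> continuous h ->
  mean s h = N%:R^-1 * \sum_(0 <= i < N) avg (arc_end s N i) (arc_end s N i.+1) h.
Proof. by move=> N0 ch; rewrite /mean (@avg_split R h s (2 * pi) N (twopi_gt0 R) N0 ch). Qed.

Lemma normc_cisB u v : normc (cis u - cis v : R[i]) = normc (1 - cis (v - u)).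
Proof.
rewrite -[RHS]mul1r -[X in X * _](normc_cis u) -normcM mulrBr mulr1 -cisD.
by rewrite subrKC.
Qed.

Variable s : R.
Hypothesis s1 : cis s = 1.

Lemma arc_dist N i t : (0 < N)%N -> arc_end s N i <= t <= arc_end s N i.+1 ->
  normc (cis t - unit_root R N ^+ i) <= 8 / N%:R.
Proof.
move=> N0 /andP[t0 t1]; have NR : 0 < N%:R :> R by rewrite ltr0n.
have -> : unit_root R N ^+ i = cis (arc_end s N i).
  by rewrite /arc_end cisD s1 mul1r unit_rootX; congr cis; ring.
rewrite normc_distC normc_cisB (le_trans (normc_1_cis_le _))// ger0_norm ?subr_ge0//.
have -> : 8 / N%:R = 2 * 4 / N%:R :> R by congr (_ / _); ring.
apply: (@le_trans _ _ (2 * pi / N%:R)); last first.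
  by rewrite ler_wpM2r ?invr_ge0 ?ler0n// ler_wpM2l// pi_le4.
move: t1; rewrite /arc_end -natr1; lra.
Qed.

(** The coordinate p of x = cis t in units of the spacing, measured from the first
    of K consecutive points of the N; reducing it modulo N = 2 K keeps all angles
    p - j below three quarters of a turn. *)
Lemma position N (K kappa : nat) i t : N = (2 * K)%N -> (0 < K)%N -> (kappa <= K)%N ->
  (i < N)%N -> arc_end s N i <= t <= arc_end s N i.+1 ->
  exists2 p : R, - (K%:R / 2) <= p <= 3 * K%:R / 2 &
    forall j, (unit_root R N ^+ (kappa + j))^* * cis t = cis (2 * pi * (p - j%:R) / N%:R).
Proof.
move=> NE K0 kK iN /andP[t0 t1]; have p0 := @twopi_gt0 R.
have KR : 0 < K%:R :> R by rewrite ltr0n.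
have NKR : N%:R = 2 * K%:R :> R by rewrite NE natrM.
have NR : 0 < N%:R :> R by rewrite NKR mulr_gt0.
pose q := (t - s) * N%:R / (2 * pi) - kappa%:R.
have kR : kappa%:R <= K%:R :> R by rewrite ler_nat.
have k0 : 0 <= kappa%:R :> R by [].
have iR : i%:R + 1 <= N%:R :> R by rewrite natr1 ler_nat.
have q0 : - K%:R <= q.
  suff : 0 <= (t - s) * N%:R / (2 * pi) by rewrite /q; lra.
  rewrite divr_ge0 ?(ltW p0)// mulr_ge0 ?(ltW NR)// subr_ge0.
  by apply: le_trans t0; rewrite lerDl mulr_ge0// divr_ge0 ?(ltW p0) ?(ltW NR).
have q1 : q <= 2 * K%:R.
  suff : (t - s) * N%:R / (2 * pi) <= N%:R by rewrite /q NKR; lra.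
  rewrite ler_pdivrMr// mulrC ler_pM2l// lerBlDl.
  apply: (le_trans t1); rewrite /arc_end lerD2l -natr1.
  by rewrite mulrCA ler_piMr ?(ltW p0)// ler_pdivrMr// mul1r.
have F (P n a b : R) : P != 0 -> n != 0 ->
    - (2 * P * (a + b) / n) + t = s + 2 * P * ((t - s) * n / (2 * P) - a - b) / n.
  by move=> P0 n0; field; rewrite P0 n0.
have E j : (unit_root R N ^+ (kappa + j))^* * cis t =
    cis (2 * pi * (q - j%:R) / N%:R).
  rewrite unit_rootX -cisN -cisD.
  have -> : - (2 * pi * (kappa + j)%:R / N%:R) + t = s + 2 * pi * (q - j%:R) / N%:R.
    by rewrite /q natrD F ?gt_eqF ?pi_gt0.
  by rewrite cisD s1 mul1r.
have [qa|qa] := ltP q (- (K%:R / 2)).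
  exists (q + N%:R) => [|j]; first by rewrite NKR; apply/andP; split; lra.
  rewrite (E j); have -> : 2 * pi * (q + N%:R - j%:R) / N%:R =
      2 * pi * (q - j%:R) / N%:R + 2 * pi by field; rewrite gt_eqF.
  by rewrite [RHS]cisD cis2pi mulr1.
have [qb|qb] := leP q (3 * K%:R / 2).
  by exists q => [|j]; [rewrite qa|exact: E j].
exists (q - N%:R) => [|j]; first by rewrite NKR; apply/andP; split; lra.
rewrite (E j); have -> : 2 * pi * (q - j%:R) / N%:R =
    2 * pi * (q - N%:R - j%:R) / N%:R + 2 * pi by field; rewrite gt_eqF.
by rewrite [LHS]cisD cis2pi mulr1.
Qed.

(** The distance to a point at depth 1 / N is comparable with 1 / N plus the angle;
    the constants come from 2 <= pi <= 4 and [normc_1_cis_ge]. *)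
Lemma den_bounds N u v : (1 < N)%N -> 0 <= v -> `|u| = 2 * pi * v / N%:R ->
  `|u| <= 3 * pi / 2 ->
  (v + 1) / 5 <= N%:R * normc (1 - (1 - N%:R^-1)%:C * cis u : R[i]) <= 8 * (v + 1).
Proof.
move=> N1 v0 uE u3; have NR : 1 < N%:R :> R by rewrite ltr1n.
have NR0 : 0 < N%:R :> R by lra.
have Ni : 0 < N%:R^-1 :> R by rewrite invr_gt0.
have Ni1 : N%:R^-1 <= 1 :> R by rewrite invf_le1// ltW.
have NN : N%:R * N%:R^-1 = 1 :> R by rewrite mulfV// gt_eqF.
set r := 1 - N%:R^-1; have r01 : 0 <= r <= 1 by apply/andP; split; rewrite /r; lra.
have a1 : normc (r%:C : R[i]) < 1.
  by case/andP: r01 => r0 _; rewrite normc_real ger0_norm// /r; lra.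
have dE : 1 - r%:C * cis u = 1 - (r%:C)^* * cis u :> R[i] by rewrite conj_real.
have c1 := normc_cis u.
have lo1 : N%:R^-1 <= normc (1 - r%:C * cis u).
  rewrite dE; apply: le_trans (normc_den_ge _ _).
  by case/andP: r01 => r0 _; rewrite c1 mulr1 normc_real ger0_norm// /r; lra.
have lo2 : `|u| / 8 <= 2 * normc (1 - r%:C * cis u).
  apply: (le_trans (normc_1_cis_ge u3)).
  have := dist_le_den r01 c1 (normc1 R); rewrite mulr1 -dE normc_distC.
  by [].
have hi : normc (1 - r%:C * cis u) <= `|u| + N%:R^-1.
  have -> : 1 - r%:C * cis u = (1 - cis u) + (N%:R^-1)%:C * cis u :> R[i].
    by rewrite /r complexRB rmorph1; ring.
  apply: (le_trans (normcD _ _)); apply: lerD; first exact: normc_1_cis_le.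
  by rewrite normcM c1 mulr1 normc_real ger0_norm// ltW.
have pi4 := @pi_le4 R; have pi2 := @pi_ge2 R.
have NU : N%:R * `|u| = 2 * pi * v by rewrite uE; field; rewrite gt_eqF.
move: lo1 lo2 hi; set D := normc _ => lo1 lo2 hi.
have h1 : N%:R * N%:R^-1 <= N%:R * D by rewrite ler_pM2l.
rewrite NN in h1.
have h2 : 2 * pi * v / 8 <= 2 * (N%:R * D) by rewrite -NU; nra.
have h3 : N%:R * D <= N%:R * (`|u| + N%:R^-1) by rewrite ler_pM2l.
rewrite mulrDr NU NN in h3.
have h4 : pi * v <= 4 * v by rewrite ler_wpM2r.
have h5 : 2 * v <= pi * v by rewrite ler_wpM2r.
by apply/andP; split; lra.
Qed.

Lemma inv_sqr_le (A D C k : R) : 0 < A -> 0 < D -> 0 <= k -> 0 <= C ->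
  A <= C * D -> k / D ^+ 2 <= C ^+ 2 * (k / A ^+ 2).
Proof.
move=> A0 D0 k0 C0 h.
have -> : C ^+ 2 * (k / A ^+ 2) = k * (C ^+ 2 / A ^+ 2) by ring.
rewrite ler_wpM2l// ler_pdivlMr ?exprn_gt0// mulrC ler_pdivrMr ?exprn_gt0//.
by rewrite -exprMn ler_sqr ?nnegrE ?mulr_ge0 ?(ltW A0) ?(ltW D0).
Qed.

Lemma radial_den_ge rho x y : 0 <= rho <= 1 -> normc x = 1 -> normc y = 1 ->
  1 - rho <= normc (1 - (rho%:C * x)^* * y).
Proof.
move=> /andP[r0 r1] x1 y1; apply: le_trans (normc_den_ge _ _).
by rewrite y1 normcM x1 !mulr1 normc_real ger0_norm.
Qed.

Lemma radial_den_diff rho x x' y y' : 0 <= rho <= 1 -> normc x = 1 -> normc x' = 1 ->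
  normc y = 1 -> normc y' = 1 ->
  normc (1 - (rho%:C * x')^* * y') <=
  normc (1 - (rho%:C * x)^* * y) + (normc (x - x') + normc (y - y')).
Proof.
move=> /andP[r0 r1] x1 x1' y1 y1'.
have -> : 1 - (rho%:C * x')^* * y' = (1 - (rho%:C * x)^* * y) +
   (rho%:C * ((x - x')^* * y) + rho%:C * (x'^* * (y - y'))).
  by rewrite !conjE; ring.
apply: (le_trans (normcD _ _)); rewrite lerD2l; apply: (le_trans (normcD _ _)).
rewrite ![normc (rho%:C * _)]normcM normc_real ger0_norm//.
rewrite [normc ((x - x')^* * y)]normcM normcJ y1 mulr1.
rewrite [normc (x'^* * _)]normcM normcJ x1' mul1r.
by apply: lerD; rewrite ler_piMl ?normc_ge0.
Qed.

Lemma dpoissonN N rho i l : (0 < N)%N -> 0 <= rho ->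
  N%:R * dpoisson N rho i l =
  (1 - rho ^+ 2) / normc (1 - (rho%:C * unit_root R N ^+ i)^* * unit_root R N ^+ l) ^+ 2.
Proof.
by move=> N0 r0; rewrite dpoissonE// mulrC divfK// pnatr_eq0 -lt0n.
Qed.

(** The points move by O(1 / N) to the ends of their arcs, hence by at most a multiple
    of 1 - rho, which is a lower bound of the denominator. *)
Lemma poisson_arcs N rho i l t t' : (0 < N)%N -> dradius N rho ->
  arc_end s N i <= t <= arc_end s N i.+1 ->
  arc_end s N l <= t' <= arc_end s N l.+1 ->
  poisson (rho%:C * cis t) (cis t') <= 33 ^+ 2 * (N%:R * dpoisson N rho i l).
Proof.
move=> N0 dr ti tl; have [r0 r1] := dradius01 N0 dr; have /andP[_ r2] := dr.
have NR : 0 < N%:R :> R by rewrite ltr0n.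
have r01 : 0 <= rho <= 1 by rewrite r0 ltW.
have u1 k := normc_unit_rootX R N k.
rewrite dpoissonN// /poisson normcM normc_cis mulr1 normc_real ger0_norm//.
have low := radial_den_ge r01 (normc_cis t) (normc_cis t').
have low' := radial_den_ge r01 (u1 i) (u1 l).
have h2 : (2 * N%:R)^-1 <= 1 - rho by lra.
have i2 : 0 < (2 * N%:R)^-1 :> R by rewrite invr_gt0 mulr_gt0.
apply: inv_sqr_le; try lra; first by nra.
apply: (le_trans (radial_den_diff r01 (normc_cis t) (u1 i) (normc_cis t') (u1 l))).
have := arc_dist N0 ti; have := arc_dist N0 tl.
have -> : 8 / N%:R = 16 * (2 * N%:R)^-1 :> R by field; rewrite gt_eqF.
lra.
Qed.

(** After [poisson_arcs] on each arc, only the mean of phi over the arc is left. *)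
Lemma mean_poisson_arcs N rho i t (phi : R -> R) : (0 < N)%N -> dradius N rho ->
  arc_end s N i <= t <= arc_end s N i.+1 -> continuous phi -> (forall u, 0 <= phi u) ->
  mean s (fun u => phi u * poisson (rho%:C * cis t) (cis u)) <=
  33 ^+ 2 * \sum_(l < N) dpoisson N rho i l * avg (arc_end s N l) (arc_end s N l.+1) phi.
Proof.
move=> N0 dr ti cphi phi0; have [r0 r1] := dradius01 N0 dr.
have NR : 0 < N%:R :> R by rewrite ltr0n.
have z1 : normc (rho%:C * cis t) < 1.
  by rewrite normcM normc_cis mulr1 normc_real ger0_norm.
have cP := cont_poisson z1.
rewrite (mean_arcs s N0); last exact: contM.
rewrite big_mkord !mulr_sumr; apply: ler_sum => l _.
apply: (@le_trans _ _ (N%:R^-1 * avg (arc_end s N l) (arc_end s N l.+1)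
    (fun u => (33 ^+ 2 * (N%:R * dpoisson N rho i l)) * phi u))).
  rewrite ler_pM2l ?invr_gt0//; apply: avg_le; first exact: arc_end_lt.
  - exact: contM.
  - by apply: contM => //; exact: cont_cst.
  - by move=> u hu; rewrite mulrC ler_wpM2r// poisson_arcs.
rewrite avgZ// le_eqVlt; apply/orP; left; apply/eqP.
by field; rewrite gt_eqF.
Qed.

End Arcs.

(** * Reversing the order of the points *)

Section Reversal.
Variable R : realType.
Implicit Types (al c : nat -> R[i]) (x : R[i]).

(** Conjugating on the circle and multiplying by the full Blaschke product reverses
    the order of the points. *)
Lemma psum_reverse al c K m x : indisc al -> normc x = 1 -> (m <= K)%N ->
  normc (psum al c m K x) =
  normc (psum (fun j => al (K - j.+1)%N)
    (fun j => (c (K - j.+1)%N)^* * unimodular (al (K - j.+1)%N)) 0 (K - m) x).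
Proof.
move=> ia x1 mK; set be := fun j => al (K - j.+1)%N.
set c' := fun j => _; have B1 := bprod_circle 0 K ia x1.
suff E : (psum al c m K x)^* * bprod al 0 K x = x * psum be c' 0 (K - m) x.
  rewrite -[LHS]mulr1 -{1}B1 -normcJ -normcM E normcM x1 mul1r.
  by [].
rewrite /psum conj_sum mulr_suml mulr_sumr big_nat_rev/= -{1}[m]add0n big_addn.
apply: eq_big_nat => j /andP[_ jK].
have -> : (m + K - (j + m).+1)%N = (K - j.+1)%N by rewrite -addSn addnC subnDr.
have kK : (K - j.+1 < K)%N.
  by rewrite ltn_subrL/= (leq_ltn_trans (leq0n _) (leq_trans jK (leq_subr _ _))).
rewrite conjM -mulrA mt_dual_circle// /mt_dual /mt /c'.
have -> : bprod al (K - j.+1).+1 K x = bprod be 0 j x.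
  rewrite /bprod big_nat_rev/= -{1}[(K - j.+1).+1]add0n big_addn.
  have jK' : (j < K)%N by exact: leq_trans jK (leq_subr _ _).
  have -> : (K - (K - j.+1).+1)%N = j by rewrite subnSK// subKn// ltnW.
  apply: eq_big_nat => i /andP[_ ij]; rewrite /be; congr (bfactor (al _) x).
  by lia.
ring.
Qed.

End Reversal.

(** * Finite maxima *)

Section BigMax.
Variable R : realType.

Lemma bigmax_seq_le (I : eqType) (r : seq I) (F : I -> R) b : 0 <= b ->
  (forall i, i \in r -> F i <= b) -> \big[Num.max/0]_(i <- r) F i <= b.
Proof.
move=> b0 h; rewrite big_seq; elim/big_ind: _ => // x y xb yb.
by rewrite ge_max xb yb.
Qed.

Lemma bigmax_seq_ge0 (I : Type) (r : seq I) (F : I -> R) :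
  0 <= \big[Num.max/0]_(i <- r) F i.
Proof.
elim: r => [|j r IH]; first by rewrite big_nil.
by rewrite big_cons le_max IH orbT.
Qed.

Lemma bigmax_seq_ge (I : eqType) (r : seq I) (F : I -> R) i : i \in r ->
  F i <= \big[Num.max/0]_(i <- r) F i.
Proof.
elim: r => // j r IH; rewrite in_cons big_cons le_max => /orP[/eqP->|/IH ->].
  by rewrite lexx.
by rewrite orbT.
Qed.

Lemma bigmax_seq_attained (I : eqType) (r : seq I) (F : I -> R) i0 :
  (forall i, i \in r -> 0 <= F i) -> i0 \in r ->
  exists2 i, i \in r & \big[Num.max/0]_(i <- r) F i = F i.
Proof.
elim: r i0 => // j r IH i0 F0 _; rewrite big_cons.
have Fj : 0 <= F j by apply: F0; rewrite mem_head.
case: r IH F0 => [|k r] IH F0.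
  by exists j; rewrite ?mem_head// big_nil max_l.
have [|i ir ->] := IH k _ (mem_head _ _).
  by move=> i ir; apply: F0; rewrite in_cons ir orbT.
have [h|h] := leP (F j) (F i).
  by exists i => //; rewrite in_cons ir orbT.
by exists j => //; rewrite mem_head.
Qed.

End BigMax.

(** * The maximal inequality for half a level *)

Section HalfLevel.
Variable R : realType.
Variables (K kappa N : nat) (al c : nat -> R[i]) (s : R).
Hypotheses (K0 : (0 < K)%N) (NE : N = (2 * K)%N) (kK : (kappa <= K)%N)
  (s1 : cis s = 1) (ia : indisc al)
  (alE : forall j, (j < K)%N -> al j = (1 - N%:R^-1)%:C * unit_root R N ^+ (kappa + j)).

Let phi t := normc (psum al c 0 K (cis t)).
Let d j t := normc (1 - (al j)^* * cis t).
Let sz j := Num.sqrt (1 - normc (al j) ^+ 2).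
(* The weight of the coefficient c j in the error term, as a mass at its arc. *)
Let tailc j := Num.sqrt (2 / N%:R) * (45 ^+ 2 * N%:R) * normc (c j).
Let radius h : R := 1 - h%:R / (2 * N%:R).
Let err h i := \sum_(0 <= j < K) dpoisson N (radius h) i (kappa + j) * tailc j.

Let N2 : (1 < N)%N. Proof. by rewrite NE; lia. Qed.
Let N0 : (0 < N)%N. Proof. exact: ltnW. Qed.
Let NR : 0 < (N%:R : R). Proof. by rewrite ltr0n. Qed.
Let NKR : (N%:R : R) = 2 * K%:R. Proof. by rewrite NE natrM. Qed.
Let NR2 : 2 <= (N%:R : R). Proof. by rewrite ler_nat. Qed.
Let NV : 0 < (N%:R^-1 : R). Proof. by rewrite invr_gt0. Qed.
Let NV2 : (N%:R^-1 : R) <= 1 / 2.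
Proof. by rewrite -div1r ler_pdivrMr//; move: NR2; lra. Qed.

Let normal j : (j < K)%N -> normc (al j) = 1 - N%:R^-1.
Proof.
move=> jK; rewrite (alE jK) normcM normc_unit_rootX mulr1 normc_real ger0_norm//; move: NV2; lra.
Qed.

Let alsq j : (j < K)%N -> N%:R^-1 <= 1 - normc (al j) ^+ 2 <= 2 / N%:R.
Proof.
by move=> jK; rewrite normal//; move: NV NV2; set e := N%:R^-1 => e0 e1; apply/andP; split; nra.
Qed.

Let radiusP h : (0 < h <= 2 * N)%N -> dradius N (radius h).
Proof.
move=> /andP[h0 hN]; rewrite /dradius /radius subr_ge0 lerD2l lerN2.
rewrite ler_pdivrMr ?mulr_gt0// mul1r -natrM ler_nat hN/=.
by rewrite -[leLHS]mul1r ler_wpM2r ?invr_ge0 ?mulr_ge0 ?ler0n// ler1n.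
Qed.

(** Up to O(1 / N) the denominator [d j t] is that of the discrete Poisson kernel
    between the arc of cis t and the point of the circle above [al j]; being at
    least of order h / N it absorbs that error. *)
Let term_bound i t h j (v : R) : arc_end s N i <= t <= arc_end s N i.+1 ->
  (0 < h <= 2 * N)%N -> (j < K)%N -> h%:R <= v + 1 -> (v + 1) / 5 <= N%:R * d j t ->
  normc (c j) * (sz j * (1 - radius h) / d j t ^+ 2) <=
  dpoisson N (radius h) i (kappa + j) * tailc j.
Proof.
move=> ti hN jK hv hd; have dr := radiusP hN.
have [r0 r1] := dradius01 N0 dr; have r01 : 0 <= radius h <= 1 by rewrite r0 ltW.
have h0 : 1 <= h%:R :> R by rewrite ler1n; case/andP: hN.
have tau : 1 - radius h = h%:R / (2 * N%:R) by rewrite /radius; ring.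
have x1 := normc_cis t; have u1 k := normc_unit_rootX R N k.
have d0 : 0 < d j t by rewrite normc_gt0 disc_den_neq0// x1.
have nd : N%:R * (1 - radius h) <= 5 / 2 * (N%:R * d j t).
  rewrite tau (_ : N%:R * (h%:R / (2 * N%:R)) = h%:R / 2); first by lra.
  by field; rewrite gt_eqF.
have tau_d : 1 - radius h <= 5 / 2 * d j t by rewrite -(ler_pM2l NR) mulrCA.
have n8 : 8 / N%:R <= 40 * d j t.
  by rewrite ler_pdivrMr// -mulrA [d j t * _]mulrC; lra.
set y := unit_root R N ^+ (kappa + j).
have ry : 0 <= 1 - (N%:R^-1 : R) <= 1 by apply/andP; split; move: NV NV2; lra.
have xy : normc (cis t - y) <= 2 * d j t.
  have := dist_le_den ry x1 (u1 (kappa + j)%N).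
  by rewrite /d (alE jK).
set A := normc (1 - ((radius h)%:C * unit_root R N ^+ i)^* * y).
have A0 : 0 < A.
  rewrite normc_gt0 disc_den_neq0 ?u1//.
  by rewrite normcM u1 mulr1 normc_real ger0_norm.
have hA : A <= 45 * d j t.
  have e : normc (1 - ((radius h)%:C * cis t)^* * cis t) = 1 - radius h.
    rewrite conjM conj_real -mulrA [_^* * cis t]mulrC -sqr_normcC x1 expr1n mulr1.
    rewrite -(rmorph1 (real_complex R)) -complexRB normc_real ger0_norm//; lra.
  have := radial_den_diff r01 x1 (u1 i) x1 (u1 (kappa + j)%N).
  have := arc_dist s1 N0 ti.
  rewrite -/y -/A e; move: tau_d n8 xy; lra.
have key : (1 - radius h) / d j t ^+ 2 <=
    45 ^+ 2 * (N%:R * dpoisson N (radius h) i (kappa + j)).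
  apply: (@le_trans _ _ (45 ^+ 2 * ((1 - radius h) / A ^+ 2))).
    by apply: inv_sqr_le => //; lra.
  rewrite ler_pM2l ?exprn_gt0// dpoissonN// ler_wpM2r ?invr_ge0 ?sqr_ge0//; nra.
have sle : sz j <= Num.sqrt (2 / N%:R).
  by rewrite ler_wsqrtr//; case/andP: (alsq jK).
have -> : normc (c j) * (sz j * (1 - radius h) / d j t ^+ 2) =
  normc (c j) * (sz j * ((1 - radius h) / d j t ^+ 2)) by ring.
have -> : dpoisson N (radius h) i (kappa + j) * tailc j = normc (c j) *
  (Num.sqrt (2 / N%:R) * (45 ^+ 2 * (N%:R * dpoisson N (radius h) i (kappa + j)))).
  by rewrite /tailc; ring.
rewrite ler_wpM2l ?normc_ge0// ler_pM ?sqrtr_ge0//.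
by rewrite divr_ge0 ?sqr_ge0//; lra.
Qed.

(** The points kept lie on one side of x when m is below the position p of x; when
    it is above, the same holds for the points dropped, in the reversed order. *)
Lemma half_level_pointwise i t m : (i < N)%N -> (m <= K)%N ->
  arc_end s N i <= t <= arc_end s N i.+1 ->
  exists2 h, (0 < h <= 2 * N)%N &
    normc (psum al c 0 m (cis t)) <= phi t + cotlar_const R *
     (mean s (fun u => phi u * poisson ((radius h)%:C * cis t) (cis u)) + err h i).
Proof.
move=> iN mK ti; have x1 := normc_cis t.
have [p /andP[p0 p1] pE] := position s1 NE K0 kK iN ti.
have KR : 1 <= K%:R :> R by rewrite ler1n.
have bounds j : (j < K)%N ->
    (`|p - j%:R| + 1) / 5 <= N%:R * d j t <= 8 * (`|p - j%:R| + 1).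
  move=> jK; have -> : d j t = normc (1 - (1 - N%:R^-1)%:C * cis (2 * pi * (p - j%:R) / N%:R)).
    by rewrite /d (alE jK) conjM conj_real -mulrA pE.
  have jR : j%:R + 1 <= K%:R :> R by rewrite natr1 ler_nat.
  have j0 : 0 <= j%:R :> R by [].
  have uE : `|2 * pi * (p - j%:R) / N%:R| = 2 * pi * `|p - j%:R| / N%:R.
    rewrite normrM normrM normfV [`|2 * pi|]ger0_norm ?(ltW (twopi_gt0 R))//.
    by rewrite [`|N%:R|]ger0_norm// ltW.
  apply: den_bounds => //; rewrite uE ler_pdivrMr// NKR.
  have : `|p - j%:R| <= 3 * K%:R / 2 by rewrite ler_norml; apply/andP; split; lra.
  have := @pi_gt0 R; nra.
have C0 : 0 <= cotlar_const R by have := cotlar_const_ge R; lra.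
have mean0 h : (0 < h <= 2 * N)%N ->
    0 <= mean s (fun u => phi u * poisson ((radius h)%:C * cis t) (cis u)).
  move=> hN; have [r0 r1] := dradius01 N0 (radiusP hN).
  apply: avg_ge0; first exact: mean_lt.
  move=> u; rewrite mulr_ge0 ?normc_ge0// poisson_ge0//.
  by rewrite normcM x1 mulr1 normc_real ger0_norm// ltW.
have dp0 h j : (0 < h <= 2 * N)%N -> 0 <= dpoisson N (radius h) i (kappa + j) * tailc j.
  move=> hN; rewrite mulr_ge0 ?dpoisson_ge0 ?radiusP//.
  by rewrite !mulr_ge0 ?sqrtr_ge0 ?normc_ge0 ?ler0n.
have err0 h : (0 < h <= 2 * N)%N -> 0 <= err h i.
  by move=> hN; apply: sumr_ge0 => j _; exact: dp0.
have triv h : (0 < h <= 2 * N)%N -> 0 <= cotlar_const R *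
     (mean s (fun u => phi u * poisson ((radius h)%:C * cis t) (cis u)) + err h i).
  by move=> hN; rewrite mulr_ge0// addr_ge0 ?mean0 ?err0.
have one_h : (0 < 1 <= 2 * N)%N by rewrite muln_gt0.
have phi0 : 0 <= phi t by exact: normc_ge0.
(* The scale: at least 1, and comparable with the distance [y] to the truncation. *)
have scale (y : R) : -1 < y -> y <= 3 * K%:R / 2 -> exists h : nat,
    (0 < h <= 2 * N)%N && (h%:R <= y + 2 <= 3 * h%:R).
  move=> y0 y1; exists (Num.truncn (y + 1)).+1.
  have yp : 0 <= y + 1 by lra.
  have /andP[h1 h2] := truncn_itv yp.
  have h3 : (Num.truncn (y + 1)).+1%:R <= y + 2 by rewrite -natr1; lra.
  have h4 : 1 <= (Num.truncn (y + 1)).+1%:R :> R by rewrite ler1n.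
  rewrite /= h3 -(ler_nat R) natrM NKR; apply/and3P; split => //; lra.
have [mp|pm] := leP m%:R p.
  have [m0|m0] := posnP m.
    exists 1%N => //; rewrite m0 /psum big_geq// normc0; apply: addr_ge0 => //; exact: triv.
  have m1 : 1 <= m%:R :> R by rewrite ler1n.
  have [||h /andP[hN hy]] := scale (p - m%:R); [lra|lra|].
  exists h => //; have /andP[hy1 hy2] := hy.
  have absE j : (j < m)%N -> `|p - j%:R| = p - j%:R.
    move=> jm; rewrite ger0_norm//.
    have : j%:R + 1 <= m%:R :> R by rewrite natr1 ler_nat.
    lra.
  have := @one_sided R al c (cis t) p s (radius h) m K h N erefl ia x1 N0.
  rewrite m0 mK hN => /(_ isT isT hy) => H.
  apply: le_trans (H _ _ _) _.
  - lra.
  - by move=> j jm; apply: alsq; exact: leq_trans mK.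
  - by move=> j jm; rewrite -absE//; apply: bounds; exact: leq_trans mK.
  rewrite -[leLHS]add0r; apply: lerD => //; rewrite ler_wpM2l// lerD2l.
  apply: (@le_trans _ _ (\sum_(0 <= j < m) dpoisson N (radius h) i (kappa + j) * tailc j)).
    rewrite big_nat [leRHS]big_nat; apply: ler_sum => j /andP[_ jm].
    have jK : (j < K)%N by exact: leq_trans mK.
    have jm1 : j%:R + 1 <= m%:R :> R by rewrite natr1 ler_nat.
    apply: (@term_bound i t h j `|p - j%:R|) => //; last by case/andP: (bounds j jK).
    by rewrite absE//; lra.
  rewrite /err (@big_cat_nat _ _ _ m 0 K)//= lerDl.
  by apply: sumr_ge0 => j _; exact: dp0.
have psplit : psum al c 0 m (cis t) = psum al c 0 K (cis t) - psum al c m K (cis t).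
  by rewrite (@psum_cat _ al c 0 m K)//= addrK.
have [h [hN hB]] : exists h, (0 < h <= 2 * N)%N /\
    normc (psum al c m K (cis t)) <= cotlar_const R *
     (mean s (fun u => phi u * poisson ((radius h)%:C * cis t) (cis u)) + err h i); last first.
  exists h => //; rewrite psplit (le_trans (normcB _ _))// lerD2l.
  exact: hB.
move: mK; rewrite leq_eqVlt => /orP[/eqP->|mK].
  by exists 1%N; split => //; rewrite /psum big_geq// normc0; exact: triv.
have mR : m%:R + 1 <= K%:R :> R by rewrite natr1 ler_nat.
have m0 : 0 <= m%:R :> R by [].
pose p' := K%:R - 1 - p; pose m' := (K - m)%N.
have m'R : m'%:R = K%:R - m%:R :> R by rewrite /m' natrB// ltnW.
have [||h /andP[hN hy]] := scale (p' - m'%:R); [by rewrite /p' m'R; lra|by rewrite /p' m'R; lra|].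
exists h; split => //; have /andP[hy1 hy2] := hy.
rewrite (psum_reverse c ia x1 (ltnW mK)).
set be := fun j => al (K - j.+1)%N; set c' := fun j => _.
have ib : indisc be by move=> j; exact: ia.
have m'0 : (0 < m')%N by rewrite subn_gt0.
have m'K : (m' <= K)%N by exact: leq_subr.
have jpK j : (j < K)%N -> (K - j.+1)%:R = K%:R - 1 - j%:R :> R.
  by move=> jK; rewrite natrB// -natr1; ring.
have ltK j : (K - j.+1 < K)%N by rewrite ltn_subrL K0.
have absE j : (j < m')%N -> `|p - (K - j.+1)%:R| = p' - j%:R.
  move=> jm; have jK : (j < K)%N by exact: leq_trans m'K.
  have jm1 : j%:R + 1 <= m'%:R :> R by rewrite natr1 ler_nat.
  by rewrite jpK// distrC ger0_norm /p'; move: jm1; rewrite m'R; lra.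
have phiE u : normc (psum be c' 0 K (cis u)) = phi u.
  by rewrite /phi (psum_reverse c ia (normc_cis u) (leq0n K)) subn0.
have := @one_sided R be c' (cis t) p' s (radius h) m' K h N erefl ib x1 N0.
rewrite m'0 m'K hN => /(_ isT isT hy) => H.
apply: le_trans (H _ _ _) _.
- by rewrite m'R /p'; lra.
- by move=> j jm; apply: alsq; exact: ltK.
- by move=> j jm; rewrite -absE//; apply: bounds; exact: ltK.
rewrite ler_wpM2l//.
rewrite (@eq_mean _ s _ (fun u => phi u * poisson ((radius h)%:C * cis t) (cis u))); last first.
  by move=> u; rewrite phiE.
rewrite lerD2l.
apply: (@le_trans _ _ (\sum_(0 <= j < m')
    dpoisson N (radius h) i (kappa + (K - j.+1)) * tailc (K - j.+1))).
  rewrite big_nat [leRHS]big_nat; apply: ler_sum => j /andP[_ jm].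
  have jm1 : j%:R + 1 <= m'%:R :> R by rewrite natr1 ler_nat.
  have -> : normc (c' j) = normc (c (K - j.+1)%N).
    by rewrite /c' normcM normcJ normc_unimodular mulr1.
  apply: (@term_bound i t h _ `|p - (K - j.+1)%:R|) => //; last by case/andP: (bounds _ (ltK j)).
  by rewrite absE//; lra.
rewrite /err [leRHS]big_nat_rev/= (@big_cat_nat _ _ _ m' 0 K)//= add0n lerDl.
by apply: sumr_ge0 => j _; exact: dp0.
Qed.

Definition half_level_const : R :=
  2 + 2 * cotlar_const R ^+ 2 * (10 ^+ 4 * (2 * (33 ^+ 2) ^+ 2 + 4 * (45 ^+ 2) ^+ 2)).

(** Both terms of [half_level_pointwise] are values of discrete Poisson averages of
    one function on the arcs: means of |psum| over arcs, plus the coefficients placed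
    at the arcs of their points. *)
Theorem half_level_maximal :
  mean s (fun t => (\big[Num.max/0]_(0 <= m < K.+1) normc (psum al c 0 m (cis t))) ^+ 2) <=
  half_level_const * \sum_(0 <= j < K) normc (c j) ^+ 2.
Proof.
pose A l := avg (arc_end s N l) (arc_end s N l.+1) phi.
pose C l := if (kappa <= l < kappa + K)%N then tailc (l - kappa) else 0.
pose G l := 33 ^+ 2 * A l + C l.
pose Mx i := \big[Num.max/0]_(1 <= h < (2 * N).+1) \sum_(l < N) dpoisson N (radius h) i l * G l.
have cphi : continuous phi by apply: cont_normc; exact: ccont_psum.
have phi0 u : 0 <= phi u by exact: normc_ge0.
have A0 l : 0 <= A l by apply: avg_ge0 => //; exact: arc_end_lt.
have T0 j : 0 <= tailc j by rewrite !mulr_ge0 ?sqrtr_ge0 ?normc_ge0 ?ler0n.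
have C0 l : 0 <= C l by rewrite /C; case: ifP.
have G0 l : 0 <= G l by rewrite addr_ge0// mulr_ge0// sqr_ge0.
have cc0 : 0 <= cotlar_const R by have := cotlar_const_ge R; lra.
have sumC (F : nat -> R) : \sum_(l < N) F l * C l = \sum_(0 <= j < K) F (kappa + j)%N * tailc j.
  rewrite -(big_mkord xpredT (fun l => F l * C l)).
  rewrite (@big_cat_nat _ _ _ kappa 0 N)//=; last by rewrite NE; lia.
  rewrite (@big_cat_nat _ _ _ (kappa + K) kappa N) ?leq_addr//=; last by rewrite NE; lia.
  rewrite big_nat big1 ?add0r; last first.
    by move=> l /andP[_ lk]; rewrite /C leqNgt lk/= mulr0.
  rewrite [X in _ + X]big_nat [X in _ + X]big1 ?addr0; last first.
    by move=> l /andP[lk _]; rewrite /C [(l < _)%N]ltnNge lk andbF mulr0.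
  rewrite -{1}[kappa]add0n big_addn addKn; apply: eq_big_nat => j /andP[_ jK].
  by rewrite /C addnC leq_addr/= ltn_add2l jK addKn.
have pw i t m : (i < N)%N -> arc_end s N i <= t <= arc_end s N i.+1 -> (m <= K)%N ->
    normc (psum al c 0 m (cis t)) <= phi t + cotlar_const R * Mx i.
  move=> iN ti mK; have [h hN H] := half_level_pointwise iN mK ti.
  apply: (le_trans H); rewrite lerD2l ler_wpM2l//.
  apply: (@le_trans _ _ (\sum_(l < N) dpoisson N (radius h) i l * G l)); last first.
    apply: (@bigmax_seq_ge _ _ _ (fun h => \sum_(l < N) dpoisson N (radius h) i l * G l)).
    by rewrite mem_index_iota ltnS.
  rewrite /G; under eq_bigr do rewrite mulrDr; rewrite big_split/= sumC.
  apply: lerD => //; apply: (le_trans (mean_poisson_arcs s1 N0 (radiusP hN) ti cphi phi0)).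
  by rewrite mulr_sumr; apply: ler_sum => l _; rewrite mulrCA.
have Mx0 i : 0 <= Mx i by exact: bigmax_seq_ge0.
have maxM : \sum_(i < N) Mx i ^+ 2 <= 10 ^+ 4 * \sum_(l < N) G l ^+ 2.
  apply: discrete_maximal_pointwise => // i iN.
  have in1 : 1%N \in index_iota 1 (2 * N).+1 by rewrite mem_index_iota; lia.
  have in0 h : h \in index_iota 1 (2 * N).+1 ->
      0 <= \sum_(l < N) dpoisson N (radius h) i l * G l.
    rewrite mem_index_iota ltnS => hN; apply: sumr_ge0 => l _.
    by rewrite mulr_ge0// dpoisson_ge0// radiusP.
  have [h hin E] := bigmax_seq_attained in0 in1.
  exists (radius h); last by rewrite /Mx E.
  by apply: radiusP; move: hin; rewrite mem_index_iota ltnS.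
set S := \sum_(0 <= j < K) normc (c j) ^+ 2.
have phiS : mean s (fun t => phi t ^+ 2) = S by exact: mean_sqr_psum.
have cphi2 : continuous (fun t => phi t ^+ 2) by exact: contX.
have sumA : \sum_(l < N) A l ^+ 2 <= N%:R * S.
  rewrite -phiS (mean_arcs s N0 cphi2) mulrA mulfV ?gt_eqF// mul1r big_mkord.
  by apply: ler_sum => l _; apply: avg_sqr => //; exact: arc_end_lt.
have sumC2 : \sum_(l < N) C l ^+ 2 = 2 * (45 ^+ 2) ^+ 2 * (N%:R * S).
  under eq_bigr do rewrite expr2.
  rewrite sumC /S !mulr_sumr; apply: eq_big_nat => j /andP[_ jK].
  rewrite /C leq_addr/= ltn_add2l jK addKn /tailc.
  have q2 : Num.sqrt (2 / N%:R) ^+ 2 = 2 / N%:R :> R by rewrite sqr_sqrtr// divr_ge0 ?ltW.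
  set q := Num.sqrt _ in q2 *.
  transitivity (q ^+ 2 * ((45 ^+ 2 * N%:R) ^+ 2 * normc (c j) ^+ 2)); first by ring.
  by rewrite q2; field; rewrite gt_eqF.
have S0 : 0 <= S by apply: sumr_ge0 => j _; exact: sqr_ge0.
have NS0 : 0 <= N%:R * S by rewrite mulr_ge0// ltW.
have sumG : \sum_(l < N) G l ^+ 2 <=
    (2 * (33 ^+ 2) ^+ 2 + 4 * (45 ^+ 2) ^+ 2) * (N%:R * S).
  apply: (@le_trans _ _ (2 * (33 ^+ 2) ^+ 2 * \sum_(l < N) A l ^+ 2 +
      2 * \sum_(l < N) C l ^+ 2)).
    rewrite !mulr_sumr -big_split/=; apply: ler_sum => l _.
    rewrite /G; move: (33 ^+ 2 : R) => w; have := sqr_ge0 (w * A l - C l); nra.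
  rewrite sumC2 [leRHS]mulrDl; apply: lerD.
    by rewrite ler_wpM2l// mulr_ge0// sqr_ge0.
  by rewrite le_eqVlt; apply/orP; left; apply/eqP; ring.
set D := 2 * (33 ^+ 2) ^+ 2 + 4 * (45 ^+ 2) ^+ 2 in sumG *.
have D0 : 0 <= D by rewrite addr_ge0// mulr_ge0// sqr_ge0.
have cF m : continuous (fun t => normc (psum al c 0 m (cis t))).
  by apply: cont_normc; exact: ccont_psum.
have cMax := @cont_bigmax R _ (index_iota 0 K.+1) _ cF.
rewrite (mean_arcs s N0); last exact: contX.
rewrite ler_pdivrMl// big_mkord.
apply: (@le_trans _ _ (\sum_(i < N) (2 * avg (arc_end s N i) (arc_end s N i.+1)
    (fun t => phi t ^+ 2) + 2 * cotlar_const R ^+ 2 * Mx i ^+ 2))).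
  apply: ler_sum => i _; have ai := arc_end_lt s i N0.
  have cst1 : continuous (fun _ : R => 2 * cotlar_const R ^+ 2 * Mx i ^+ 2).
    exact: cont_cst.
  have c2phi : continuous (fun t => 2 * phi t ^+ 2).
    by apply: contM => //; exact: cont_cst.
  rewrite -avgZ// -[X in _ + X](avg_cst _ ai) -avgD//.
  apply: avg_le => //; [exact: contX|exact: contD|move=> t ti].
  set W := \big[_/_]_(_ <- _) _.
  have W0 : 0 <= W by exact: bigmax_seq_ge0.
  have Wle : W <= phi t + cotlar_const R * Mx i.
    apply: bigmax_seq_le => [|m]; first by rewrite addr_ge0// mulr_ge0.
    by rewrite mem_index_iota ltnS => /andP[_ mK]; exact: pw.
  have := phi0 t; move: (phi t) Wle (Mx0 i) cc0 => f Wle M0 k0 f0.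
  have b0 : 0 <= cotlar_const R * Mx i by exact: mulr_ge0.
  rewrite -mulrA -exprMn; move: (cotlar_const R * Mx i) b0 Wle => b b0 Wle.
  have : W ^+ 2 <= (f + b) ^+ 2 by rewrite ler_sqr ?nnegrE ?addr_ge0.
  by have := sqr_ge0 (f - b); lra.
rewrite big_split/= -!mulr_sumr.
have -> : \sum_(i < N) avg (arc_end s N i) (arc_end s N i.+1) (fun t => phi t ^+ 2) =
    N%:R * S.
  by rewrite -phiS (mean_arcs s N0 cphi2) mulrA mulfV ?gt_eqF// mul1r big_mkord.
have -> : N%:R * (half_level_const * S) = 2 * (N%:R * S) +
    2 * cotlar_const R ^+ 2 * (10 ^+ 4 * (D * (N%:R * S))).
  by rewrite /half_level_const -/D; ring.
have k2 : 0 <= 2 * cotlar_const R ^+ 2 by apply: mulr_ge0; [exact: ler0n|exact: sqr_ge0].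
have t4 : 0 <= 10 ^+ 4 :> R by apply: exprn_ge0; exact: ler0n.
rewrite lerD2l (ler_wpM2l k2)//.
exact: le_trans maxM (ler_wpM2l t4 sumG).
Qed.

End HalfLevel.

(** * Blaschke products of the dyadic points *)

(** The homogeneous form of the factorisation of X ^ N - 1. *)
Lemma prod_primitive_root (F : fieldType) N (w u v : F) : N.-primitive_root w ->
  \prod_(0 <= j < N) (u - v * w ^+ j) = u ^+ N - v ^+ N.
Proof.
move=> prim; have N0 := prim_order_gt0 prim.
have [->|v0] := eqVneq v 0.
  rewrite (expr0n _ N) gtn_eqF// subr0 -[in RHS](subn0 N) -prodr_const_nat.
  by apply: eq_bigr => j _; rewrite mul0r subr0.
have /(congr1 (fun p => p.[u / v])) := factor_Xn_sub_1 prim.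
rewrite horner_prod hornerD hornerN hornerXn hornerC => E.
have -> : u ^+ N - v ^+ N = v ^+ N * ((u / v) ^+ N - 1).
  by rewrite mulrBr mulr1 -exprMn mulrCA mulfV// mulr1.
rewrite -E -[in v ^+ N](subn0 N) -prodr_const_nat -big_split/=.
by apply: eq_bigr => j _; rewrite hornerXsubC mulrBr mulrCA mulfV// mulr1.
Qed.

Section DyadicPoints.
Variable R : realType.
Implicit Types (k l i j N : nat) (z w u v : R[i]).

Definition dy j : R[i] := dyadic_points R j.+1.

(** The index of the first point of level k, which has 2 ^ k points. *)
Definition lev k := (2 ^ k).-1.

Lemma levE k : (lev k).+1 = (2 ^ k)%N.
Proof. by rewrite /lev prednK// expn_gt0. Qed.

Lemma lev_le k l : (k <= l)%N -> (lev k <= lev l)%N.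
Proof. by move=> kl; rewrite -ltnS !levE leq_pexp2l. Qed.

Lemma levS k : lev k.+1 = (lev k + 2 ^ k)%N.
Proof. by apply: succn_inj; rewrite -addSn !levE expnS mul2n addnn. Qed.

(** The common modulus of the points of level k. *)
Definition rad k : R := 1 - (2 ^ k)%:R^-1.

Lemma rad_bounds k : 0 <= rad k < 1.
Proof.
have h : 0 < (2 ^ k)%:R :> R by rewrite ltr0n expn_gt0.
rewrite /rad subr_ge0 invf_le1// ler1n expn_gt0/=.
by rewrite ltrBlDr ltrDl invr_gt0.
Qed.

Lemma rad_le k l : (k <= l)%N -> rad k <= rad l.
Proof.
move=> kl; rewrite /rad lerD2l lerN2 lef_pV2 ?posrE ?ltr0n ?expn_gt0//.
by rewrite ler_nat leq_pexp2l.
Qed.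

Lemma rad_lt k l : (k < l)%N -> rad k < rad l.
Proof.
move=> kl; rewrite /rad ltrD2l ltrN2 ltf_pV2 ?posrE ?ltr0n ?expn_gt0//.
by rewrite ltr_nat ltn_exp2l.
Qed.

Lemma normc_dy j : normc (dy j) = rad (trunc_log 2 j.+1).
Proof.
rewrite /dy /dyadic_points normcM normc_cis mulr1 normc_real -natrX -/(rad _) ger0_norm//.
by case/andP: (rad_bounds (trunc_log 2 j.+1)).
Qed.

Lemma indisc_dy : indisc dy.
Proof. by move=> j; rewrite normc_dy; case/andP: (rad_bounds (trunc_log 2 j.+1)). Qed.

Lemma normc_dy_le j l : (j < lev l.+1)%N -> normc (dy j) <= rad l.
Proof.
move=> jl; rewrite normc_dy rad_le//.
have h : (j.+1 < 2 ^ l.+1)%N by rewrite -levE ltnS.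
have h1 := @trunc_logP 2 j.+1 isT isT.
by rewrite -ltnS -(@ltn_exp2l 2)// (leq_ltn_trans h1).
Qed.

Lemma dyE k i : (i < 2 ^ k)%N ->
  dy (lev k + i) = (rad k)%:C * unit_root R (2 ^ k) ^+ i.
Proof.
move=> ik; rewrite /dy /dyadic_points -addSn levE.
have -> : trunc_log 2 (2 ^ k + i) = k.
  by apply: trunc_log_eq => //; rewrite leq_addr/= expnS mul2n -addnn ltn_add2l.
rewrite /rad natrX; congr (_ * _); rewrite unit_rootX.
have k0 : (2 ^+ k : R) != 0 by rewrite expf_neq0.
rewrite (_ : 2 * pi * (2 ^ k + i)%:R * 2 ^- k = 2 * pi + 2 * pi * i%:R / (2 ^ k)%:R).
  by rewrite cisD cis2pi mul1r.
by rewrite natrD natrX; field.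
Qed.

Lemma prod_unit_roots N u v : (0 < N)%N ->
  \prod_(0 <= j < N) (u - v * unit_root R N ^+ j) = u ^+ N - v ^+ N.
Proof.
move=> N0; apply: prod_primitive_root.
rewrite /primitive_root_of_unity N0/=; apply/forallP => i.
rewrite unity_rootE; have [->|ne] := eqVneq i.+1 N.
  by rewrite unit_root_exp// eqxx.
by rewrite (negbTE (unit_root_prim _ _))//= ltn_neqAle ne ltn_ord.
Qed.

(** The Blaschke product of a whole level is, up to a unimodular constant, a
    single Blaschke factor in z ^ N. *)
Lemma level_product k z :
  normc (bprod dy (lev k) (lev k.+1) z) =
  normc (bfactor (rad k ^+ (2 ^ k))%:C (z ^+ (2 ^ k))).
Proof.
set N := (2 ^ k)%N; have N0 : (0 < N)%N by rewrite expn_gt0.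
rewrite /bprod normc_prod -{1}[lev k]add0n big_addn levS addKn -/N.
rewrite (eq_big_nat _ _ (F2 := fun j =>
    normc (z - (rad k)%:C * unit_root R N ^+ j) /
    normc (1 - ((rad k)%:C * z^*) * unit_root R N ^+ j))); last first.
  move=> j /andP[_ jN]; rewrite addnC dyE// /bfactor normcM normc_unimodular mul1r.
  rewrite normcM normcV; congr (_ / _); rewrite -normcJ !conjE; congr normc; ring.
rewrite prodf_div -!normc_prod !prod_unit_roots// expr1n.
rewrite /bfactor normcM normc_unimodular mul1r normcM normcV -rmorphXn/=.
congr (_ / _); rewrite -normcJ !conjE exprMn rmorphXn/=; congr normc.
by rewrite conjM !rmorphXn/= conj_real conjCK.
Qed.

Lemma bernoulli_le (x : R) n : 0 <= x <= 1 -> 1 - n%:R * x <= (1 - x) ^+ n.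
Proof.
move=> /andP[x0 x1]; elim: n => [|n IH]; first by rewrite expr0 mul0r subr0.
apply: (@le_trans _ _ ((1 - x) * (1 - n%:R * x))).
  by rewrite -natr1; have := ler0n R n; nra.
by rewrite exprS ler_wpM2l// subr_ge0.
Qed.

Lemma rad_pow_le k i : (k <= i)%N -> rad k ^+ (2 ^ i) <= 1 / 2.
Proof.
move=> ki; have /andP[r0 r1] := rad_bounds k.
apply: (@le_trans _ _ (rad k ^+ (2 ^ k))).
  by apply: ler_wiXn2l => //; [exact: ltW|rewrite leq_pexp2l].
have h : 0 < (2 ^ k)%:R :> R by rewrite ltr0n expn_gt0.
have x01 : 0 <= ((2 ^ k)%:R^-1 : R) <= 1.
  by rewrite invr_ge0 (ltW h)/= invf_le1// ler1n expn_gt0.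
have := bernoulli_inv (2 ^ k) x01; rewrite mulfV ?gt_eqF// -/(rad k).
lra.
Qed.

Lemma rad_pow_ge k i : (i < k)%N -> 1 - (2 ^ i)%:R / (2 ^ k)%:R <= rad k ^+ (2 ^ i) /\
  1 / 2 <= rad k ^+ (2 ^ i).
Proof.
move=> ik; have h : 0 < (2 ^ k)%:R :> R by rewrite ltr0n expn_gt0.
have x01 : 0 <= ((2 ^ k)%:R^-1 : R) <= 1.
  by rewrite invr_ge0 (ltW h)/= invf_le1// ler1n expn_gt0.
have hb := bernoulli_le (2 ^ i) x01; split => //.
apply: le_trans hb; rewrite lerBrDr -lerBrDl.
rewrite ler_pdivrMr//.
have : (2 ^ i * 2)%:R <= (2 ^ k)%:R :> R by rewrite ler_nat -expnSr leq_pexp2l.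
by rewrite natrM; lra.
Qed.

(** Both moduli raised to the power 2 ^ i are at most 1 / 2, so the single factor of
    [level_product] is bounded by a number below 1. *)
Lemma level_upper k i z : (k <= i)%N -> normc z = rad k ->
  normc (bprod dy (lev i) (lev i.+1) z) <= 4 / 5.
Proof.
move=> ki zr; rewrite level_product; have /andP[r0 r1] := rad_bounds i.
have /andP[k0 k1] := rad_bounds k.
have p2 : 0 <= rad i ^+ (2 ^ i) <= 1 / 2 by rewrite exprn_ge0 ?rad_pow_le.
have s2 : 0 <= normc (z ^+ (2 ^ i)) <= 1 / 2.
  by rewrite normc_ge0 normcX zr rad_pow_le.
move: p2 s2; set p := rad i ^+ _; set w := z ^+ _ => /andP[p0 p1] /andP[s0 s1].
have np : normc (p%:C : R[i]) = p by rewrite normc_real ger0_norm.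
have d0 : 1 - (p%:C)^* * w != 0 by rewrite disc_den_neq0 ?np//; lra.
have := bfactor_sqr d0; rewrite np.
have dle : normc (1 - (p%:C)^* * w) <= 5 / 4.
  have := normcB 1 ((p%:C)^* * w); rewrite normc1 normcM normcJ np; nra.
have dpos : 0 < normc (1 - (p%:C)^* * w) by rewrite normc_gt0.
have := normc_ge0 (bfactor p%:C w); move: (normc (bfactor _ _)) => b b0 E.
have : 9 / 25 <= 1 - b ^+ 2.
  rewrite E ler_pdivlMr ?exprn_gt0//.
  have hD : normc (1 - (p%:C)^* * w) ^+ 2 <= 25 / 16.
    by move: dle dpos; move: (normc (1 - _)) => D; nra.
  move: hD s0 s1; move: (normc w) => q hD s0 s1.
  have p4 : p ^+ 2 <= 1 / 4 by nra.
  have q4 : q ^+ 2 <= 1 / 4 by nra.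
  have : 9 / 16 <= (1 - p ^+ 2) * (1 - q ^+ 2) by nra.
  move: hD; move: (_ ^+ 2) => D hD; lra.
nra.
Qed.

Lemma bprod_levels m k z : (m <= k)%N ->
  normc (bprod dy (lev m) (lev k) z) =
  \prod_(m <= i < k) normc (bprod dy (lev i) (lev i.+1) z).
Proof.
elim: k => [|k IH]; first by rewrite leqn0 => /eqP->; rewrite /bprod !big_geq// normc1.
rewrite leq_eqVlt => /orP[/eqP->|]; first by rewrite /bprod !big_geq// normc1.
rewrite ltnS => mk; rewrite big_nat_recr//= -IH// -normcM -bprod_cat//.
by rewrite !lev_le// leqnSn.
Qed.

(** Each complete level between k and l contributes a factor 4 / 5. *)
Lemma blaschke_upper k l z : (k <= l)%N -> normc z = rad k ->
  normc (bprod dy 0 (lev l) z) <= (4 / 5) ^+ (l - k).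
Proof.
move=> kl zr; rewrite (@bprod_cat _ dy 0 (lev k))//; last by rewrite lev_le.
rewrite normcM -[leRHS]mul1r ler_pM ?normc_ge0//.
  apply: bprod_le1; first exact: indisc_dy.
  by rewrite zr ltW//; case/andP: (rad_bounds k).
rewrite bprod_levels// -prodr_const_nat big_nat [leRHS]big_nat.
apply: ler_prod => i /andP[ki il]; rewrite normc_ge0/=; exact: level_upper ki zr.
Qed.

(** With s = |z| ^ N and p = (rad i) ^ N the defect of the modulus is of order
    1 - s, hence of order 2 ^ i / 2 ^ k, while z ^ N stays at a definite distance
    from the zero p since p <= s ^ 2 and s >= 1 / 2. *)
Lemma level_lower k i z : (i < k)%N -> normc z = rad k ->
  0 < normc (bprod dy (lev i) (lev i.+1) z) /\
  (normc (bprod dy (lev i) (lev i.+1) z)) ^- 2 <= 1 + 58 * ((2 ^ i)%:R / (2 ^ k)%:R).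
Proof.
move=> ik zr; rewrite level_product; have /andP[r0 r1] := rad_bounds i.
have /andP[k0 k1] := rad_bounds k.
have [s1 s2] := rad_pow_ge ik.
have p1 : rad i ^+ (2 ^ i) <= 1 / 2 by exact: rad_pow_le.
have p0 : 0 <= rad i ^+ (2 ^ i) by exact: exprn_ge0.
have ps : rad i ^+ (2 ^ i) <= (rad k ^+ (2 ^ i)) ^+ 2.
  have -> : (rad k ^+ (2 ^ i)) ^+ 2 = (rad k ^+ 2) ^+ (2 ^ i) by rewrite -!exprM mulnC.
  rewrite lerXn2r ?nnegrE ?sqr_ge0//.
  apply: (@le_trans _ _ (rad i.+1 ^+ 2)); last first.
    by rewrite ler_sqr ?nnegrE// ?rad_le//; case/andP: (rad_bounds i.+1).
  rewrite /rad expnS natrM invfM; set e := (2 ^ i)%:R^-1.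
  have := sqr_ge0 (2^-1 * e); lra.
have s1' : rad k ^+ (2 ^ i) <= 1 by apply: exprn_ile1 => //; exact: ltW.
have sE : normc (z ^+ (2 ^ i)) = rad k ^+ (2 ^ i) by rewrite normcX zr.
move: p0 p1 ps s1 s2 s1' sE; set p := rad i ^+ _; set s := rad k ^+ _; set w := z ^+ _.
set e := (2 ^ i)%:R / _ => p0 p1 ps s1 s2 s1' sE.
have np : normc (p%:C : R[i]) = p by rewrite normc_real ger0_norm.
have gap : 3 / 16 <= s - p by nra.
have wp : 3 / 16 <= normc (w - p%:C).
  by have := lerB_normc w p%:C; rewrite np sE; lra.
have d0 : 1 - (p%:C)^* * w != 0 by rewrite disc_den_neq0 ?np ?sE//; lra.
have dpos : 0 < normc (1 - (p%:C)^* * w) by rewrite normc_gt0.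
have bE : normc (bfactor p%:C w) = normc (w - p%:C) / normc (1 - (p%:C)^* * w).
  by rewrite /bfactor normcM normc_unimodular mul1r normcM normcV.
have b0 : 0 < normc (bfactor p%:C w) by rewrite bE divr_gt0//; lra.
split => //; have := bfactor_sqr d0; rewrite np sE => E.
have E2 : normc (bfactor p%:C w) ^- 2 - 1 = (1 - p ^+ 2) * (1 - s ^+ 2) / normc (w - p%:C) ^+ 2.
  have -> : normc (bfactor p%:C w) ^- 2 - 1 =
    (1 - normc (bfactor p%:C w) ^+ 2) / normc (bfactor p%:C w) ^+ 2.
    by field; rewrite gt_eqF.
  by rewrite E bE; field; rewrite !gt_eqF//; lra.
rewrite addrC -lerBlDr E2 ler_pdivrMr ?exprn_gt0//; last by lra.
have h1 : (1 - p ^+ 2) * (1 - s ^+ 2) <= 2 * (1 - s).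
  have : 0 <= 1 - s by lra.
  have : 0 <= 1 + s by lra.
  move: (sqr_ge0 p); move: (p ^+ 2) => P P0 hs hs'.
  have := mulr_ge0 P0 (mulr_ge0 hs hs'); have := sqr_ge0 (1 - s); nra.
have h2 : 9 / 256 <= normc (w - p%:C) ^+ 2.
  by have := wp; move: (normc (w - _)) => q hq; nra.
apply: (le_trans h1).
have e0 : 0 <= e by rewrite divr_ge0 ?ler0n.
apply: (@le_trans _ _ (58 * e * (9 / 256))); last by rewrite ler_wpM2l// mulr_ge0.
lra.
Qed.

(** The defects of the levels up to l form a geometric series dominated by the last
    one. *)
Lemma blaschke_lower k l z : (l < k)%N -> normc z = rad k ->
  0 < normc (bprod dy 0 (lev l.+1) z) /\
  (normc (bprod dy 0 (lev l.+1) z)) ^- 2 <=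
    1 + 116 * expR 116 * ((2 ^ l)%:R / (2 ^ k)%:R).
Proof.
move=> lk zr; have -> : bprod dy 0 (lev l.+1) z = bprod dy (lev 0) (lev l.+1) z by [].
have K0 : 0 < (2 ^ k)%:R :> R by rewrite ltr0n expn_gt0.
have step n : (n <= k)%N -> 0 < normc (bprod dy (lev 0) (lev n) z) /\
    (normc (bprod dy (lev 0) (lev n) z)) ^- 2 <=
    expR (58 * ((2 ^ n)%:R / (2 ^ k)%:R)).
  elim: n => [_|n IH nk].
    rewrite /bprod big_geq// normc1 ltr01 expr1n invr1; split => //.
    by rewrite -expR0 ler_expR mulr_ge0 ?divr_ge0.
  have [P0 P1] := IH (ltnW nk); have [Q0 Q1] := level_lower nk zr.
  have -> : bprod dy (lev 0) (lev n.+1) z =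
    bprod dy (lev 0) (lev n) z * bprod dy (lev n) (lev n.+1) z.
    by rewrite -bprod_cat// lev_le//= lev_le.
  rewrite normcM mulr_gt0//; split => //.
  have -> : 58 * ((2 ^ n.+1)%:R / (2 ^ k)%:R) =
      58 * ((2 ^ n)%:R / (2 ^ k)%:R) + 58 * ((2 ^ n)%:R / (2 ^ k)%:R) :> R.
    by rewrite expnS natrM; ring.
  rewrite exprMn invfM expRD.
  rewrite ler_pM ?invr_ge0 ?sqr_ge0//.
  exact: le_trans Q1 (expR_ge1Dx _).
have [P0 P1] := step l.+1 lk; split => //; apply: (le_trans P1).
rewrite expnS natrM -[2 * _ / _]mulrA mulrA.
set e := (2 ^ l)%:R / _; have -> : 58 * 2 = 116 :> R by ring.
have e0 : 0 <= e by rewrite divr_ge0.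
have e1 : e <= 1.
  by rewrite ler_pdivrMr// mul1r ler_nat leq_pexp2l// ltnW.
have h := expR_ge1Dx (- (116 * e)); rewrite expRN in h.
have X0 := expR_gt0 (116 * e : R).
have h2 : expR (116 * e) * (1 - 116 * e) <= 1.
  by rewrite mulrC -ler_pdivlMr// div1r.
have h3 : expR (116 * e) <= expR 116 by rewrite ler_expR; lra.
have h4 : (116 * e) * expR (116 * e) <= (116 * e) * expR 116.
  by rewrite ler_wpM2l//; lra.
have -> : 116 * expR 116 * e = (116 * e) * expR 116 by ring.
by rewrite mulrBr mulr1 in h2; lra.
Qed.

End DyadicPoints.

(** * Maximal functions of dilations *)

Section RadialMaximal.
Variable R : realType.

Lemma ccont_dilation rho x f : 0 <= x <= rho -> discalg rho f ->
  ccont (fun t => f (x%:C * cis t : R[i])).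
Proof.
move=> /andP[x0 xr] df; apply: (ccont_discalg df).
  by apply: ccontM; [exact: ccont_cst|exact: ccont_cis].
by move=> t; rewrite normcM normc_cis mulr1 normc_real ger0_norm.
Qed.

Definition radial_const : R := 10 ^+ 4 * (2 * 33 ^+ 2) ^+ 2.

(** Each value inside the disc is dominated by a Poisson average; on the scale of N
    arcs this average becomes a discrete one, whatever radius is chosen on each
    arc. *)
Lemma radial_maximal s N f (I : eqType) (r : seq I) (radius : I -> R) i0 :
  (0 < N)%N -> cis s = 1 :> R[i] -> discalg 1 f -> i0 \in r ->
  (forall i, i \in r -> dradius N (radius i)) ->
  mean s (fun t => (\big[Num.max/0]_(i <- r) normc (f ((radius i)%:C * cis t))) ^+ 2) <=
  radial_const * mean s (fun t => normc (f (cis t)) ^+ 2).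
Proof.
move=> N0 s1 df i0r dr; pose phi t := normc (f (cis t)).
have NR : 0 < (N%:R : R) by rewrite ltr0n.
have cphi : continuous phi by apply: cont_normc; exact: ccont_circle df.
have phi0 u : 0 <= phi u by exact: normc_ge0.
pose A l := avg (arc_end s N l) (arc_end s N l.+1) phi.
have A0 l : 0 <= A l by apply: avg_ge0 => //; exact: arc_end_lt.
set b : R := 2 * 33 ^+ 2; have b0 : 0 <= b by rewrite mulr_ge0// sqr_ge0.
pose g l := b * A l; have g0 l : 0 <= g l by rewrite mulr_ge0.
pose S i k := \sum_(l < N) dpoisson N (radius k) i l * g l.
pose Z i := \big[Num.max/0]_(k <- r) S i k.
have Z0 i : 0 <= Z i by exact: bigmax_seq_ge0.
have maxZ : \sum_(i < N) Z i ^+ 2 <= 10 ^+ 4 * \sum_(l < N) g l ^+ 2.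
  apply: discrete_maximal_pointwise => // i iN.
  have S0 k : k \in r -> 0 <= S i k.
    by move=> kr; apply: sumr_ge0 => l _; rewrite mulr_ge0// dpoisson_ge0// dr.
  have [k kr E] := bigmax_seq_attained S0 i0r.
  by exists (radius k); [exact: dr|rewrite /Z E].
have pw i t k : k \in r -> arc_end s N i <= t <= arc_end s N i.+1 ->
    normc (f ((radius k)%:C * cis t)) <= S i k.
  move=> kr ti; have [r0 r1] := dradius01 N0 (dr _ kr).
  apply: (le_trans (normc_poisson_le s df _)).
    by rewrite normcM normc_cis mulr1 normc_real ger0_norm.
  have := mean_poisson_arcs s1 N0 (dr _ kr) ti cphi phi0.
  rewrite -(ler_pM2l (ltr0Sn R 1)) => /le_trans; apply.
  rewrite mulrA -/b mulr_sumr; apply: ler_sum => l _.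
  by rewrite mulrCA.
have cr k : k \in r -> ccont (fun t => f ((radius k)%:C * cis t)).
  move=> kr; have [r0 r1] := dradius01 N0 (dr _ kr).
  by apply: (ccont_dilation _ df); rewrite r0 ltW.
pose F k t := if k \in r then normc (f ((radius k)%:C * cis t)) else 0.
have cF k : continuous (F k).
  rewrite /F; case kr : (k \in r); last exact: cont_cst.
  by apply: cont_normc; exact: cr.
have -> : (fun t => (\big[Num.max/0]_(i <- r) normc (f ((radius i)%:C * cis t))) ^+ 2) =
    (fun t => (\big[Num.max/0]_(i <- r) F i t) ^+ 2).
  apply/funext => t; congr (_ ^+ 2); rewrite big_seq [RHS]big_seq.
  by apply: eq_bigr => k kr; rewrite /F kr.
have cMax := @cont_bigmax R _ r _ cF.
rewrite (mean_arcs s N0); last exact: contX.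
rewrite ler_pdivrMl// big_mkord.
apply: (@le_trans _ _ (\sum_(i < N) Z i ^+ 2)).
  apply: ler_sum => i _; apply: avg_le_cst; [exact: arc_end_lt|exact: contX|move=> t ti].
  rewrite ler_sqr ?nnegrE ?bigmax_seq_ge0//.
  apply: bigmax_seq_le => // k kr; rewrite /F kr (le_trans (pw _ _ _ kr ti))//.
  exact: (@bigmax_seq_ge _ _ _ (S i)).
apply: (le_trans maxZ); have cphi2 : continuous (fun t => phi t ^+ 2) by exact: contX.
have sumA : \sum_(l < N) A l ^+ 2 <= N%:R * mean s (fun t => phi t ^+ 2).
  rewrite (mean_arcs s N0 cphi2) mulrA mulfV ?gt_eqF// mul1r big_mkord.
  by apply: ler_sum => l _; apply: avg_sqr => //; exact: arc_end_lt.
have -> : N%:R * (radial_const * mean s (fun t => normc (f (cis t)) ^+ 2)) =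
    10 ^+ 4 * (b ^+ 2 * (N%:R * mean s (fun t => phi t ^+ 2))).
  by rewrite /radial_const -/b; move: (mean _ _) => m; ring.
rewrite ler_wpM2l ?exprn_ge0// /g; under eq_bigr do rewrite exprMn.
by rewrite -mulr_sumr ler_wpM2l// sqr_ge0.
Qed.

End RadialMaximal.

(** * Sums with geometric decay *)

Section Sums.
Variable R : realType.

Lemma sum_levels (V : nmodType) (h : nat -> V) n :
  \sum_(0 <= j < lev n) h j = \sum_(0 <= l < n) \sum_(lev l <= j < lev l.+1) h j.
Proof.
elim: n => [|n IH]; first by rewrite !big_geq.
by rewrite big_nat_recr//= -IH (@big_cat_nat _ _ _ (lev n))//= lev_le.
Qed.

Lemma weighted_cauchy_schwarz (I : Type) (r : seq I) (a w : I -> R) :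
  (forall i, 0 < w i) ->
  (\sum_(i <- r) a i) ^+ 2 <= (\sum_(i <- r) w i) * \sum_(i <- r) a i ^+ 2 / w i.
Proof.
move=> w0; case: r => [|i0 r]; first by rewrite !big_nil expr0n mul0r.
set W := \sum_(i <- _) w i; set A := \sum_(i <- _) a i; set Q := \sum_(i <- _) _.
have W0 : 0 < W.
  by rewrite /W big_cons ltr_pwDl// sumr_ge0// => i _; rewrite ltW.
have : 0 <= \sum_(i <- i0 :: r) (a i * W - A * w i) ^+ 2 / w i.
  by apply: sumr_ge0 => i _; rewrite divr_ge0 ?sqr_ge0// ltW.
have -> : \sum_(i <- i0 :: r) (a i * W - A * w i) ^+ 2 / w i =
    \sum_(i <- i0 :: r) (W ^+ 2 * (a i ^+ 2 / w i) + (- (2 * W * A)) * a i + A ^+ 2 * w i).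
  by apply: eq_bigr => i _; field; rewrite gt_eqF.
rewrite !big_split/= -!mulr_sumr -/W -/A -/Q.
have -> : W ^+ 2 * Q + - (2 * W * A) * A + A ^+ 2 * W = W * (W * Q - A ^+ 2) by ring.
by rewrite pmulr_rge0// subr_ge0.
Qed.

Definition dist k l := ((k - l) + (l - k))%N.

Definition decay : R := 4 / 5.

(** The two-sided geometric series: 4 on one side, 5 on the other. *)
Lemma sum_decay k L : \sum_(0 <= l < L) decay ^+ dist k l <= 9.
Proof.
have q0 n : 0 <= decay ^+ n by apply: exprn_ge0; rewrite /decay; lra.
have left n : (n <= k)%N -> \sum_(0 <= l < n) decay ^+ dist k l <= 5 * decay ^+ (k - n).+1.
  elim: n => [_|n IH nk]; first by rewrite big_geq// mulr_ge0.
  rewrite big_nat_recr//=; have := IH (ltnW nk).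
  have -> : dist k n = (k - n)%N by rewrite /dist; lia.
  have -> : (k - n)%N = (k - n.+1).+1 by lia.
  rewrite [decay ^+ (_.+2)]exprS; move: (decay ^+ _) (q0 (k - n.+1)%N) => y y0.
  by rewrite /decay; lra.
have right n : \sum_(0 <= l < k + n) decay ^+ dist k l <= 9 - 5 * decay ^+ n.
  elim: n => [|n IH].
    rewrite addn0; have := left k (leqnn k); rewrite subnn expr1 expr0 /decay; lra.
  rewrite addnS big_nat_recr//=; have -> : dist k (k + n) = n by rewrite /dist; lia.
  move: IH; rewrite exprS; move: (decay ^+ n) => y; rewrite /decay; lra.
have [Lk|kL] := leqP L k.
  apply: (le_trans (left _ Lk)); have : decay ^+ (k - L).+1 <= 1.
    by apply: exprn_ile1; rewrite /decay; lra.
  lra.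
rewrite -(subnKC (ltnW kL)); apply: (le_trans (right _)).
by rewrite gerDl oppr_le0 mulr_ge0.
Qed.

End Sums.

(** * Partial sums at the ends of levels *)

Section Lacunary.
Variable R : realType.
Variables (c : nat -> R[i]) (s : R).
Hypothesis s1 : cis s = 1 :> R[i].
Local Notation dy := (dy R).
Local Notation rad := (rad R).
Let level l z := psum dy c (lev l) (lev l.+1) z.
Let gam l := \sum_(lev l <= j < lev l.+1) normc (c j) ^+ 2.
Definition reflection_const : R := 116 * expR 116.

Let rad01 k : 0 <= rad k <= 1.
Proof. by have /andP[-> /ltW] := rad_bounds R k. Qed.

Let discalg_level l : discalg 1 (level l).
Proof. by apply: discalg_psum => // j _; apply: indisc1; exact: indisc_dy. Qed.

Let ccont_dil k f : discalg 1 f -> ccont (fun t => f ((rad k)%:C * cis t)).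
Proof. exact: ccont_dilation (rad01 k). Qed.

Let gam_ge0 l : 0 <= gam l.
Proof. by apply: sumr_ge0 => j _; exact: sqr_ge0. Qed.

(** On the circle of radius [rad k] the levels beyond k carry a small Blaschke
    product. *)
Let outer_level k l : (k <= l)%N ->
  mean s (fun t => normc (level l ((rad k)%:C * cis t)) ^+ 2) <=
  (16 / 25) ^+ (l - k) * gam l.
Proof.
move=> kl; pose be j := dy (lev l + j)%N; pose d j := c (lev l + j)%N.
have ib : indisc be by move=> j; exact: indisc_dy.
pose f z := psum be d 0 (2 ^ l)%N z.
have df : discalg 1 f by apply: discalg_psum => // j _; exact: indisc1.
have E z : level l z = bprod dy 0 (lev l) z * f z by rewrite /level levS psum_shift.
have -> : gam l = mean s (fun t => normc (f (cis t)) ^+ 2).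
  rewrite mean_sqr_psum// /gam levS -{1}[lev l]add0n big_addn addKn.
  by apply: eq_bigr => j _; rewrite addnC.
set q := (16 / 25) ^+ _; have q0 : 0 <= q by rewrite exprn_ge0// divr_ge0.
apply: (@le_trans _ _ (q * mean s (fun t => normc (f ((rad k)%:C * cis t)) ^+ 2))); last first.
  by rewrite ler_wpM2l//; exact: (discalg_contraction s (rad01 k) df).
have cf := cont_normc2 (ccont_dil k df).
rewrite /mean -avgZ//; apply: cont_mean_le; first by apply: cont_normc2; exact: ccont_dil.
  by apply: contM => //; exact: cont_cst.
move=> t; rewrite E normcM exprMn ler_wpM2r ?sqr_ge0//.
have -> : q = ((4 / 5) ^+ (l - k)) ^+ 2.
  by rewrite /q -exprM mulnC exprM; congr (_ ^+ _); field.
rewrite ler_sqr ?nnegrE ?normc_ge0 ?exprn_ge0 ?divr_ge0//.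
apply: blaschke_upper => //; rewrite normcM normc_cis mulr1 normc_real ger0_norm//.
by case/andP: (rad01 k).
Qed.

(** For the levels below k: the reflection in the circle turns the dilation by
    the inverse of [rad k] into a contraction of the dual system divided by a
    Blaschke product close to unimodular. *)
Let inner_level k l : (l < k)%N ->
  mean s (fun t => normc (level l (cis t) - level l ((rad k)%:C * cis t)) ^+ 2) <=
  reflection_const * ((2 ^ l)%:R / (2 ^ k)%:R) * gam l.
Proof.
move=> lk; set r := rad k; have /andP[r0 r1] := rad01 k.
have rlk : rad l < r by exact: rad_lt.
have rp : 0 < r by apply: le_lt_trans rlk; case/andP: (rad_bounds R l).
set n := lev l.+1; have dn j : (j < n)%N -> normc (dy j) < r.
  by move=> jn; apply: le_lt_trans rlk; exact: normc_dy_le.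
have dl : discalg r^-1 (level l).
  apply: discalg_psum; first by rewrite invr_ge0 ltW.
  by move=> j jn; rewrite ltr_pdivrMr// mul1r; exact: dn.
have r01 : 0 < r <= 1 by rewrite rp.
have := @discalg_dilation_diff R s r (level l) r01 dl.
have mg : mean s (fun t => normc (level l (cis t)) ^+ 2) = gam l.
  by apply: mean_sqr_psum; exact: indisc_dy.
rewrite mg; pose G z := \sum_(j <- index_iota (lev l) n | (j < n)%N) (c j)^* * mt_dual dy j n z.
have GE x : (forall j, (j < n)%N -> x != dy j /\ 1 - (dy j)^* * x != 0) -> x != 0 ->
    (level l (x^*)^-1)^* * bprod dy 0 n x = G x.
  move=> hx x0; rewrite /level /psum conj_sum mulr_suml big_nat /G big_seq_cond/=.
  rewrite [RHS]big_seq_cond; apply: eq_big => j; first by rewrite mem_index_iota; lia.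
  by move=> /and3P[_ _ jn]; rewrite conjM -mulrA mt_reflect.
have dG : discalg 1 G.
  apply: discalg_sum => j jn; apply: discalgM; first exact: discalg_cst.
  by apply: discalg_dual => // i _; apply: indisc1; exact: indisc_dy.
have mG : mean s (fun t => normc (G (cis t)) ^+ 2) = gam l.
  rewrite -mg; apply: eq_mean => t; congr (_ ^+ 2).
  have x1 := normc_cis t; have x0 : cis t != 0 :> R[i] by rewrite -normc_gt0 x1.
  rewrite -GE//; first by rewrite (conj_unit x1) invrK normcM normcJ bprod_circle ?mulr1//; exact: indisc_dy.
  move=> j _; split; last by rewrite disc_den_neq0 ?x1//; exact: indisc_dy.
  by apply: contraTneq (indisc_dy R j) => E; rewrite -E x1 ltxx.
set X := reflection_const * _ => H.
have X0 : 0 <= X by rewrite /X /reflection_const !mulr_ge0 ?expR_ge0 ?invr_ge0.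
suff H2 : mean s (fun t => normc (level l ((r^-1)%:C * cis t)) ^+ 2) <= (1 + X) * gam l.
  by move: H H2; rewrite mulrDl mul1r; lra.
apply: (@le_trans _ _ ((1 + X) * mean s (fun t => normc (G (r%:C * cis t)) ^+ 2))); last first.
  by rewrite ler_wpM2l ?addr_ge0// -mG; exact: (discalg_contraction s (rad01 k) dG).
have cG := cont_normc2 (ccont_dil k dG).
rewrite /mean -avgZ//; apply: cont_mean_le.
- by apply: cont_normc2; apply: (ccont_dilation _ dl); rewrite invr_ge0 lexx ltW.
- by apply: contM => //; exact: cont_cst.
move=> t; have xr : normc (r%:C * cis t) = r.
  by rewrite normcM normc_cis mulr1 normc_real ger0_norm.
have [b0 bi] := blaschke_lower lk xr.
have x0 : r%:C * cis t != 0 by rewrite -normc_gt0 xr.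
have cisI : (cis t)^*^-1 = cis t :> R[i] by rewrite (conj_unit (normc_cis t)) invrK.
rewrite -GE//; last first.
  move=> j jn; split; last by rewrite disc_den_neq0 ?xr//; exact: indisc_dy.
  by apply: contraTneq (dn j jn) => E; rewrite -E xr ltxx.
rewrite conjM conj_real invfM cisI -fmorphV normcM normcJ.
set a := normc (level _ _); set b := normc (bprod _ _ _ _) in b0 bi *.
rewrite exprMn mulrCA -[leLHS]mulr1 ler_wpM2l ?sqr_ge0//.
by rewrite -ler_pdivrMr ?exprn_gt0// div1r.
Qed.

Definition lacunary_const : R := 2 * radial_const R + 162 * reflection_const.

(** The partial sums at the ends of the levels are close in square mean to the
    dilations of the whole sum, and the dilations are controlled by Poisson
    averages. *)
Theorem lacunary_maximal L :
  mean s (fun t => (\big[Num.max/0]_(0 <= k < L.+1) normc (psum dy c 0 (lev k) (cis t))) ^+ 2)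
  <= lacunary_const * \sum_(0 <= j < lev L) normc (c j) ^+ 2.
Proof.
pose F z := psum dy c 0 (lev L) z.
have dF : discalg 1 F by apply: discalg_psum => // j _; apply: indisc1; exact: indisc_dy.
set T := \sum_(0 <= j < lev L) _.
have TE : T = \sum_(0 <= l < L) gam l by exact: sum_levels.
(* The part of level l in the difference between the partial sum and the dilation. *)
pose u k l t := (if (l < k)%N then level l (cis t) else 0) - level l ((rad k)%:C * cis t).
have cu k l : ccont (u k l).
  apply: ccontB; last exact: ccont_dil.
  by case: (l < k)%N; [exact: (ccont_circle (lexx 1))|exact: ccont_cst].
have uE k t : (k <= L)%N -> psum dy c 0 (lev k) (cis t) =
    F ((rad k)%:C * cis t) + \sum_(0 <= l < L) u k l t.
  move=> kL; rewrite /u sumrB /F {2}/psum sum_levels addrC subrK.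
  rewrite /psum sum_levels (@big_cat_nat _ _ _ k 0 L)//= [X in _ = _ + X]big_nat.
  rewrite [X in _ = _ + X]big1 ?addr0; last by move=> l /andP[kl _]; rewrite ltnNge kl.
  by apply: eq_big_nat => l /andP[_ ->].
have um k l : mean s (fun t => normc (u k l t) ^+ 2 / decay R ^+ dist k l) <=
    reflection_const * gam l * decay R ^+ dist k l.
  set q := decay R ^+ _; have q0 : 0 < q by rewrite exprn_gt0// /decay; lra.
  have rc1 : 1 <= reflection_const.
    by rewrite /reflection_const; have := expR_ge1Dx (116 : R); nra.
  under [X in mean _ X]eq_fun do rewrite mulrC.
  rewrite /mean avgZ; last exact: cont_normc2.
  rewrite ler_pdivrMl// -/(mean s _) /u; have [lk|kl] := ltnP l k.
    apply: (le_trans (inner_level lk)).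
    have -> : q * (reflection_const * gam l * q) = reflection_const * q ^+ 2 * gam l by ring.
    rewrite ler_wpM2r// ler_wpM2l//; first by lra.
    rewrite /q /dist (_ : (l - k)%N = 0%N); last by lia.
    have kE : (2 ^ k)%:R = (2 ^ (k - l))%:R * (2 ^ l)%:R :> R.
      by rewrite -natrM -expnD subnK// ltnW.
    have -> : (2 ^ l)%:R / (2 ^ k)%:R = (2 ^ (k - l))%:R^-1 :> R.
      by rewrite kE invfM mulrCA mulfV ?mulr1// pnatr_eq0 expn_eq0.
    rewrite addn0 -exprM mulnC exprM natrX -exprVn lerXn2r ?nnegrE ?invr_ge0 ?sqr_ge0//.
    by rewrite /decay; lra.
  under [X in mean _ X]eq_fun do rewrite sub0r normcN.
  apply: (le_trans (outer_level kl)).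
  have -> : q * (reflection_const * gam l * q) = reflection_const * q ^+ 2 * gam l by ring.
  rewrite ler_wpM2r//; have -> : (16 / 25) ^+ (l - k) = q ^+ 2.
    rewrite /q /dist (_ : (k - l)%N = 0%N); last by lia.
    by rewrite add0n -exprM mulnC exprM; congr (_ ^+ _); rewrite /decay; field.
  by rewrite -[leLHS]mul1r ler_wpM2r// sqr_ge0.
pose M t := \big[Num.max/0]_(0 <= k < L.+1) normc (F ((rad k)%:C * cis t)).
pose Q k t := \sum_(0 <= l < L) normc (u k l t) ^+ 2 / decay R ^+ dist k l.
have cul k l : continuous (fun t => normc (u k l t) ^+ 2 / decay R ^+ dist k l).
  by apply: contM; [exact: cont_normc2|exact: cont_cst].
have cQ k : continuous (Q k) by exact: cont_sum.
have cM : continuous (fun t => M t ^+ 2).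
  by apply: contX; apply: cont_bigmax => k; apply: cont_normc; exact: ccont_dil.
have Q0 k t : 0 <= Q k t.
  apply: sumr_ge0 => l _; rewrite divr_ge0 ?sqr_ge0// exprn_ge0// /decay; lra.
have Dle k t : (\sum_(0 <= l < L) normc (u k l t)) ^+ 2 <= 9 * Q k t.
  have w0 l : 0 < decay R ^+ dist k l by rewrite exprn_gt0// /decay; lra.
  apply: (le_trans (weighted_cauchy_schwarz _ _ w0)).
  by rewrite ler_wpM2r ?sum_decay//; exact: Q0.
apply: (@le_trans _ _ (mean s (fun t => 2 * M t ^+ 2 + 18 * \sum_(0 <= k < L.+1) Q k t))).
  apply: cont_mean_le.
  - apply: contX; apply: cont_bigmax => k; apply: cont_normc.
    by apply: ccont_psum; exact: indisc_dy.
  - apply: contD; apply: contM; try exact: cont_cst; first exact: cM.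
    exact: cont_sum.
  move=> t; set W := \big[_/_]_(_ <- _) _.
  have F0 k : k \in index_iota 0 L.+1 -> 0 <= normc (psum dy c 0 (lev k) (cis t)).
    by move=> _; exact: normc_ge0.
  have i0 : 0%N \in index_iota 0 L.+1 by rewrite mem_index_iota.
  have [k kin E] := bigmax_seq_attained F0 i0; rewrite {}/W {}E.
  have kL : (k <= L)%N by move: kin; rewrite mem_index_iota ltnS.
  have Mk : normc (F ((rad k)%:C * cis t)) <= M t.
    exact: (@bigmax_seq_ge _ _ _ (fun k => normc (F ((rad k)%:C * cis t)))).
  have Qk : Q k t <= \sum_(0 <= k < L.+1) Q k t.
    rewrite (big_rem k)//= lerDl; apply: sumr_ge0 => i _; exact: Q0.
  rewrite (uE _ t kL).
  have h1 := normcD (F ((rad k)%:C * cis t)) (\sum_(0 <= l < L) u k l t).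
  have h2 := normc_sum (index_iota 0 L) xpredT (fun l => u k l t).
  have h3 := Dle k t; move: h1 h2 h3.
  set a := normc (_ + _); set b := normc (F _) in Mk *; set e := normc (\sum_(_ <= _ < _) _).
  set D := \sum_(_ <= _ < _) normc _; move=> h1 h2 h3.
  have a0 : 0 <= a by exact: normc_ge0.
  have b0 : 0 <= b by exact: normc_ge0.
  have e0 : 0 <= e by exact: normc_ge0.
  have h4 : a <= M t + D by lra.
  have h5 : a ^+ 2 <= (M t + D) ^+ 2 by rewrite ler_sqr ?nnegrE//; lra.
  have := sqr_ge0 (M t - D); lra.
have cQs : continuous (fun t => \sum_(0 <= k < L.+1) Q k t) by exact: cont_sum.
have c2M : continuous (fun t => 2 * M t ^+ 2) by apply: contM => //; exact: cont_cst.
have c18Q : continuous (fun t => 18 * \sum_(0 <= k < L.+1) Q k t).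
  by apply: contM => //; exact: cont_cst.
rewrite /mean avgD// !avgZ// avg_sum// -!/(mean s _) /lacunary_const [leRHS]mulrDl; apply: lerD.
  rewrite -[leRHS]mulrA ler_wpM2l//.
  have := @radial_maximal R s (2 ^ L) F _ (index_iota 0 L.+1) rad 0%N.
  rewrite expn_gt0 mem_index_iota => /(_ isT s1 dF isT) H.
  apply: le_trans (H _) _; last by rewrite /F mean_sqr_psum//; exact: indisc_dy.
  move=> k; rewrite mem_index_iota ltnS => /andP[_ kL].
  have /andP[k0 _] := rad01 k; rewrite /dradius k0/= lerD2l lerN2.
  rewrite lef_pV2 ?posrE ?mulr_gt0 ?ltr0n ?expn_gt0//.
  by rewrite -natrM ler_nat (leq_trans (leq_pexp2l _ kL))// leq_pmull.
apply: (@le_trans _ _ (18 * \sum_(0 <= k < L.+1) \sum_(0 <= l < L)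
    reflection_const * gam l * decay R ^+ dist k l)).
  rewrite ler_wpM2l//; apply: ler_sum => k _.
  by rewrite /mean avg_sum//; apply: ler_sum => l _; exact: um.
have rc0 : 0 <= reflection_const by rewrite mulr_ge0 ?expR_ge0.
have -> : 162 * reflection_const * T = 18 * (9 * (reflection_const * T)) by ring.
rewrite ler_wpM2l// exchange_big/= TE !mulr_sumr; apply: ler_sum => l _.
rewrite -mulr_sumr mulrC ler_wpM2r ?mulr_ge0//.
have -> : \sum_(0 <= i < L.+1) decay R ^+ dist i l = \sum_(0 <= i < L.+1) decay R ^+ dist l i.
  by apply: eq_bigr => i _; rewrite /dist addnC.
exact: sum_decay.
Qed.

End Lacunary.

(** * All partial sums of a finite expansion *)

Section Assembly.
Variable R : realType.
Implicit Types (c : nat -> R[i]) (s t : R).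
Local Notation dy := (dy R).

(** The level k = i + 1 consists of two runs of 2 ^ i consecutive points, each of
    which covers half of the circle of radius [rad R i.+1]. *)
Definition half_start i (b : bool) := (lev i.+1 + b * 2 ^ i)%N.

Definition half_max c i b t : R := \big[Num.max/0]_(0 <= m < (2 ^ i).+1)
  normc (psum (fun j => dy (half_start i b + j)) (fun j => c (half_start i b + j)%N)
    0 m (cis t)).

Lemma half_max_ge0 c i b t : 0 <= half_max c i b t.
Proof. exact: bigmax_seq_ge0. Qed.

Lemma cont_half_max c i b : continuous (half_max c i b).
Proof.
apply: cont_bigmax => m; apply: cont_normc; apply: ccont_psum => j.
exact: indisc_dy.
Qed.

Lemma normc_psum_shift c al m n x : indisc al -> normc x = 1 ->
  normc (psum al c m (m + n) x) =
  normc (psum (fun j => al (m + j)%N) (fun j => c (m + j)%N) 0 n x).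
Proof. by move=> ia x1; rewrite psum_shift normcM bprod_circle// mul1r. Qed.

Lemma mean_half_max c s i b : cis s = 1 :> R[i] ->
  mean s (fun t => half_max c i b t ^+ 2) <= half_level_const R *
    \sum_(0 <= j < 2 ^ i) normc (c (half_start i b + j)%N) ^+ 2.
Proof.
move=> s1; apply: (@half_level_maximal R (2 ^ i) (b * 2 ^ i) (2 ^ i.+1)) => //.
- by rewrite expn_gt0.
- by rewrite expnS.
- by case: b; rewrite ?mul1n ?mul0n.
- by move=> j; exact: indisc_dy.
- move=> j ji; rewrite /half_start -addnA dyE//.
  by rewrite expnS mul2n -addnn; case: b; rewrite ?mul1n ?mul0n ?ltn_add2l// ltn_addl.
Qed.

(** A truncation in the second half is the whole first half plus a truncation of the
    second, up to a unimodular factor. *)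
Lemma block_le c i m t : (m <= 2 ^ i.+1)%N ->
  normc (psum dy c (lev i.+1) (lev i.+1 + m) (cis t)) <=
  half_max c i false t + half_max c i true t.
Proof.
move=> mi; have x1 := normc_cis t; have id := indisc_dy R.
have half b n : (n <= 2 ^ i)%N ->
    normc (psum dy c (half_start i b) (half_start i b + n) (cis t)) <= half_max c i b t.
  move=> ni; rewrite normc_psum_shift//.
  apply: (@bigmax_seq_ge _ _ _ (fun m => normc (psum (fun j => dy (half_start i b + j))
    (fun j => c (half_start i b + j)%N) 0 m (cis t)))).
  by rewrite mem_index_iota ltnS.
have h0 : half_start i false = lev i.+1 by rewrite /half_start mul0n addn0.
have h1 : half_start i true = (lev i.+1 + 2 ^ i)%N by rewrite /half_start mul1n.
have [mK|Km] := leqP m (2 ^ i).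
  by have := half false m mK; rewrite h0; have := half_max_ge0 c i true t; lra.
rewrite (@psum_cat _ _ _ _ (lev i.+1 + 2 ^ i)); last by rewrite leq_addr leq_add2l ltnW.
apply: (le_trans (normcD _ _)); apply: lerD.
  by have := half false _ (leqnn _); rewrite h0.
have := half true (m - 2 ^ i)%N; rewrite h1 -addnA subnKC; last exact: ltnW.
by apply; rewrite leq_subLR addnn -mul2n -expnS.
Qed.

Definition maximal_const : R := 3 * lacunary_const R + 3 * half_level_const R.

Lemma half_level_const_ge0 : 0 <= half_level_const R.
Proof.
have t4 : 0 <= 10 ^+ 4 :> R by apply: exprn_ge0; exact: ler0n.
have m2 (n : nat) (x : R) : 0 <= n%:R * x ^+ 2 := mulr_ge0 (ler0n _ n) (sqr_ge0 x).
exact: addr_ge0 (ler0n _ 2) (mulr_ge0 (m2 _ _) (mulr_ge0 t4 (addr_ge0 (m2 _ _) (m2 _ _)))).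
Qed.

Lemma maximal_levels c s L : cis s = 1 :> R[i] ->
  mean s (fun t => (\big[Num.max/0]_(0 <= n < (lev L).+1) normc (psum dy c 0 n (cis t))) ^+ 2)
  <= maximal_const * \sum_(0 <= j < lev L) normc (c j) ^+ 2.
Proof.
move=> s1; have id := indisc_dy R.
pose E t := \big[Num.max/0]_(0 <= k < L.+1) normc (psum dy c 0 (lev k) (cis t)).
pose H i t := half_max c i false t ^+ 2 + half_max c i true t ^+ 2.
(* Taking the sum over all levels instead of a maximum loses nothing, since the
   levels use disjoint coefficients. *)
pose HS t := \sum_(0 <= i < L.-1) H i t.
have cH b i : continuous (fun t => half_max c i b t ^+ 2).
  by apply: contX; exact: cont_half_max.
have cHi i : continuous (H i) by exact: contD.
have cHS : continuous HS by exact: cont_sum.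
have H0 i t : 0 <= H i t by rewrite addr_ge0// sqr_ge0.
have HS0 t : 0 <= HS t by exact: sumr_ge0.
have cpsum n : continuous (fun t => normc (psum dy c 0 n (cis t))).
  by apply: cont_normc; exact: ccont_psum.
have cE2 : continuous (fun t => E t ^+ 2).
  by apply: contX; apply: cont_bigmax => k; exact: cpsum.
have Ek t k : (k <= L)%N -> normc (psum dy c 0 (lev k) (cis t)) <= E t.
  move=> kL; apply: (@bigmax_seq_ge _ _ _ (fun k => normc (psum dy c 0 (lev k) (cis t)))).
  by rewrite mem_index_iota ltnS.
have E0 t : 0 <= E t by exact: bigmax_seq_ge0.
have pw n t : (n <= lev L)%N ->
    normc (psum dy c 0 n (cis t)) ^+ 2 <= 3 * E t ^+ 2 + 3 * HS t.
  rewrite leq_eqVlt => /orP[/eqP->|nL].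
    have : normc (psum dy c 0 (lev L) (cis t)) ^+ 2 <= E t ^+ 2.
      by rewrite ler_sqr ?nnegrE ?normc_ge0// Ek.
    by have := HS0 t; have := sqr_ge0 (E t); lra.
  pose k := trunc_log 2 n.+1.
  have /andP[k1 k2] := @trunc_log_bounds 2 n.+1 isT isT; rewrite -/k in k1 k2.
  have kL : (k < L)%N.
    by rewrite -(@ltn_exp2l 2)// (leq_ltn_trans k1)// -levE ltnS.
  have kn : (lev k <= n)%N by rewrite -ltnS levE.
  have nE : n = (lev k + (n - lev k))%N by rewrite subnKC.
  have mk : (n - lev k < 2 ^ k)%N.
    by rewrite ltn_subLR// -levS -ltnS levE.
  move: nE mk; set m := (n - lev k)%N => nE mk; clearbody m.
  have bound : normc (psum dy c (lev k) (lev k + m) (cis t)) <= 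
      (if k is i.+1 then half_max c i false t + half_max c i true t else 0).
    case: (k) mk => [|i] mk; last by apply: block_le; exact: ltnW.
    by move: mk; rewrite expn0 ltnS leqn0 => /eqP->; rewrite addn0 /psum big_geq// normc0.
  have hk : normc (psum dy c 0 n (cis t)) <= E t +
      (if k is i.+1 then half_max c i false t + half_max c i true t else 0).
    rewrite nE (@psum_cat _ dy c 0 (lev k)) ?leq_addr//.
    apply: (le_trans (normcD _ _)); apply: lerD => //.
    by apply: Ek; exact: ltnW.
  have n0 := normc_ge0 (psum dy c 0 n (cis t)).
  move: hk kL n0; move: (normc _) => a; case: (k) => [|i] hk kL n0.
    have : a ^+ 2 <= E t ^+ 2 by rewrite ler_sqr ?nnegrE//; lra.
    by have := HS0 t; have := sqr_ge0 (E t); lra.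
  have iHS : H i t <= HS t.
    have iL : i \in index_iota 0 L.-1 by rewrite mem_index_iota; lia.
    by rewrite /HS (big_rem i)//= lerDl; apply: sumr_ge0.
  have := half_max_ge0 c i false t; have := half_max_ge0 c i true t.
  move: iHS hk; rewrite /H; move: (half_max _ _ _ _) (half_max _ _ _ _) => h g hS hk g0 h0.
  have e0 := E0 t; have : a ^+ 2 <= (E t + (g + h)) ^+ 2.
    by rewrite ler_sqr ?nnegrE// !addr_ge0.
  have := sqr_ge0 (E t - h); have := sqr_ge0 (E t - g); have := sqr_ge0 (h - g); lra.
apply: (@le_trans _ _ (mean s (fun t => 3 * E t ^+ 2 + 3 * HS t))).
  apply: avg_le; first exact: mean_lt.
  - by apply: contX; apply: cont_bigmax.
  - by apply: contD; apply: contM => //; exact: cont_cst.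
  move=> t _; have F0 n : n \in index_iota 0 (lev L).+1 ->
      0 <= normc (psum dy c 0 n (cis t)) by move=> _; exact: normc_ge0.
  have i0 : 0%N \in index_iota 0 (lev L).+1 by rewrite mem_index_iota.
  have [n nin ->] := bigmax_seq_attained F0 i0.
  by apply: pw; move: nin; rewrite mem_index_iota ltnS.
have c3E : continuous (fun t => 3 * E t ^+ 2) by apply: contM => //; exact: cont_cst.
have c3H : continuous (fun t => 3 * HS t) by apply: contM => //; exact: cont_cst.
rewrite /mean avgD// !avgZ// -!/(mean s _) /maximal_const [leRHS]mulrDl.
apply: lerD; first by rewrite -[leRHS]mulrA ler_wpM2l//; exact: lacunary_maximal.
rewrite -[leRHS]mulrA ler_wpM2l// /mean /HS avg_sum// -!/(mean s _).
have mH i : mean s (H i) <= half_level_const R *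
    \sum_(lev i.+1 <= j < lev i.+2) normc (c j) ^+ 2.
  rewrite /mean /H avgD//.
  apply: (le_trans (lerD (mean_half_max c i false s1) (mean_half_max c i true s1))).
  rewrite -mulrDr ler_wpM2l ?half_level_const_ge0// le_eqVlt; apply/orP; left; apply/eqP.
  have shift a n : \sum_(a <= j < a + n) normc (c j) ^+ 2 =
      \sum_(0 <= j < n) normc (c (a + j)%N) ^+ 2.
    by rewrite -{1}[a]add0n big_addn addKn; apply: eq_bigr => j _; rewrite addnC.
  have e0 : half_start i false = lev i.+1 by rewrite /half_start mul0n addn0.
  have e1 : half_start i true = (lev i.+1 + 2 ^ i)%N by rewrite /half_start mul1n.
  have e2 : lev i.+2 = (half_start i true + 2 ^ i)%N.
    by rewrite levS e1 -addnA addnn -mul2n -expnS.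
  rewrite (@big_cat_nat _ _ _ (half_start i true) (lev i.+1))//=; first last.
  - by rewrite e2 leq_addr.
  - by rewrite e1 leq_addr.
  by rewrite e2 [X in _ = _ + X]shift; congr (_ + _); rewrite e1 -shift e0.
apply: (@le_trans _ _ (\sum_(0 <= i < L.-1) half_level_const R *
    \sum_(lev i.+1 <= j < lev i.+2) normc (c j) ^+ 2)).
  by apply: ler_sum => i _; exact: mH.
rewrite -mulr_sumr ler_wpM2l ?half_level_const_ge0//.
case: L {E HS cHS HS0 cE2 Ek E0 pw c3E c3H} => [|L]; first by rewrite !big_geq.
rewrite sum_levels [leRHS]big_nat_recl//= lerDr.
by apply: sumr_ge0 => j _; exact: sqr_ge0.
Qed.

(** Any length is the beginning of a sum over complete levels, with zero
    coefficients at the end. *)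
Theorem finite_maximal c s M : cis s = 1 :> R[i] ->
  mean s (fun t => (\big[Num.max/0]_(0 <= n < M.+1) normc (psum dy c 0 n (cis t))) ^+ 2)
  <= maximal_const * \sum_(0 <= j < M) normc (c j) ^+ 2.
Proof.
move=> s1; pose d j := if (j < M)%N then c j else 0.
have Mlev : (M <= lev M)%N by rewrite -ltnS levE ltn_expl.
have := maximal_levels d M s1.
have -> : \sum_(0 <= j < lev M) normc (d j) ^+ 2 = \sum_(0 <= j < M) normc (c j) ^+ 2.
  rewrite (@big_cat_nat _ _ _ M)//= [X in _ + X]big_nat [X in _ + X]big1 ?addr0; last first.
    by move=> j /andP[Mj _]; rewrite /d ltnNge Mj normc0 expr0n.
  by apply: eq_big_nat => j /andP[_ jM]; rewrite /d jM.
apply: le_trans; apply: avg_le; first exact: mean_lt.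
- apply: contX; apply: cont_bigmax => n; apply: cont_normc.
  by apply: ccont_psum; exact: indisc_dy.
- apply: contX; apply: cont_bigmax => n; apply: cont_normc.
  by apply: ccont_psum; exact: indisc_dy.
move=> t _; rewrite ler_sqr ?nnegrE ?bigmax_seq_ge0//.
apply: bigmax_seq_le => [|n]; first exact: bigmax_seq_ge0.
rewrite mem_index_iota ltnS => /andP[_ nM].
have -> : psum dy c 0 n (cis t) = psum dy d 0 n (cis t).
  by apply: eq_big_nat => j /andP[_ jn]; rewrite /d (leq_trans jn nM).
apply: (@bigmax_seq_ge _ _ _ (fun n => normc (psum dy d 0 n (cis t)))).
by rewrite mem_index_iota ltnS (leq_trans nM).
Qed.

End Assembly.

(** * Infinite expansions *)

Section MaximalFunction.
Variable R : realType.
Implicit Types (c : nat -> R[i]) (s t : R).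
Local Notation dy := (dy R).
Local Notation mu := (@lebesgue_measure R).
Local Notation T := (2 * pi : R).

Definition prefix_max c M t : R :=
  \big[Num.max/0]_(0 <= n < M.+1) normc (psum dy c 0 n (cis t)).

(** The square is taken inside the supremum so that the function is a monotone limit
    of continuous functions. *)
Definition maximal_sqr c t : \bar R :=
  ereal_sup (range (fun M => (prefix_max c M t ^+ 2)%:E)).

(** Unions of whole periods around 0: they start where cis is 1, they contain
    the period from - pi to pi, and they exhaust the line. *)
Definition periods n : set R := `[- (n%:R * T), n%:R * T].

Lemma cis_period n : cis (n%:R * T) = 1 /\ cis (- (n%:R * T)) = 1.
Proof. by rewrite cisN -cisX cis2pi expr1n conj1. Qed.

Lemma maximal_const_ge0 : 0 <= maximal_const R.
Proof.
have h := half_level_const_ge0 R.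
have h1 : 0 <= radial_const R.
  by rewrite mulr_ge0 ?sqr_ge0 ?exprn_ge0.
have h2 : 0 <= reflection_const R by rewrite mulr_ge0 ?expR_ge0.
rewrite /maximal_const /lacunary_const; lra.
Qed.

Lemma integral_periods (h : R -> R) B n : continuous h ->
  (forall s, cis s = 1 :> R[i] -> mean s h <= B) ->
  \int[mu]_(t in periods n) h t <= 2 * n%:R * T * B.
Proof.
move=> ch hB; have T0 := twopi_gt0 R.
have one s : cis s = 1 :> R[i] -> \int[mu]_(t in `[s, s + T]) h t <= T * B.
  move=> /hB; rewrite /mean /avg addrAC subrr add0r.
  by rewrite -(ler_pM2l T0) mulrA mulfV ?gt_eqF// mul1r.
elim: n => [|n IH].
  by rewrite /periods mul0r oppr0 set_itv1 Rintegral_set1 mulr0 !mul0r.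
have [cp cn] := cis_period n; have [cp1 cn1] := cis_period n.+1.
have nT : 0 <= n%:R * T by rewrite mulr_ge0// ltW.
have eT : n.+1%:R * T = n%:R * T + T by rewrite -natr1 mulrDl mul1r.
rewrite /periods (@Rintegral_split _ h _ _ (- (n%:R * T)))//; last first.
  by rewrite eT; apply/andP; split; lra.
rewrite (@Rintegral_split _ h (- (n%:R * T)) _ (n%:R * T))//; last first.
  by rewrite eT; apply/andP; split; lra.
have e1 : - (n%:R * T) = - (n.+1%:R * T) + T by rewrite eT; ring.
have := one _ cn1; rewrite -e1; have := one _ cp; rewrite -eT.
move: IH; rewrite /periods.
have -> : 2 * n.+1%:R * T * B = 2 * n%:R * T * B + 2 * (T * B) by rewrite -natr1; ring.
lra.
Qed.

Lemma cont_prefix_max c M : continuous (prefix_max c M).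
Proof.
apply: cont_bigmax => n; apply: cont_normc; apply: ccont_psum; exact: indisc_dy.
Qed.

Lemma prefix_max_ge0 c M t : 0 <= prefix_max c M t.
Proof. exact: bigmax_seq_ge0. Qed.

Lemma prefix_max_nondecreasing c t : nondecreasing_seq (fun M => (prefix_max c M t ^+ 2)%:E).
Proof.
move=> M M' MM; rewrite lee_fin ler_sqr ?nnegrE ?prefix_max_ge0//.
apply: bigmax_seq_le => [|n]; first exact: prefix_max_ge0.
rewrite mem_index_iota ltnS => /andP[_ nM].
apply: (@bigmax_seq_ge _ _ _ (fun n => normc (psum dy c 0 n (cis t)))).
by rewrite mem_index_iota ltnS (leq_trans nM).
Qed.

Lemma maximal_sqr_cvg c t : (prefix_max c M t ^+ 2)%:E @[M --> \oo] --> maximal_sqr c t.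
Proof. exact: ereal_nondecreasing_cvgn (@prefix_max_nondecreasing c t). Qed.

Lemma maximal_sqr_ge c t n :
  ((normc (psum dy c 0 n (cis t)) ^+ 2)%:E <= maximal_sqr c t)%E.
Proof.
apply: (@le_trans _ _ (prefix_max c n t ^+ 2)%:E); last first.
  by apply: ereal_sup_ubound; exists n.
rewrite lee_fin ler_sqr ?nnegrE ?prefix_max_ge0 ?normc_ge0//.
apply: (@bigmax_seq_ge _ _ _ (fun n => normc (psum dy c 0 n (cis t)))).
by rewrite mem_index_iota ltnS leqnn.
Qed.

Lemma maximal_sqr_ge0 c t : (0 <= maximal_sqr c t)%E.
Proof. by apply: le_trans (maximal_sqr_ge c t 0); rewrite lee_fin sqr_ge0. Qed.

Lemma measurable_prefix c M (D : set R) :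
  measurable_fun D (EFin \o (fun t => prefix_max c M t ^+ 2)).
Proof.
apply/measurable_EFinP; apply: measurable_funTS; apply: continuous_measurable_fun.
by apply: contX; exact: cont_prefix_max.
Qed.

Lemma measurable_maximal_sqr c (D : set R) : measurable D -> measurable_fun D (maximal_sqr c).
Proof.
move=> mD; apply: (emeasurable_fun_cvg (fun M t => (prefix_max c M t ^+ 2)%:E)).
  by move=> M; exact: measurable_prefix.
by move=> t _; exact: maximal_sqr_cvg.
Qed.

(** The maximal inequality for infinite coefficient sequences, by monotone
    convergence. *)
Lemma integral_maximal_sqr c A n :
  (forall M, \sum_(0 <= j < M) normc (c j) ^+ 2 <= A) ->
  (\int[mu]_(t in periods n) maximal_sqr c t <=
    (2 * n%:R * T * (maximal_const R * A))%:E)%E.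
Proof.
move=> cA; have mD : measurable (periods n) by exact: measurable_itv.
have -> : (\int[mu]_(t in periods n) maximal_sqr c t =
    \int[mu]_(t in periods n) limn (fun M => (prefix_max c M t ^+ 2)%:E))%E.
  by apply: eq_integral => t _; apply/esym/cvg_lim => //; exact: maximal_sqr_cvg.
have H := @cvg_monotone_convergence _ _ _ mu _ mD
  (fun M t => (prefix_max c M t ^+ 2)%:E).
have {}H := H (fun M => @measurable_prefix c M (periods n)).
rewrite -(cvg_lim _ (H _ _))//; first last.
- by move=> t _; exact: prefix_max_nondecreasing.
- by move=> M t _; rewrite lee_fin sqr_ge0.
apply: lime_le.
  apply/cvg_ex; eexists; apply: H.
  - by move=> M t _; rewrite lee_fin sqr_ge0.
  - by move=> t _; exact: prefix_max_nondecreasing.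
apply: nearW => M; have ch : continuous (fun t => prefix_max c M t ^+ 2).
  by apply: contX; exact: cont_prefix_max.
have iP := @cont_integrable R _ (- (n%:R * T)) (n%:R * T) ch.
have /fineK <- : (\int[mu]_(t in periods n) (prefix_max c M t ^+ 2)%:E)%E \is a fin_num.
  by apply: integrable_fin_num; [exact: mD|exact: iP].
rewrite lee_fin; apply: (@integral_periods (fun t => prefix_max c M t ^+ 2)) => // s s1.
apply: (le_trans (finite_maximal c M s1)).
by rewrite ler_wpM2l// maximal_const_ge0.
Qed.

End MaximalFunction.

(** * The Bessel inequality *)

Section Bessel.
Variable R : realType.
Variable f : R[i] -> R[i].
Hypothesis L2f : L2_circle f.
Local Notation mu := (@lebesgue_measure R).
Local Notation D := (`[- pi, pi]%classic : set R).
Local Notation dy := (dy R).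
Let F2 t := normc (f (cis t)) ^+ 2.

Definition mt_coef (j : nat) : R[i] := inner f (MT (@dyadic_points R) j).

Definition energy : R := (2 * pi)^-1 * \int[mu]_(t in D) F2 t.

Lemma MT_mt n z : MT (@dyadic_points R) n z = mt dy n z.
Proof. by rewrite /MT /mt /blaschke /bprod big_add1. Qed.

Lemma MT_partial_sumE n x :
  MT_partial_sum (@dyadic_points R) f n x = psum dy mt_coef 0 n.+1 (cis x).
Proof. by apply: eq_bigr => j _; rewrite MT_mt. Qed.

Let mD : measurable D. Proof. exact: measurable_itv. Qed.

Let twopiV : 0 < (2 * pi)^-1 :> R. Proof. by rewrite invr_gt0 twopi_gt0. Qed.

Let mF2 : measurable_fun D F2.
Proof.
have [mu1 mu2 _] := L2f; apply: measurable_funTS.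
rewrite (_ : F2 = fun t => complex.Re (f (cis t)) ^+ 2 + complex.Im (f (cis t)) ^+ 2).
  by apply: measurable_funD; apply: measurable_funX.
by apply/funext => t; rewrite /F2 sqr_normcE.
Qed.

Let integrable_add (g h : R -> R) : mu.-integrable D (EFin \o g) ->
  mu.-integrable D (EFin \o h) -> mu.-integrable D (EFin \o (fun t => g t + h t)).
Proof.
move=> ig ih; have := integrableD _ ig ih; apply.
exact: mD.
Qed.

Let sqrE : (\int[mu]_(t in D) (`|(normc (f (cis t)))%:E| ^+ 2) = \int[mu]_(t in D) (F2 t)%:E)%E.
Proof.
by apply: eq_integral => t _; rewrite abse_EFin ger0_norm ?normc_ge0.
Qed.

Let iF2 : mu.-integrable D (EFin \o F2).
Proof.
apply/integrableP; split; first exact/measurable_EFinP.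
have [_ _] := L2f; rewrite /L2norm_circle /L2norm sqrE => h.
have n0 : 2^-1 != 0 :> R by rewrite invr_eq0.
move: {h}(lty_poweRy n0 h).
have -> : (\int[mu]_(t in D) `|(EFin \o F2) t| = \int[mu]_(t in D) (F2 t)%:E)%E.
  by apply: eq_integral => t _; rewrite /= ger0_norm// sqr_ge0.
by case: integral => [r| |]; rewrite ?ltry// gt0_muley ?lte_fin.
Qed.

Lemma L2norm_energy : L2norm_circle f = (energy%:E `^ 2^-1)%E.
Proof.
rewrite /L2norm_circle /L2norm sqrE /energy EFinM; congr (poweR (_ * _)%E _).
by rewrite /Rintegral fineK//; apply: integrable_fin_num; [exact: mD|exact: iF2].
Qed.

Lemma energy_ge0 : 0 <= energy.
Proof. by rewrite mulr_ge0 ?(ltW twopiV)//; apply: Rintegral_ge0 => t _; exact: sqr_ge0. Qed.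

Let integrable_mul (w a : R -> R) : measurable_fun setT w -> (forall t, w t ^+ 2 <= F2 t) ->
  continuous a -> mu.-integrable D (EFin \o (fun t => w t * a t)).
Proof.
move=> mw wF ca; have ca2 : continuous (fun t => a t ^+ 2) by exact: contX.
apply: (@le_integrable _ _ _ mu D mD _ (EFin \o (fun t => F2 t + a t ^+ 2))).
- apply/measurable_EFinP; apply: measurable_funTS; apply: measurable_funM => //.
  exact: continuous_measurable_fun.
- move=> t _; rewrite /= lee_fin [leRHS]ger0_norm ?addr_ge0 ?sqr_ge0//.
  have := wF t; rewrite ler_norml => h; apply/andP; split.
    by have := sqr_ge0 (w t + a t); have := sqr_ge0 (w t); have := sqr_ge0 (a t); lra.
  by have := sqr_ge0 (w t - a t); have := sqr_ge0 (w t); have := sqr_ge0 (a t); lra.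
- by apply: integrable_add; [exact: iF2|exact: cont_integrable].
Qed.

Let integrable_coef (g : R -> R[i]) : ccont g ->
  mu.-integrable D (EFin \o (fun t => complex.Re (f (cis t) * g t))) /\
  mu.-integrable D (EFin \o (fun t => complex.Im (f (cis t) * g t))).
Proof.
move=> [g1 g2]; have [m1 m2 _] := L2f.
have h1 t : complex.Re (f (cis t)) ^+ 2 <= F2 t.
  by rewrite /F2 sqr_normcE lerDl sqr_ge0.
have h2 t : complex.Im (f (cis t)) ^+ 2 <= F2 t.
  by rewrite /F2 sqr_normcE lerDr sqr_ge0.
split.
- under [X in EFin \o X]eq_fun do rewrite ReMc -mulrN.
  by apply: integrable_add; apply: integrable_mul => //; exact: contN.
- under [X in EFin \o X]eq_fun do rewrite ImMc.
  by apply: integrable_add; exact: integrable_mul.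
Qed.

Let Rintegral_sum (I : Type) (r : seq I) (F : I -> R -> R) :
  (forall i, mu.-integrable D (EFin \o F i)) ->
  mu.-integrable D (EFin \o (fun t => \sum_(i <- r) F i t)) /\
  \int[mu]_(t in D) (\sum_(i <- r) F i t) = \sum_(i <- r) \int[mu]_(t in D) F i t.
Proof.
move=> iF; elim: r => [|i r [IH1 IH2]].
  split.
    rewrite (_ : EFin \o _ = cst 0%E); first exact: integrable0.
    by apply/funext => t; rewrite /= big_nil.
  rewrite big_nil (@eq_Rintegral _ _ _ mu _ (fun=> 0)); first by rewrite Rintegral_cst// mul0r.
  by move=> t _; rewrite big_nil.
have iD := integrable_add (iF i) IH1.
split.
  by under [X in EFin \o X]eq_fun do rewrite big_cons.
rewrite big_cons -IH2 -RintegralD//.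
by apply: eq_Rintegral => t _; rewrite big_cons.
Qed.

(** Integrate 2 Re (f S^* ) <= |f|^2 + |S|^2 for the partial sum S: up to the
    normalisation, the integrals of f S^* and of |S|^2 are both the sum of the
    squared coefficients. *)
Lemma bessel M : \sum_(0 <= j < M) normc (mt_coef j) ^+ 2 <= energy.
Proof.
have id := indisc_dy R; set c := mt_coef; set S := \sum_(_ <= _ < _) _.
pose p j t := f (cis t) * (mt dy j (cis t))^*.
have ip j := integrable_coef (ccontJ (ccont_mt j id)).
pose P j := \int[mu]_(t in D) complex.Re (p j t); pose Q j := \int[mu]_(t in D) complex.Im (p j t).
have cE j : (complex.Re (c j) = (2 * pi)^-1 * P j) * (complex.Im (c j) = (2 * pi)^-1 * Q j).
  rewrite /c /mt_coef /inner ReMc ImMc /= !mul0r subr0 addr0.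
  by rewrite /P /Q /p; split; congr (_ * _); apply: eq_Rintegral => t _; rewrite MT_mt.
pose G t := \sum_(0 <= j < M) (complex.Re (c j) * complex.Re (p j t) +
  complex.Im (c j) * complex.Im (p j t)).
have iZ r (h : R -> R) : mu.-integrable D (EFin \o h) ->
    mu.-integrable D (EFin \o (fun t => r * h t)).
  by move=> ih; have := integrableZl _ r ih; apply; exact: mD.
have iT j : mu.-integrable D (EFin \o (fun t => complex.Re (c j) * complex.Re (p j t) +
    complex.Im (c j) * complex.Im (p j t))).
  have [i1 i2] := ip j.
  by apply: integrable_add; exact: iZ.
have [iG GE] := Rintegral_sum (index_iota 0 M) iT.
have {}GE : \int[mu]_(t in D) G t = 2 * pi * S.
  rewrite GE /S mulr_sumr; apply: eq_bigr => j _; have [i1 i2] := ip j.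
  rewrite (RintegralD _ (iZ _ _ i1) (iZ _ _ i2))// !RintegralZl// -/(P j) -/(Q j).
  have inv x y : x = (2 * pi)^-1 * y -> y = 2 * pi * x :> R.
    by move=> ->; rewrite mulrA mulfV ?mul1r// gt_eqF// twopi_gt0.
  rewrite sqr_normcE (inv _ _ (cE j).1) (inv _ _ (cE j).2).
  by move: (2 * pi : R) => w; ring.
have cS : continuous (fun t => normc (psum dy c 0 M (cis t)) ^+ 2).
  by apply: cont_normc2; exact: ccont_psum.
have SE : \int[mu]_(t in D) normc (psum dy c 0 M (cis t)) ^+ 2 = 2 * pi * S.
  rewrite /S -(mean_sqr_psum (- pi) c 0 M id) /mean /avg.
  have -> : - pi + 2 * pi = pi :> R by ring.
  have -> : pi - - pi = 2 * pi :> R by ring.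
  by rewrite mulrA mulfV ?mul1r// gt_eqF// twopi_gt0.
have iS := @cont_integrable R _ (- pi) pi cS.
have : \int[mu]_(t in D) (2 * G t) <=
    \int[mu]_(t in D) (F2 t + normc (psum dy c 0 M (cis t)) ^+ 2).
  apply: le_Rintegral => //; first exact: iZ.
    exact: integrable_add iF2 iS.
  move=> t _; have -> : G t = complex.Re (f (cis t) * (psum dy c 0 M (cis t))^*).
    rewrite /G /psum conj_sum mulr_sumr (big_morph _ (@ReD R) (erefl (complex.Re 0))).
    apply: eq_bigr => j _; have -> : f (cis t) * (c j * mt dy j (cis t))^* = (c j)^* * p j t.
      by rewrite conjM /p; ring.
    by rewrite [RHS]ReMc ReJ ImJ; ring.
  set w := psum _ _ _ _ _; have := sqr_ge0 (normc (f (cis t) - w)).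
  rewrite /F2 !sqr_normcE ReMc ReJ ImJ ReD ImD.
  case: (f (cis t)) => a b; case: w => a' b' /=; nra.
rewrite RintegralZl// GE RintegralD// SE => h.
rewrite /energy -(ler_pM2l (twopi_gt0 R)) [leRHS]mulrA mulfV ?mul1r ?gt_eqF ?twopi_gt0//.
by lra.
Qed.

End Bessel.

(** * Boundedness and convergence almost everywhere *)

Section Convergence.
Variable R : realType.
Local Notation mu := (@lebesgue_measure R).
Local Notation T := (2 * pi : R).
Local Notation dy := (dy R).

Lemma MT_maximal_sqr f x :
  (`|MT_maximal (@dyadic_points R) f x| ^+ 2 = maximal_sqr (mt_coef f) x)%E.
Proof.
set S := MT_maximal _ _ _.
have S_ge n : ((normc (psum dy (mt_coef f) 0 n.+1 (cis x)))%:E <= S)%E.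
  by rewrite -MT_partial_sumE; apply: ereal_sup_ubound; exists n.
have S0 : (0 <= S)%E by apply: le_trans (S_ge 0%N); rewrite lee_fin normc_ge0.
rewrite gee0_abs//; apply/eqP; rewrite eq_le; apply/andP; split.
- have := maximal_sqr_ge0 (mt_coef f) x; have := maximal_sqr_ge (mt_coef f) x.
  case: (maximal_sqr _ _) => [r hr r0| |]; last by []; last by move=> _ _; rewrite leey.
  have : (S <= (Num.sqrt r)%:E)%E.
    apply: ge_ereal_sup => _ [n _ <-]; rewrite MT_partial_sumE lee_fin.
    have := hr n.+1; rewrite lee_fin => h.
    rewrite -[leLHS]ger0_norm ?normc_ge0// -sqrtr_sqr.
    by rewrite ler_wsqrtr.
  move: S0; case: S {S_ge} => [t| |]//; rewrite !lee_fin => t0 tr.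
  have r0' : 0 <= r by move: r0; rewrite lee_fin.
  by rewrite -expr2 -[leRHS](sqr_sqrtr r0') ler_sqr ?nnegrE ?sqrtr_ge0.
- apply: ge_ereal_sup => _ [M _ <-].
  have F0 n : n \in index_iota 0 M.+1 -> 0 <= normc (psum dy (mt_coef f) 0 n (cis x)).
    by move=> _; exact: normc_ge0.
  have i0 : 0%N \in index_iota 0 M.+1 by rewrite mem_index_iota.
  have [n _ E] := bigmax_seq_attained F0 i0; rewrite /prefix_max E.
  have hn : ((normc (psum dy (mt_coef f) 0 n (cis x)))%:E <= S)%E.
    by case: n {E} => [|n]; [rewrite /psum big_geq// normc0|exact: S_ge].
  move: S0 hn; case: S {S_ge} => [t| |]//; rewrite ?leey// !lee_fin => t0 hn.
  by rewrite -expr2 ler_sqr ?nnegrE ?normc_ge0.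
Qed.

Lemma sub_periods : `[- pi, pi]%classic `<=` @periods R 1.
Proof.
move=> t; rewrite /periods /= !in_itv/= mul1r => /andP[h1 h2]; have := @pi_gt0 R => p0.
by apply/andP; split; lra.
Qed.

(** The period from - pi to pi lies in two periods that start at multiples of 2 pi,
    whence the factor 2. *)
Theorem MT_maximal_bound f : L2_circle f ->
  (L2norm (MT_maximal (@dyadic_points R) f) <=
    ((2 * maximal_const R + 1) `^ 2^-1)%:E * L2norm_circle f)%E.
Proof.
move=> L2f; have mc0 := maximal_const_ge0 R; have e0 := energy_ge0 f.
have V0 : 0 < T^-1 by rewrite invr_gt0 twopi_gt0.
rewrite (L2norm_energy L2f) -poweR_EFin -poweRM ?lee_fin//; last by lra.
rewrite /L2norm -EFinM.
have I0 : (0 <= \int[mu]_(t in `[(- pi)%R, pi])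
    (`|MT_maximal (@dyadic_points R) f t| ^+ 2))%E.
  by apply: integral_ge0 => t _; rewrite MT_maximal_sqr; exact: maximal_sqr_ge0.
apply: gt0_ler_poweR.
- by rewrite invr_ge0.
- by rewrite in_itv/= leey andbT mule_ge0// lee_fin ltW.
- by rewrite in_itv/= leey andbT lee_fin mulr_ge0//; lra.
apply: (@le_trans _ _ (T^-1%:E * (2 * 1%:R * T * (maximal_const R * energy f))%:E)%E).
  apply: lee_wpmul2l; first by rewrite lee_fin ltW.
  apply: le_trans (@integral_maximal_sqr R _ _ 1 (bessel L2f)).
  under eq_integral do rewrite MT_maximal_sqr.
  apply: ge0_subset_integral.
  - exact: measurable_itv.
  - exact: measurable_itv.
  - by apply: measurable_maximal_sqr; exact: measurable_itv.
  - by move=> t _; exact: maximal_sqr_ge0.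
  - exact: sub_periods.
rewrite -EFinM lee_fin.
have -> : T^-1 * (2 * 1 * T * (maximal_const R * energy f)) = 2 * maximal_const R * energy f.
  by rewrite mulr1 -[2 * T * _]mulrA mulrCA mulKf ?mulrA// gt_eqF// twopi_gt0.
by rewrite ler_wpM2r//; lra.
Qed.

Lemma complex_cauchy (w : nat -> R[i]) :
  (forall e : R, 0 < e -> exists m, forall n, (m <= n)%N -> normc (w n - w m) < e) ->
  exists l : R[i]^o, (fun n => w n : R[i]^o) @ \oo --> l.
Proof.
move=> H; have real_part (p : R[i] -> R) : (forall z v, p (z - v) = p z - p v) ->
    (forall z, `|p z| <= normc z) -> exists l : R, (fun n => p (w n)) @ \oo --> l.
  move=> pB pn; suff : cvg ((fun n => p (w n)) @ \oo) by move=> /cvg_ex.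
  apply/cauchy_cvgP/cauchy_exP => e e0; have [m hm] := H e e0.
  exists (p (w m)); exists m => // n /= mn; rewrite /ball/=.
  by rewrite -pB (le_lt_trans (pn _))// -normcN opprB; exact: hm.
have ReB z v : complex.Re (z - v : R[i]) = complex.Re z - complex.Re v by case: z; case: v.
have ImB z v : complex.Im (z - v : R[i]) = complex.Im z - complex.Im v by case: z; case: v.
have [a ha] := real_part (@complex.Re R) ReB (@Re_le_normc R).
have [b hb] := real_part (@complex.Im R) ImB (@Im_le_normc R).
exists (a +i* b : R[i]^o); apply/cvgrPdist_lt => eps eps0.
have [e e0 ->] : exists2 e : R, 0 < e & eps = e%:C.
  move: eps0; case: eps => x y; rewrite ltcE/= => /andP[/eqP -> x0].
  by exists x.
have e2 : 0 < e / 2 by rewrite divr_gt0.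
move/cvgrPdist_lt : ha => /(_ _ e2) ha; move/cvgrPdist_lt : hb => /(_ _ e2) hb.
near=> n; have -> : `|(a +i* b : R[i]^o) - w n| = (normc ((a +i* b) - w n))%:C by [].
rewrite ltcR; apply: (le_lt_trans (normc_le_ReIm _)).
have : `|a - complex.Re (w n)| < e / 2 by near: n.
have : `|b - complex.Im (w n)| < e / 2 by near: n.
case: (w n) => x y /=; lra.
Unshelve. all: by end_near. Qed.

Definition tail_coef (c : nat -> R[i]) m j := if (j < m)%N then 0 else c j.

Lemma psum_tail c m n z : (m <= n)%N ->
  psum dy (tail_coef c m) 0 n z = psum dy c 0 n z - psum dy c 0 m z.
Proof.
move=> mn; rewrite !(@psum_cat _ dy _ 0 m n)// [psum dy (tail_coef _ _) 0 m z]big_nat.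
rewrite big1 => [|j /andP[_ jm]]; last by rewrite /tail_coef jm mul0r.
rewrite add0r addrC addKr; apply: eq_big_nat => j /andP[mj _].
by rewrite /tail_coef ltnNge mj.
Qed.

Lemma tail_small (c : nat -> R[i]) A :
  (forall M, \sum_(0 <= j < M) normc (c j) ^+ 2 <= A) ->
  forall e : R, 0 < e -> exists m, forall M,
    \sum_(0 <= j < M) normc (tail_coef c m j) ^+ 2 <= e.
Proof.
move=> cA e e0; pose s M := \sum_(0 <= j < M) normc (c j) ^+ 2.
have hs : has_sup (range s).
  by split; [exists (s 0%N); exists 0%N|exists A => _ [M _ <-]; exact: cA].
have [_ [m _ <-] hm] := sup_adherent e0 hs.
exists m => M; have [Mm|mM] := leqP M m.
  rewrite big_nat big1 ?ltW// => j /andP[_ jM].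
  by rewrite /tail_coef (leq_trans jM)// normc0 expr0n.
rewrite (@big_cat_nat _ _ _ m)//=; last exact: ltnW.
rewrite big_nat big1 ?add0r; last first.
  by move=> j /andP[_ jM]; rewrite /tail_coef jM normc0 expr0n.
rewrite (eq_big_nat _ _ (F2 := fun j => normc (c j) ^+ 2)); last first.
  by move=> j /andP[mj _]; rewrite /tail_coef ltnNge mj.
have : s M <= sup (range s) by apply: sup_upper_bound => //; exists M.
by rewrite /s (@big_cat_nat _ _ _ m 0 M)//= ?(ltnW mM)// -/(s m); lra.
Qed.

(** Two partial sums beyond m differ by at most twice the maximal function of the
    tail that starts at m. *)
Lemma cvg_of_tails c x :
  einfs (fun m => maximal_sqr (tail_coef c m) x) 0%N = 0%E ->
  exists l : R[i]^o, (fun n => psum dy c 0 n.+1 (cis x) : R[i]^o) @ \oo --> l.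
Proof.
move=> H; apply: complex_cauchy => e e0.
have e2 : 0 < (e / 2) ^+ 2 by rewrite exprn_gt0// divr_gt0.
have : (einfs (fun m => maximal_sqr (tail_coef c m) x) 0%N < ((e / 2) ^+ 2)%:E)%E.
  by rewrite H lte_fin.
move=> /ereal_inf_lt[_ [m _ <-] hm].
have close n : (m <= n)%N ->
    normc (psum dy c 0 n (cis x) - psum dy c 0 m (cis x)) < e / 2.
  move=> mn; rewrite -psum_tail// -ltr_sqr ?nnegrE ?normc_ge0 ?divr_ge0 ?ltW//.
  by rewrite -lte_fin; exact: le_lt_trans (maximal_sqr_ge _ _ _) hm.
exists m => n mn; apply: (le_lt_trans (normc_triangle (psum dy c 0 m (cis x)) _ _)).
have := close n.+1 (leqW mn); have := close m.+1 (leqnSn m).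
rewrite [normc (psum dy c 0 m _ - _)]normc_distC; lra.
Qed.

(** The maximal functions of the tails have arbitrarily small integrals, so their
    infimum vanishes almost everywhere. *)
Theorem psum_cvg_ae c A : (forall M, \sum_(0 <= j < M) normc (c j) ^+ 2 <= A) ->
  {ae mu, forall x, exists l : R[i]^o,
    (fun n => psum dy c 0 n.+1 (cis x) : R[i]^o) @ \oo --> l}.
Proof.
move=> cA; pose g x := einfs (fun m => maximal_sqr (tail_coef c m) x) 0%N.
have mD n : measurable (@periods R n) by exact: measurable_itv.
have g0 x : (0 <= g x)%E.
  by apply: le_ereal_inf_tmp => _ [m _ <-]; exact: maximal_sqr_ge0.
have mg n : measurable_fun (@periods R n) g.
  by apply: measurable_fun_einfs => m; apply: measurable_maximal_sqr.
have int0 n : (\int[mu]_(x in @periods R n) `|g x| = 0)%E.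
  have -> : (\int[mu]_(x in @periods R n) `|g x| = \int[mu]_(x in @periods R n) g x)%E.
    by apply: eq_integral => x _; rewrite gee0_abs.
  apply/eqP; rewrite eq_le integral_ge0// andbT.
  apply/lee_addgt0Pr => e e0; rewrite add0e.
  have K0 : 0 <= 2 * n%:R * T * maximal_const R.
    by apply: mulr_ge0; [rewrite !mulr_ge0 ?(ltW (pi_gt0 R))|exact: maximal_const_ge0].
  have e' : 0 < e / (2 * n%:R * T * maximal_const R + 1) by rewrite divr_gt0//; lra.
  have [m hm] := tail_small cA e'.
  apply: (@le_trans _ _ (\int[mu]_(x in @periods R n) maximal_sqr (tail_coef c m) x)%E).
    apply: ge0_le_integral => //.
    - exact: mD.
    - exact: mg.
    - by apply: measurable_maximal_sqr; exact: mD.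
    - by move=> x _; apply: ereal_inf_lbound; exists m.
  apply: (le_trans (@integral_maximal_sqr R _ _ n hm)); rewrite lee_fin mulrA mulrCA.
  rewrite -[leRHS]mulr1 ler_wpM2l ?(ltW e0)// ler_pdivrMr ?mul1r; lra.
have ae0 n : {ae mu, forall x, @periods R n x -> g x = 0%E}.
  exact/(ae_eq_integral_abs mu (mD n) (mg n)).
apply: negligibleS (ae_foralln ae0) => x /=; apply: contra_not => hx; apply: cvg_of_tails.
have p2 := @pi_gt0 R; apply: (hx (Num.truncn `|x|).+1).
have h1 : `|x| <= (Num.truncn `|x|).+1%:R by rewrite ltW// truncnS_gt.
have h2 : 1 <= T by have := @pi_ge2 R; lra.
rewrite /periods /= in_itv/=.
have h3 : (Num.truncn `|x|).+1%:R <= (Num.truncn `|x|).+1%:R * T.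
  by rewrite ler_peMr.
by rewrite -ler_norml (le_trans h1).
Qed.

End Convergence.

Theorem corollary2 (R : realType) :
  (exists C : R, 0 < C /\
    forall f : R[i] -> R[i], L2_circle f ->
      (L2norm (MT_maximal (@dyadic_points R) f) <= C%:E * L2norm_circle f)%E)
  /\
  (forall f : R[i] -> R[i], L2_circle f ->
    {ae lebesgue_measure, forall x : R,
      exists l : R[i]^o,
        (fun n : nat => MT_partial_sum (@dyadic_points R) f n x : R[i]^o) @ \oo
          --> l}).
Proof.
split.
  exists ((2 * maximal_const R + 1) `^ 2^-1); split; last exact: MT_maximal_bound.
  by rewrite powR_gt0//; have := maximal_const_ge0 R; lra.
move=> f L2f; apply: negligibleS (psum_cvg_ae (bessel L2f)) => x /=.
apply: contra_not => -[l hl]; exists l.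
by under eq_fun do rewrite MT_partial_sumE.
Qed.
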